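(* Let $(X_n)_{n\in\mathbb Z}$ be the strictly stationary centered solution of $X_n=\rho(X_{n-1})+\varepsilon_n$ described in the context, and assume $\mathbf A_0$, $\mathbf A_1$, $\mathbf A_2$, $\mathbf A_3$ (listed in the context). Let $\rho_n=\Delta_n\Gamma_n^{\dagger}$ be the estimator of $\rho$ defined in the context. Then $\rho_n-\rho$ cannot, after normalization, converge in distribution to a nondegenerate limit for the norm topology on the space $\mathcal K(\mathcal H)$ of compact operators. Precisely: for every increasing real sequence $\alpha_n\uparrow+\infty$, either the sequence $\alpha_n(\rho_n-\rho)$ does not converge in distribution in $(\mathcal K(\mathcal H),\|\cdot\|_\infty)$, or it converges in distribution to the Dirac distribution at the null element of $\mathcal K(\mathcal H)$.
   Context: Setting. $\mathcal H$ is a real separable infinite-dimensional Hilbert space with scalar product $\langle\cdot,\cdot\rangle$ and norm $\|\cdot\|$; $\|T\|_\infty=\sup_{\|x\|\le 1}\|Tx\|$ is the operator norm; for $u,v\in\mathcal H$, $(u\otimes v)(h)=\langle u,h\rangle v$. $\rho$ is a compact linear operator on $\mathcal H$; $(\varepsilon_n)_{n\in\mathbb Z}$ is an i.i.d. sequence of centered $\mathcal H$-valued random elements, and $(X_n)_{n\in\mathbb Z}$ is a strictly stationary centered $\mathcal H$-valued process satisfying $X_n=\rho(X_{n-1})+\varepsilon_n$ for all $n\in\mathbb Z$, with $\varepsilon_n$ independent of $(X_m)_{m\le n-1}$. Operators. $\Gamma=\mathbb E(X_1\otimes X_1)$, with eigenvalues $\lambda_1\ge\lambda_2\ge\dots$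 (counted with multiplicity) and associated complete orthonormal system of eigenvectors $(e_l)_{l\ge1}$. Assumptions. $\mathbf A_0$: $\ker\Gamma=\{0\}$, $\mathbb E\|\varepsilon_1\|^2<\infty$, $\|\rho\|_\infty<1$. $\mathbf A_1$: $\|\Gamma^{-1/2}\rho\|_\infty<\infty$, i.e. the range of $\rho$ is contained in the range of $\Gamma^{1/2}$ and $\Gamma^{-1/2}\rho$ is a bounded operator. $\mathbf A_2$: $\sup_k\mathbb E\,\xi_k^4<\infty$, where $\xi_k=\langle X_1,e_k\rangle/\sqrt{\lambda_k}$. $\mathbf A_3$: $\lambda_j=\lambda(j)$ for a positive convex function $\lambda$ on $\mathbb R^+$ (decreasing, with limit $0$ at $+\infty$). Estimator. $\Gamma_n=\frac1n\sum_{k=1}^nX_k\otimes X_k$, with eigenvalues $\widehat\lambda_1\ge\widehat\lambda_2\ge\dots$ and associated eigenprojectors $\widehat\pi_l=\widehat e_l\otimes\widehat e_l$ for an orthonormal system $(\widehat e_l)$ of eigenvectors; $\Delta_n=\frac1{n-1}\sum_{k=1}^{n-1}X_k\otimes X_{k+1}$; $(k_n)$ is a nondecreasing sequence of positive integers tending to infinity; $\Gamma_n^\dagger=\sum_{l\le k_n}\widehat\lambda_l^{-1}\widehat\pi_l$ (with $\widehat\lambda_l^{-1}$ read as $0$ if $\widehat\lambda_l=0$); $\rho_n=\Delta_n\Gamma_n^\dagger$. *)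

(* Defs.v *)
From HB Require Import structures.
From mathcomp Require Import all_boot all_order all_algebra.
From mathcomp Require Import all_classical all_reals all_analysis.
From mathcomp Require Import ring.
Set Implicit Arguments.
Unset Strict Implicit.
Unset Printing Implicit Defensive.
Import Order.TTheory GRing.Theory Num.Theory.
Import numFieldNormedType.Exports.
Local Open Scope classical_set_scope.
Local Open Scope ring_scope.

HB.mixin Record NormedModule_hasInner (R : realType) V
    & CompleteNormedModule R V := {
  inner : V -> V -> R ;
  innerC : forall x y, inner x y = inner y x ;
  innerDl : forall x y z, inner (x + y) z = inner x z + inner y z ;
  innerZl : forall (a : R) x y, inner (a *: x) y = a * inner x y ;
  inner_norm : forall x, inner x x = `|x| ^+ 2
}.

#[short(type="hilbertType")]
HB.structure Definition Hilbert (R : realType) :=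
  {V of CompleteNormedModule R V & NormedModule_hasInner R V}.

Definition separable_space (E : topologicalType) :=
  exists2 D : set E, countable D & dense D.

Definition infinite_dimensional (R : realType) (E : lmodType R) :=
  forall (n : nat) (v : 'I_n -> E),
    exists x : E, forall c : 'I_n -> R, x <> \sum_(i < n) c i *: v i.

Section compact_operators.
Context {R : realType}.

Definition is_compact_op (E : normedModType R) (T : E -> E) : Prop :=
  linear T /\ forall B : set E, bounded_set B -> precompact (T @` B).

Definition compact_op_pred (E : normedModType R) : {pred (E -> E)} :=
  fun T => `[< is_compact_op T >].
Arguments compact_op_pred : clear implicits.

Context {E : normedModType R}.

Lemma is_compact_op0 : is_compact_op (0 : E -> E).
Proof.
split=> [a x y|B _]; first by rewrite /= scaler0 addr0.
apply: (@precompact_subset _ _ [set 0]) => [_ [x _ <-]//|].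
rewrite precompact_closed; first exact: compact_set1.
by apply: compact_closed; [exact: norm_hausdorff|exact: compact_set1].
Qed.

Lemma is_compact_opZD (a : R) (S T : E -> E) :
  is_compact_op S -> is_compact_op T -> is_compact_op (a *: S + T).
Proof.
move=> [lS cS] [lT cT]; split=> [b x y|B bB].
  by rewrite /= !fctE lS lT !scalerDr !scalerA (mulrC a b) addrACA.
have cS' := cS B bB; have cT' := cT B bB; rewrite !precompactE in cS' cT'.
pose f (p : E * E) : E := a *: p.1 + p.2.
have cf : continuous f.
  move=> p; apply: cvgD; last exact: cvg_snd.
  by apply: cvgZ; [exact: cvg_cst|exact: cvg_fst].
apply: (@precompact_subset _ _ (f @` (closure (S @` B) `*` closure (T @` B)))).
  move=> _ [x Bx <-]; exists (S x, T x) => //.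
  by split => /=; apply: subset_closure; exists x.
have cK : compact (f @` (closure (S @` B) `*` closure (T @` B))).
  apply: continuous_compact; last exact: compact_setX.
  exact: continuous_subspaceT.
rewrite precompact_closed//.
exact: (compact_closed (@norm_hausdorff _ _) cK).
Qed.

Lemma compact_op_submod : submod_closed (compact_op_pred E).
Proof.
split; first by apply/asboolP; exact: is_compact_op0.
by move=> a S T /asboolP cS /asboolP cT; apply/asboolP; exact: is_compact_opZD.
Qed.

HB.instance Definition _ :=
  GRing.isSubmodClosed.Build R (E -> E) (compact_op_pred E) compact_op_submod.

End compact_operators.
Arguments compact_op_pred {R} E _.

Record compact_op (R : realType) (E : normedModType R) := CompactOp {
  compact_op_fun :> E -> E ;
  _ : compact_op_fun \in compact_op_pred E }.

Section compact_op_normed.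
Context {R : realType} {E : normedModType R}.
Local Notation K := (compact_op E).

HB.instance Definition _ := [isSub for @compact_op_fun R E].
HB.instance Definition _ := [Choice of K by <:].
HB.instance Definition _ := [SubChoice_isSubLmodule of K by <:].

Definition opnorm (T : E -> E) : R :=
  sup [set `|T x| | x in [set x : E | `|x| <= 1]].

Lemma compact_opP (T : K) : is_compact_op T.
Proof. by case: T => T /= /asboolP. Qed.

Lemma compact_op_linear (T : K) : linear T.
Proof. by have [] := compact_opP T. Qed.

Lemma compact_op_lin0 (T : K) : T 0 = 0.
Proof.
by have /(_ (-1) 0 0) := compact_op_linear T; rewrite scaler0 addr0 scaleN1r addNr.
Qed.

Lemma compact_op_linZ (T : K) a x : T (a *: x) = a *: T x.
Proof.
by have /(_ a x 0) := compact_op_linear T; rewrite compact_op_lin0 !addr0.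
Qed.

Lemma opnorm_has_ub (T : K) :
  has_ubound [set `|T x| | x in [set x : E | `|x| <= 1]].
Proof.
have [_ cT] := compact_opP T.
have bB : bounded_set [set x : E | `|x| <= 1].
  exists 1; split; first exact: num_real.
  by move=> M M1 x /= x1; apply: le_trans x1 (ltW M1).
have := cT _ bB; rewrite precompactE => /compact_bounded [M [_ HM]].
exists (M + 1) => _ [x x1 <-].
apply: HM; first by rewrite ltrDl.
by apply: subset_closure; exists x.
Qed.

Lemma opnorm_has_sup (T : K) :
  has_sup [set `|T x| | x in [set x : E | `|x| <= 1]].
Proof.
split; last exact: opnorm_has_ub.
by exists `|T 0|; exists 0 => //=; rewrite normr0.
Qed.

Lemma opnorm_ub1 (T : K) x : `|x| <= 1 -> `|T x| <= opnorm T.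
Proof. by move=> x1; apply: ub_le_sup; [exact: opnorm_has_ub|exists x]. Qed.

Lemma opnorm_le (T : K) M :
  (forall x, `|x| <= 1 -> `|T x| <= M) -> opnorm T <= M.
Proof.
move=> TM; apply: ge_sup; first by have [] := opnorm_has_sup T.
by move=> _ [x x1 <-]; exact: TM.
Qed.

Lemma opnorm_ge0 (T : K) : 0 <= opnorm T.
Proof. by apply: le_trans (@opnorm_ub1 T 0 _); rewrite ?normr0. Qed.

Lemma ler_opnorm (T : K) x : `|T x| <= opnorm T * `|x|.
Proof.
have [->|x0] := eqVneq x 0; first by rewrite compact_op_lin0 !normr0 mulr0.
have nx : 0 < `|x| by rewrite normr_gt0.
rewrite -ler_pdivrMr// mulrC -[_^-1]ger0_norm ?invr_ge0//.
rewrite -normrZ -compact_op_linZ; apply: opnorm_ub1.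
by rewrite normrZ ger0_norm ?invr_ge0// mulVf ?gt_eqF.
Qed.

Lemma opnormD (S T : K) : opnorm (S + T : K) <= opnorm S + opnorm T.
Proof.
apply: opnorm_le => x x1.
by apply: le_trans (ler_normD _ _) _; apply: lerD; exact: opnorm_ub1.
Qed.

Lemma opnormZ (a : R) (T : K) : opnorm (a *: T : K) = `|a| * opnorm T.
Proof.
have ub (b : R) (S : K) : opnorm (b *: S : K) <= `|b| * opnorm S.
  apply: opnorm_le => x x1; rewrite /= fctE normrZ.
  by apply: ler_wpM2l => //; exact: opnorm_ub1.
apply/eqP; rewrite eq_le ub andTb.
have [->|a0] := eqVneq a 0; first by rewrite normr0 mul0r; exact: opnorm_ge0.
have := ub a^-1 (a *: T); rewrite scalerA mulVf// scale1r normfV.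
by rewrite mulrC ler_pdivlMr ?normr_gt0// mulrC.
Qed.

Lemma opnorm0_eq0 (T : K) : opnorm T = 0 -> T = 0.
Proof.
move=> T0; apply/val_inj/funext => x /=.
by apply/eqP; rewrite -normr_le0; have := ler_opnorm T x; rewrite T0 mul0r.
Qed.

HB.instance Definition _ :=
  @Lmodule_isNormed.Build R K (fun T => opnorm T) opnormD opnormZ opnorm0_eq0.

Lemma compact_op_norm (T : K) : `|T| = opnorm T. Proof. by []. Qed.

Lemma comp_op_compact (S T : K) : (S \o T : E -> E) \in compact_op_pred E.
Proof.
apply/asboolP; split=> [a x y|B [M [_ HM]]].
  by rewrite /= !compact_op_linear.
have [_ cS] := compact_opP S; rewrite -image_comp.
apply: cS; exists (opnorm T * (M + 1)); split; first exact: num_real.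
move=> N NM _ [x Bx <-]; apply: le_trans (ltW NM).
apply: le_trans (ler_opnorm _ _) _; apply: ler_wpM2l; first exact: opnorm_ge0.
by apply: HM => //; rewrite ltrDl.
Qed.

Definition comp_op (S T : K) : K := CompactOp (comp_op_compact S T).

End compact_op_normed.

Section hilbert.
Context {R : realType} {H : hilbertType R}.

Lemma innerDr (x y z : H) : inner x (y + z) = inner x y + inner x z.
Proof. by rewrite innerC innerDl !(innerC x). Qed.

Lemma innerZr (a : R) (x y : H) : inner x (a *: y) = a * inner x y.
Proof. by rewrite innerC innerZl innerC. Qed.

Lemma inner_CauchySchwarz (x y : H) : `|inner x y| <= `|x| * `|y|.
Proof.
have [->|y0] := eqVneq y 0.
  by rewrite -(scale0r (0 : H)) innerZr mul0r !normr0 mulr_ge0.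
have ny : 0 < `|y| ^+ 2 by rewrite exprn_gt0// normr_gt0.
rewrite -(@ler_pXn2r _ 2)// ?nnegrE ?mulr_ge0// exprMn -normrX ger0_norm ?sqr_ge0//.
pose t := inner x y / `|y| ^+ 2.
have := sqr_ge0 (`|x + (- t) *: y|).
rewrite -inner_norm !(innerDl, innerDr, innerZl, innerZr) !inner_norm (innerC y x).
have e : inner x y = t * `|y| ^+ 2 by rewrite /t divfK ?gt_eqF.
rewrite e => h.
have tx : t ^+ 2 * `|y| ^+ 2 <= `|x| ^+ 2.
  by rewrite -subr_ge0; apply: (le_trans h); rewrite le_eqVlt; apply/orP; left;
    apply/eqP; ring.
rewrite [X in X <= _](_ : _ = t ^+ 2 * `|y| ^+ 2 * `|y| ^+ 2); last by ring.
by rewrite ler_pM2r.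
Qed.

Lemma tensor_compact (u v : H) :
  (fun h => inner u h *: v) \in compact_op_pred H.
Proof.
apply/asboolP; split=> [a x y|B [M [_ HM]]].
  by rewrite /= innerDr innerZr scalerDl scalerA.
pose f (t : R) : H := t *: v.
have cf : continuous f by move=> t; apply: cvgZ; [exact: cvg_id|exact: cvg_cst].
pose C := `|u| * (M + 1).
have cK : compact (f @` `[- C, C]).
  by apply: continuous_compact; [exact: continuous_subspaceT|exact: segment_compact].
apply: (@precompact_subset _ _ (f @` `[- C, C])) => [_ [x Bx <-]|].
  exists (inner u x) => //=; rewrite in_itv/= -ler_norml.
  apply: le_trans (inner_CauchySchwarz _ _) _; apply: ler_wpM2l => //.
  by apply: HM => //; rewrite ltrDl.
by rewrite precompact_closed//; exact: (compact_closed (@norm_hausdorff _ _) cK).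
Qed.

Definition tensor (u v : H) : compact_op H := CompactOp (tensor_compact u v).

Definition orthonormal_seq (e : nat -> H) :=
  forall i j, inner (e i) (e j) = (i == j)%:R.

Definition complete_orthonormal (e : nat -> H) :=
  orthonormal_seq e /\ forall x, (forall l, inner (e l) x = 0) -> x = 0.

(* The last clause says that no nonzero eigenvalue, counted with its
   multiplicity, is missing from [lam]; for an operator of finite rank the
   sequence [lam] is eventually 0. *)
Definition eigensystem (T : H -> H) (lam : nat -> R) (e : nat -> H) :=
  [/\ orthonormal_seq e,
      forall l, T (e l) = lam l *: e l,
      {homo lam : i j / (i <= j)%N >-> j <= i} &
      forall x, (forall l, inner (e l) x = 0) -> T x = 0].

Definition positive_sqrt (T S : H -> H) :=
  [/\ linear S /\ continuous S,
      forall x y, inner (S x) y = inner x (S y),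
      forall x, 0 <= inner (S x) x &
      forall x, S (S x) = T x].

(* With [S] injective, [S^-1 T] is everywhere defined and bounded. *)
Definition bounded_inv_comp (S T : H -> H) :=
  (forall x, exists y, S y = T x) /\
  exists C : R, forall x y, S y = T x -> `|y| <= C * `|x|.

End hilbert.

Definition borel (E : ptopologicalType) := g_sigma_algebraType (@open E).

Section random_elements.
Context {d : measure_display} {Omega : measurableType d} {R : realType}.
Variable P : probability Omega R.

Definition random_element (E : ptopologicalType) (Z : Omega -> E) :=
  measurable_fun [set: Omega] (Z : Omega -> borel E).

Definition same_law (E : topologicalType) (Y Z : Omega -> E) :=
  forall A : set E, <<s @open E >> A -> P (Y @^-1` A) = P (Z @^-1` A).

(* The mean is characterized weakly, which for an integrable norm is the
   Bochner integral. *)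
Definition is_mean (H : hilbertType R) (Z : Omega -> H) (m : H) :=
  P.-integrable [set: Omega] (fun w => `|Z w|%:E) /\
  forall h, (\int[P]_w (inner h (Z w))%:E = (inner h m)%:E)%E.

Definition is_mean_op (H : hilbertType R) (Z : Omega -> compact_op H)
    (G : H -> H) :=
  P.-integrable [set: Omega] (fun w => `|Z w|%:E) /\
  forall h, is_mean (fun w => Z w h) (G h).

Definition mutually_independent (E : ptopologicalType)
    (Y : int -> Omega -> E) :=
  forall (s : seq int) (A : int -> set (borel E)), uniq s ->
    (forall n, measurable (A n)) ->
    P (\bigcap_(n in [set` s]) (Y n @^-1` A n)) =
    (\prod_(n <- s) P (Y n @^-1` A n))%E.

Definition iid (E : ptopologicalType) (Y : int -> Omega -> E) :=
  mutually_independent Y /\ forall n m, same_law (Y n) (Y m).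

Definition sigma_upto (E : ptopologicalType) (Y : int -> Omega -> E)
    (n : int) : set (set Omega) :=
  <<s \bigcup_(m in [set m : int | m <= n])
        preimage_set_system [set: Omega] (Y m : Omega -> borel E) measurable >>.

Definition independent_of_past (E : ptopologicalType)
    (Z : Omega -> E) (Y : int -> Omega -> E) (n : int) :=
  forall (A : set (borel E)) (B : set Omega), measurable A -> sigma_upto Y n B ->
    P ((Z @^-1` A) `&` B) = (P (Z @^-1` A) * P B)%E.

(* The joint laws are compared on the Borel sets of the finite power of [E]
   with its product topology. *)
Definition strictly_stationary (E : ptopologicalType)
    (Y : int -> Omega -> E) :=
  forall (m : nat) (t : 'I_m -> int) (h : int),
    same_law
      (fun w => (fun i => Y (t i) w) : {ptws 'I_m -> E})
      (fun w => (fun i => Y (t i + h) w) : {ptws 'I_m -> E}).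

Definition cvg_in_law (E : normedModType R) (Z : nat -> Omega -> E)
    (mu : probability (borel E) R) :=
  forall f : E -> R, continuous f -> (exists M, forall x, `|f x| <= M) ->
    (\int[P]_w (f (Z n w))%:E)%E @[n --> \oo] --> (\int[mu]_x (f x)%:E)%E.

End random_elements.

Section estimator.
Context {R : realType} {H : hilbertType R} {Omega : Type}.
Implicit Types X : int -> Omega -> H.

Definition emp_cov X (n : nat) (w : Omega) : compact_op H :=
  n%:R^-1 *: \sum_(1 <= k < n.+1) tensor (X k%:Z w) (X k%:Z w).

Definition emp_cross X (n : nat) (w : Omega) : compact_op H :=
  (n.-1)%:R^-1 *: \sum_(1 <= k < n) tensor (X k%:Z w) (X k.+1%:Z w).

(* The library convention [0^-1 = 0] is the one required here. *)
Definition trunc_inv (k : nat) (lam : nat -> R) (e : nat -> H) : compact_op H :=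
  \sum_(l < k) (lam l)^-1 *: tensor (e l) (e l).

Definition rho_est X (k : nat -> nat) (lamh : nat -> nat -> Omega -> R)
    (eh : nat -> nat -> Omega -> H) (n : nat) (w : Omega) : compact_op H :=
  comp_op (emp_cross X n w)
    (trunc_inv (k n) (fun l => lamh n l w) (fun l => eh n l w)).

End estimator.

(* Main.v *)
Require Import Defs.
From HB Require Import structures.
From mathcomp Require Import all_boot all_order all_algebra.
From mathcomp Require Import all_classical all_reals all_analysis.
From mathcomp Require Import measurable_realfun.
From mathcomp Require Import ring lra.
Set Implicit Arguments.
Unset Strict Implicit.
Unset Printing Implicit Defensive.
Import Order.TTheory GRing.Theory Num.Theory.
Import numFieldNormedType.Exports.
Local Open Scope classical_set_scope.
Local Open Scope ring_scope.

(* Put U_n = Delta_n - rho Gamma_n, which up to an edge term of order 1/n is an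
   average of martingale differences, and let Q project onto the first k_n
   empirical eigenvectors. Evaluating rho_n - rho at Gamma_n Q e_l instead of
   e_l removes the truncation bias: (rho_n - rho) Gamma_n Q e_l = U_n Q e_l up to
   the edge term. Whatever the growth of k_n, Gamma_n Q e_l tends to lam_l e_l and
   Q e_l to e_l in probability, because k_n times the k_n-th empirical eigenvalue
   is at most the trace of Gamma_n, and Gamma_n e_l tends to lam_l e_l. The last
   point follows from q(x) = n^-1 sum_j <x, X_j>^2, which satisfies
   q(x) = q(rho^* x) + (averages of martingale differences and a constant), by
   iterating, since |rho| < 1. Hence lam_l <(rho_n - rho) e_l, y> equals
   <U_n e_l, y> up to negligible terms, and sqrt n <U_n e_l, y> is bounded in
   probability.

   Assume that alpha_n (rho_n - rho) converges in law. If alpha_n is infinitely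
   often below c sqrt n for every c > 0, then every coefficient of the limit
   vanishes. Otherwise sqrt n |rho_n - rho| is bounded in probability, so
   sqrt n <U_n e_l, y> / lam_l is bounded in probability uniformly in l. But its
   second moment is of order 1 / lam_l and its fourth moment of order
   1 / lam_l^2, so by the Paley-Zygmund inequality it exceeds a multiple of
   1 / sqrt lam_l with a probability bounded away from 0, which is absurd as
   lam_l tends to 0. *)

(** * Orthonormal expansions and adjoints *)

(** Two kinds of error separate lam_l <(rho_n - rho) e_l, y> from <U_n e_l, y>: |rho_n - rho| times
    a negligible factor, which the assumed convergence controls only after multiplication by
    alpha_n, and |U_n| times a negligible factor, which is controlled at the rate sqrt n.
    Multiplying by the smaller of |alpha_n| and sqrt n makes both negligible whichever rate is the
    smaller, so one estimate serves both cases. In the case of small alpha_n the coefficients are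
    shown to vanish only along infinitely many n; this suffices because the whole sequence is
    assumed to converge in law. Nothing says that the empirical eigenvectors are measurable in the
    sample point, so quantities built from them are bounded outside a measurable exceptional event
    rather than integrated; expectations are taken only of functions of X and, at the end, of
    rho_n. *)

Lemma lipschitz_continuous (R : realType) (E F : normedModType R) (C : R)
    (f : E -> F) :
  (forall x y, `|f x - f y| <= C * `|x - y|) -> continuous f.
Proof.
move=> fC x; apply/cvgrPdist_le => /= eps eps0.
have C0 : 0 < `|C| + 1 by rewrite ltr_pwDr.
near=> y.
apply: le_trans (fC x y) _.
have : `|x - y| <= eps / (`|C| + 1).
  by near: y; apply: cvgr_dist_le; [exact: cvg_id|exact: divr_gt0].
rewrite ler_pdivlMr// mulrC => h; apply: le_trans h.
by rewrite ler_wpM2r// ler_wpDr// ler_norm.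
Unshelve. all: by end_near. Qed.

Section orthonormal.
Context {R : realType} {H : hilbertType R}.
Implicit Types (x y z w : H) (e : nat -> H).

Lemma inner0r x : inner x 0 = 0.
Proof. by rewrite -(scale0r (0 : H)) innerZr mul0r. Qed.

Lemma innerNr x y : inner x (- y) = - inner x y.
Proof. by rewrite -scaleN1r innerZr mulN1r. Qed.

Lemma innerBr x y z : inner x (y - z) = inner x y - inner x z.
Proof. by rewrite innerDr innerNr. Qed.

Lemma inner_sumr (I : Type) (s : seq I) (Q : pred I) (F : I -> H) x :
  inner x (\sum_(i <- s | Q i) F i) = \sum_(i <- s | Q i) inner x (F i).
Proof.
apply: (big_morph (inner x)); [exact: innerDr|exact: inner0r].
Qed.

Lemma inner_continuous x : continuous (inner x : H -> R).
Proof.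
apply: (@lipschitz_continuous _ _ _ `|x|) => y z.
by rewrite -innerBr inner_CauchySchwarz.
Qed.

Lemma norm_sqrD x y : `|x + y| ^+ 2 = `|x| ^+ 2 + inner x y *+ 2 + `|y| ^+ 2.
Proof.
rewrite -!inner_norm innerDr !innerDl (innerC y x).
by rewrite mulr2n; ring.
Qed.

Lemma orthonormal_norm e : orthonormal_seq e -> forall i, `|e i| = 1.
Proof.
move=> oe i; have := inner_norm (e i); rewrite oe eqxx => /esym/eqP.
by rewrite sqrp_eq1//= => /eqP.
Qed.

Lemma inner_orthonormal_sum e (c : nat -> R) n l : orthonormal_seq e ->
  inner (e l) (\sum_(i < n) c i *: e i) = if (l < n)%N then c l else 0.
Proof.
move=> oe; rewrite inner_sumr.
under eq_bigr do rewrite innerZr oe mulr_natr mulrb.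
rewrite -big_mkcond/=; case: ltnP => ln.
  by rewrite (big_pred1 (Ordinal ln)).
by rewrite big_pred0// => i; apply/negbTE/negP => /eqP li; move: (ltn_ord i); rewrite -li ltnNge ln.
Qed.

Lemma norm_orthonormal_sum e (c : nat -> R) m n : orthonormal_seq e ->
  `|\sum_(m <= i < n) c i *: e i| ^+ 2 = \sum_(m <= i < n) c i ^+ 2.
Proof.
move=> oe.
have [nm|mn] := leqP n m; first by rewrite !big_geq// normr0 expr0n.
elim: n mn => // n IH; rewrite ltnS leq_eqVlt => /predU1P[->|mn].
  by rewrite !big_nat1 normrZ orthonormal_norm// mulr1 real_normK ?num_real.
rewrite !big_nat_recr//=; try exact: ltnW.
rewrite norm_sqrD IH// normrZ orthonormal_norm// mulr1 real_normK ?num_real//.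
have -> : inner (\sum_(m <= i < n) c i *: e i) (c n *: e n) = 0.
  rewrite innerC innerZl inner_sumr big_nat big1 ?mulr0// => i /andP[_ ni].
  by rewrite innerZr oe gtn_eqF// mulr0.
by rewrite mul0rn addr0.
Qed.

Lemma orthonormal_residual e x n : orthonormal_seq e ->
  `|x - \sum_(i < n) inner (e i) x *: e i| ^+ 2 =
  `|x| ^+ 2 - \sum_(i < n) inner (e i) x ^+ 2.
Proof.
move=> oe; rewrite norm_sqrD normrN innerNr inner_sumr.
have := @norm_orthonormal_sum e (fun i => inner (e i) x) 0 n oe.
rewrite !big_mkord => ->.
rewrite (eq_bigr (fun i : 'I_n => inner (e i) x ^+ 2)) => [|i _].
  by rewrite mulr2n; ring.
by rewrite innerZr innerC expr2.
Qed.

Lemma bessel e x n : orthonormal_seq e ->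
  \sum_(i < n) inner (e i) x ^+ 2 <= `|x| ^+ 2.
Proof.
by move=> oe; rewrite -subr_ge0 -orthonormal_residual// sqr_ge0.
Qed.

(** Riesz-Fischer: the squared norm of a block of the sum is a block of the convergent series of
    [c i ^+ 2], so completeness of [H] applies. *)
Lemma orthonormal_sum_cvg e (c : nat -> R) (B : R) : orthonormal_seq e ->
  (forall n, \sum_(i < n) c i ^+ 2 <= B) ->
  exists2 x, (\sum_(i < n) c i *: e i) @[n --> \oo] --> x &
    forall l, inner (e l) x = c l.
Proof.
move=> oe cB; pose u i := c i *: e i.
have su : cvgn (series u).
  apply/cauchy_cvgP/cauchy_seriesP => eps eps0.
  have : cvgn (series (fun i => c i ^+ 2)).
    apply: nondecreasing_is_cvgn.
      by apply: nondecreasing_series => i _ _; exact: sqr_ge0.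
    by exists B => _ [n _ <-]; rewrite /series/= big_mkord.
  move=> /cauchy_cvgP/cauchy_seriesP/(_ _ (exprn_gt0 2 eps0)).
  apply: filterS => -[m n] /=; rewrite -(norm_orthonormal_sum _ _ _ oe) => h.
  rewrite -(@ltr_pXn2r _ 2)// ?nnegrE ?(ltW eps0)//.
  by apply: le_lt_trans h; rewrite ler_norm.
pose x := limn (series u).
have sx : (\sum_(i < n) u i) @[n --> \oo] --> x.
  by under eq_fun do rewrite -(big_mkord xpredT u).
exists x => // l.
have h1 : inner (e l) (\sum_(i < n) u i) @[n --> \oo] --> inner (e l) x.
  by apply: (cvg_comp _ _ sx); exact: inner_continuous.
have h2 : inner (e l) (\sum_(i < n) u i) @[n --> \oo] --> c l.
  apply: cvg_near_cst; near=> n.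
  rewrite (inner_orthonormal_sum c)//; case: ltnP => // ln.
  exfalso; move: ln; apply/negP; rewrite -ltnNge; near: n; exact: nbhs_infty_gt.
exact: cvg_unique h1 h2.
Unshelve. all: by end_near. Qed.

Lemma orthonormal_series_cvg e x : orthonormal_seq e ->
  exists2 x', (\sum_(i < n) inner (e i) x *: e i) @[n --> \oo] --> x' &
    forall l, inner (e l) (x - x') = 0.
Proof.
move=> oe; have [|x' cx' h] := @orthonormal_sum_cvg e (fun i => inner (e i) x)
  (`|x| ^+ 2) oe; first by move=> n; exact: bessel.
by exists x' => // l; rewrite innerBr h subrr.
Qed.

Lemma complete_orthonormal_cvg e x : complete_orthonormal e ->
  (\sum_(i < n) inner (e i) x *: e i) @[n --> \oo] --> x.
Proof.
move=> [oe ce]; have [x' cx' h] := orthonormal_series_cvg x oe.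
by move/ce/eqP: h; rewrite subr_eq0 => /eqP {2}->.
Qed.

Lemma parseval e x y : complete_orthonormal e ->
  (\sum_(i < n) inner (e i) x * inner (e i) y) @[n --> \oo] --> inner x y.
Proof.
move=> /(@complete_orthonormal_cvg _ y) cx.
have : inner x (\sum_(i < n) inner (e i) y *: e i) @[n --> \oo] --> inner x y.
  by apply: (cvg_comp _ _ cx); exact: inner_continuous.
apply: cvg_trans; apply: near_eq_cvg; apply: nearW => n.
by rewrite inner_sumr; apply: eq_bigr => i _; rewrite innerZr mulrC (innerC x).
Qed.

Lemma compact_op_continuous (T : compact_op H) : continuous (T : H -> H).
Proof.
apply: (@lipschitz_continuous _ _ _ (opnorm T)) => x y.
rewrite -scaleN1r -compact_op_linZ.
have := compact_op_linear T 1 x ((-1) *: y).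
by rewrite !scale1r => <-; rewrite scaleN1r ler_opnorm.
Qed.

Lemma compact_opD (T : compact_op H) x y : T (x + y) = T x + T y.
Proof. by have := compact_op_linear T 1 x y; rewrite !scale1r. Qed.

Lemma compact_opB (T : compact_op H) x y : T (x - y) = T x - T y.
Proof. by rewrite compact_opD -scaleN1r compact_op_linZ scaleN1r. Qed.

Lemma compact_op_sum (T : compact_op H) (I : Type) (s : seq I) (Q : pred I)
    (F : I -> H) :
  T (\sum_(i <- s | Q i) F i) = \sum_(i <- s | Q i) T (F i).
Proof.
apply: (big_morph (fun x => T x)); [exact: compact_opD|exact: compact_op_lin0].
Qed.

Lemma sum_compact_op (I : Type) (s : seq I) (Q : pred I)
    (F : I -> compact_op H) x :
  (\sum_(i <- s | Q i) F i) x = \sum_(i <- s | Q i) F i x.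
Proof. by apply: (big_morph (fun T : compact_op H => T x)). Qed.

Lemma scale_compact_op (a : R) (T : compact_op H) x : (a *: T) x = a *: T x.
Proof. by []. Qed.

Lemma comp_opE (S T : compact_op H) x : comp_op S T x = S (T x).
Proof. by []. Qed.

(** The [e l] need not span [H], but the last clause of [eigensystem] makes [T] vanish on their
    orthogonal complement. So [w] can be replaced by its projection [w'], on which [T] acts
    diagonally with entries at most [lam m]. *)
Lemma eigensystem_tail (T : compact_op H) (lam : nat -> R) e m w :
  eigensystem T lam e -> (forall l, 0 <= lam l) ->
  (forall l, (l < m)%N -> inner (e l) w = 0) -> `|T w| <= lam m * `|w|.
Proof.
move=> [oe Te lam_dec Tker] lam0 wm.
have [w' cw' ww'] := orthonormal_series_cvg w oe.
have -> : T w = T w'.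
  by apply/eqP; rewrite -subr_eq0 -compact_opB; apply/eqP/Tker.
have cT : T (\sum_(i < n) inner (e i) w *: e i) @[n --> \oo] --> T w'.
  by apply: (cvg_comp _ _ cw'); exact: compact_op_continuous.
apply: (cvgr_to_le (cvg_norm cT)).
apply: nearW => n.
rewrite -(@ler_pXn2r _ 2)// ?nnegrE ?mulr_ge0//.
rewrite compact_op_sum.
under eq_bigr do rewrite compact_op_linZ Te scalerA.
have := @norm_orthonormal_sum e (fun i => inner (e i) w * lam i) 0 n oe.
rewrite !big_mkord => ->.
rewrite exprMn; apply: le_trans (ler_wpM2l (sqr_ge0 _) (bessel w n oe)).
rewrite mulr_sumr; apply: ler_sum => i _.
rewrite exprMn mulrC.
have [im|mi] := ltnP i m; first by rewrite wm// expr0n !mulr0.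
by rewrite ler_wpM2r ?sqr_ge0// lerXn2r ?nnegrE// lam_dec.
Qed.

Lemma riesz_representation e (phi : H -> R) (C : R) : complete_orthonormal e ->
  (forall a x y, phi (a *: x + y) = a * phi x + phi y) ->
  (forall x, `|phi x| <= C * `|x|) -> exists h, forall x, phi x = inner h x.
Proof.
move=> ce lphi phiC; have [oe _] := ce.
have phi0 : phi 0 = 0.
  by have := lphi (-1) 0 0; rewrite scaler0 addr0 mulN1r addNr.
have phiD x y : phi (x + y) = phi x + phi y.
  by have := lphi 1 x y; rewrite scale1r mul1r.
have phiZ a x : phi (a *: x) = a * phi x.
  by have := lphi a x 0; rewrite phi0 !addr0.
have phi_sum (c : nat -> R) n :
    phi (\sum_(i < n) c i *: e i) = \sum_(i < n) c i * phi (e i).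
  rewrite (big_morph phi phiD phi0).
  by apply: eq_bigr => i _; exact: phiZ.
(* Testing [phi] on the partial sum of its own candidate representer, of squared norm [S], gives
   [S <= C * sqrt S]; hence the coefficients are square summable. *)
have [|h hh hE] := @orthonormal_sum_cvg e (fun i => phi (e i)) (C ^+ 2) oe.
  move=> n; set S := \sum_(i < n) _.
  have S0 : 0 <= S by apply: sumr_ge0 => i _; exact: sqr_ge0.
  have [->|SN0] := eqVneq S 0; first exact: sqr_ge0.
  have Sgt0 : 0 < S by rewrite lt0r SN0.
  have SE : `|\sum_(i < n) phi (e i) *: e i| ^+ 2 = S.
    have := @norm_orthonormal_sum e (fun i => phi (e i)) 0 n oe.
    by rewrite !big_mkord.
  have := phiC (\sum_(i < n) phi (e i) *: e i).
  rewrite (phi_sum (fun i => phi (e i))).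
  rewrite (_ : \sum_(i < n) _ = S); last by apply: eq_bigr => i _; rewrite expr2.
  rewrite ger0_norm// => h.
  have : S ^+ 2 <= C ^+ 2 * S.
    rewrite -[in leRHS]SE -exprMn lerXn2r ?nnegrE//.
    exact: le_trans h.
  by rewrite expr2 ler_pM2r.
exists h => x.
have cphi : continuous (phi : H -> R).
  apply: (@lipschitz_continuous _ _ _ C) => y z.
  have -> : phi y - phi z = phi (y - z) by rewrite phiD -[- z]scaleN1r phiZ mulN1r.
  exact: phiC.
have h1 : phi (\sum_(i < n) inner (e i) x *: e i) @[n --> \oo] --> phi x.
  exact: (cvg_comp _ _ (complete_orthonormal_cvg ce) (cphi x)).
apply: (cvg_unique _ h1); first exact: norm_hausdorff.
apply: cvg_trans (@parseval e h x ce).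
apply: near_eq_cvg; apply: nearW => n.
rewrite (phi_sum (fun i => inner (e i) x)).
by apply: eq_bigr => i _; rewrite mulrC hE.
Qed.

Lemma adjoint_exists e (T : compact_op H) : complete_orthonormal e ->
  exists adj : H -> H, (forall x y, inner (adj x) y = inner x (T y)) /\
    forall x, `|adj x| <= opnorm T * `|x|.
Proof.
move=> ce.
have /choice[adj adjE] (x : H) : exists h, forall y, inner x (T y) = inner h y.
  apply: (riesz_representation (C := `|x| * opnorm T) ce) => [a y z|y].
    by rewrite compact_opD compact_op_linZ innerDr innerZr.
  apply: le_trans (inner_CauchySchwarz _ _) _.
  by rewrite -mulrA ler_wpM2l// ler_opnorm.
exists adj; split => // x.
have [->|adj0] := eqVneq (adj x) 0.
  by rewrite normr0 mulr_ge0// opnorm_ge0.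
rewrite -(@ler_pM2r _ `|adj x|) ?normr_gt0// -expr2 -inner_norm -adjE.
apply: le_trans (ler_norm _) _; apply: le_trans (inner_CauchySchwarz _ _) _.
by rewrite mulrAC mulrC ler_wpM2r// ler_opnorm.
Qed.

End orthonormal.

(** * Pathwise expansion of the estimator *)

Section estimator_expansion.
Context {R : realType} {H : hilbertType R} {Omega : Type}.
Variables (rho : compact_op H) (X : int -> Omega -> H).
Implicit Types (n : nat) (w : Omega) (x y z h : H).

Definition innovation (j : int) w : H := X j w - rho (X (j - 1) w).

(* The adjoint of [emp_cross X n w - rho \o emp_cov X n w] at [y], up to an
   edge term of order [1 / n]. *)
Definition noise_vector n y w : H :=
  (n.-1)%:R^-1 *: \sum_(1 <= j < n) inner (innovation j.+1%:Z w) y *: X j%:Z w.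

Definition mean_sq_norm n w : R :=
  n%:R^-1 * \sum_(1 <= j < n.+1) `|X j%:Z w| ^+ 2.

Lemma mean_sq_norm_ge0 n w : 0 <= mean_sq_norm n w.
Proof. by rewrite mulr_ge0// sumr_ge0// => i _; exact: sqr_ge0. Qed.

Lemma emp_covE n w h :
  emp_cov X n w h =
  n%:R^-1 *: \sum_(1 <= j < n.+1) inner (X j%:Z w) h *: X j%:Z w.
Proof.
by rewrite /emp_cov scale_compact_op sum_compact_op.
Qed.

Lemma inner_emp_cov n w x y :
  inner x (emp_cov X n w y) =
  n%:R^-1 * \sum_(1 <= j < n.+1) inner (X j%:Z w) x * inner (X j%:Z w) y.
Proof.
rewrite emp_covE innerZr inner_sumr; congr (_ * _); apply: eq_bigr => j _.
by rewrite innerZr mulrC (innerC x).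
Qed.

Lemma emp_cov_sym n w x y :
  inner x (emp_cov X n w y) = inner (emp_cov X n w x) y.
Proof.
rewrite (innerC _ y) !inner_emp_cov; congr (_ * _); apply: eq_bigr => j _.
by rewrite mulrC.
Qed.

Lemma emp_cov_norm n w h : `|emp_cov X n w h| <= mean_sq_norm n w * `|h|.
Proof.
rewrite emp_covE normrZ ger0_norm// -mulrA ler_wpM2l//.
apply: le_trans (ler_norm_sum _ _ _) _; rewrite mulr_suml.
apply: ler_sum => j _; rewrite normrZ expr2 mulrAC ler_wpM2r//.
exact: inner_CauchySchwarz.
Qed.

Lemma emp_crossE n w h :
  emp_cross X n w h =
  (n.-1)%:R^-1 *: \sum_(1 <= j < n) inner (X j%:Z w) h *: X j.+1%:Z w.
Proof.
by rewrite /emp_cross scale_compact_op sum_compact_op.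
Qed.

Lemma innovationS (j : nat) w :
  X j.+1%:Z w = innovation j.+1%:Z w + rho (X j%:Z w).
Proof.
by rewrite /innovation (_ : j.+1%:Z - 1 = j%:Z) ?subrK// -addn1 PoszD addrK.
Qed.

Lemma inner_noise_vector n w y h :
  inner (noise_vector n y w) h =
  (n.-1)%:R^-1 *
  \sum_(1 <= j < n) inner (innovation j.+1%:Z w) y * inner (X j%:Z w) h.
Proof.
rewrite innerC innerZr inner_sumr; congr (_ * _); apply: eq_bigr => j _.
by rewrite innerZr (innerC h).
Qed.

(** Replacing X_(j+1) by innovation plus rho X_j leaves rho applied to the sum over j < n of <X_j,
    h> X_j, which is n Gamma_n h - <X_n, h> X_n. Divided by n - 1 instead of n, it misses rho
    Gamma_n h by rho of (Gamma_n h - <X_n, h> X_n) / (n - 1). *)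
Lemma emp_cross_edge n w y h : (1 < n)%N ->
  `|inner y (emp_cross X n w h) - inner y (rho (emp_cov X n w h))
    - inner (noise_vector n y w) h|
  <= opnorm rho * `|y| * ((mean_sq_norm n w + `|X n%:Z w| ^+ 2) / (n.-1)%:R)
     * `|h|.
Proof.
move=> n1; have n0 : (0 < n.-1)%N by case: n n1 => [|[]].
have nE : n%:R = (n.-1)%:R + 1 :> R by rewrite natr1 prednK// ltnW.
pose S : H := \sum_(1 <= j < n) inner (X j%:Z w) h *: X j%:Z w.
have crossE : inner y (emp_cross X n w h) =
    inner (noise_vector n y w) h + (n.-1)%:R^-1 * inner y (rho S).
  rewrite emp_crossE inner_noise_vector innerZr -mulrDr; congr (_ * _).
  rewrite compact_op_sum !inner_sumr -big_split/=; apply: eq_bigr => j _.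
  rewrite compact_op_linZ !innerZr innovationS innerDr (innerC y (innovation _ _)).
  by ring.
have covE : n%:R *: emp_cov X n w h = S + inner (X n%:Z w) h *: X n%:Z w.
  rewrite emp_covE scalerA divff ?pnatr_eq0 ?gtn_eqF ?(ltnW n1)// scale1r.
  by rewrite big_nat_recr//= ltnW.
have -> : inner y (emp_cross X n w h) - inner y (rho (emp_cov X n w h))
    - inner (noise_vector n y w) h =
    inner y (rho ((n.-1)%:R^-1 *:
      (emp_cov X n w h - inner (X n%:Z w) h *: X n%:Z w))).
  rewrite crossE; set a := inner (noise_vector _ _ _) _.
  rewrite (_ : S = n%:R *: emp_cov X n w h - inner (X n%:Z w) h *: X n%:Z w);
    last by rewrite covE addrK.
  rewrite !compact_op_linZ !compact_opB !compact_op_linZ.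
  rewrite !innerZr !innerBr !innerZr nE.
  have nn0 : (n.-1)%:R != 0 :> R by rewrite pnatr_eq0 -lt0n.
  by field; rewrite nn0 -nE pnatr_eq0 gtn_eqF ?(ltnW n1).
apply: le_trans (inner_CauchySchwarz _ _) _.
rewrite [opnorm rho * _]mulrC -!mulrA ler_wpM2l//.
apply: le_trans (ler_opnorm _ _) _; rewrite ler_wpM2l ?opnorm_ge0//.
rewrite normrZ ger0_norm// [leRHS]mulrA [X in _ <= X]mulrAC.
rewrite [leRHS]mulrC ler_wpM2l// mulrDl.
apply: le_trans (ler_normB _ _) _; apply: lerD; first exact: emp_cov_norm.
rewrite normrZ expr2 mulrAC ler_wpM2r//.
exact: inner_CauchySchwarz.
Qed.

Section eigen.
Variables (n : nat) (w : Omega) (lamh : nat -> R) (eh : nat -> H).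
Hypothesis (n_gt1 : (1 < n)%N).
Hypothesis eig : eigensystem (emp_cov X n w) lamh eh.

Let oe : orthonormal_seq eh. Proof. by have [] := eig. Qed.

Let eigE l : emp_cov X n w (eh l) = lamh l *: eh l.
Proof. by have [] := eig. Qed.

Lemma emp_eigenvalueE l :
  lamh l = n%:R^-1 * \sum_(1 <= j < n.+1) inner (X j%:Z w) (eh l) ^+ 2.
Proof.
have := inner_emp_cov n w (eh l) (eh l).
by rewrite eigE innerZr oe eqxx mulr1 => ->.
Qed.

Lemma emp_eigenvalue_ge0 l : 0 <= lamh l.
Proof.
by rewrite emp_eigenvalueE mulr_ge0// sumr_ge0// => i _; exact: sqr_ge0.
Qed.

Lemma emp_eigenvalue_le k : (0 < k)%N -> lamh k <= mean_sq_norm n w / k%:R.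
Proof.
move=> k0; rewrite ler_pdivlMr ?ltr0n//.
have [_ _ lam_dec _] := eig.
apply: (@le_trans _ _ (\sum_(l < k) lamh l)).
  have -> : lamh k * k%:R = \sum_(l < k) lamh k.
    by rewrite sumr_const card_ord mulr_natr.
  by apply: ler_sum => l _; apply: lam_dec; exact: ltnW (ltn_ord l).
under eq_bigr do rewrite emp_eigenvalueE.
rewrite -mulr_sumr ler_wpM2l// exchange_big/=; apply: ler_sum => j _.
by under eq_bigr do rewrite innerC; exact: bessel.
Qed.

Let trunc (k : nat) z : H := \sum_(l < k) inner (eh l) z *: eh l.

Let rho_hat k : compact_op H := comp_op (emp_cross X n w) (trunc_inv k lamh eh).

(* [emp_cross] vanishes on the kernel of [emp_cov], so the junk value
   [(lamh l)^-1 = 0] at [lamh l = 0] is harmless. *)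
Lemma rho_hat_emp_cov k z :
  rho_hat k (emp_cov X n w (trunc k z)) = emp_cross X n w (trunc k z).
Proof.
rewrite comp_opE /trunc_inv /trunc sum_compact_op !compact_op_sum.
apply: eq_bigr => i _.
have -> : ((lamh i)^-1 *: tensor (eh i) (eh i))
            (\sum_(l < k) emp_cov X n w (inner (eh l) z *: eh l)) =
          ((lamh i)^-1 * lamh i * inner (eh i) z) *: eh i.
  rewrite scale_compact_op -compact_op_sum.
  rewrite -[tensor _ _ _]/(inner _ _ *: eh i) emp_cov_sym eigE innerZl.
  rewrite (inner_orthonormal_sum (fun l => inner (eh l) z))// ltn_ord.
  by rewrite scalerA mulrA.
have [l0|l0] := eqVneq (lamh i) 0; last by rewrite mulVf// mul1r.
suff -> : emp_cross X n w (inner (eh i) z *: eh i) = 0.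
  by rewrite l0 mulr0 mul0r scale0r compact_op_lin0.
rewrite compact_op_linZ emp_crossE big_nat big1 ?scaler0// => j /andP[j1 jn].
move/eqP: l0; rewrite emp_eigenvalueE mulf_eq0 invr_eq0 pnatr_eq0.
rewrite gtn_eqF/= ?(ltnW n_gt1)// psumr_eq0; last by move=> *; exact: sqr_ge0.
move=> /allP/(_ j); rewrite mem_index_iota j1 ltnS (ltnW jn) => /(_ isT).
by rewrite sqrf_eq0 => /eqP ->; rewrite scale0r.
Qed.

(** With Q z the truncation of [z], the identity is exact up to the edge term at Gamma_n Q z. The
    first two error terms pay for replacing Gamma_n Q z by [lam *: z] under [rho_hat k - rho], and Q
    z by [z] in the noise. For [z] an eigenvector of Gamma, both costs are governed by [D] and by
    the eigenvalue following the truncation. *)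
Lemma estimator_expansion (k : nat) z y (lam : R) (D := `|emp_cov X n w z - lam *: z|)
    (T := mean_sq_norm n w) :
  (0 < k)%N -> `|z| = 1 -> 0 < lam ->
  `|inner y ((rho_hat k - rho) (lam *: z)) - inner (noise_vector n y w) z| <=
  opnorm (rho_hat k - rho) * `|y| * (D + T / k%:R)
  + `|noise_vector n y w| * ((D + T / k%:R) / lam)
  + opnorm rho * `|y| * ((T + `|X n%:Z w| ^+ 2) / (n.-1)%:R).
Proof.
move=> k0 z1 lam0; set V := noise_vector n y w.
have D0 : 0 <= D by exact: normr_ge0.
pose r : H := z - trunc k z.
have rE l : (l < k)%N -> inner (eh l) r = 0.
  move=> lk; rewrite innerBr (inner_orthonormal_sum (fun l => inner (eh l) z))//.
  by rewrite lk subrr.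
have r1 : `|r| <= 1.
  rewrite -(@ler_pXn2r _ 2)// ?nnegrE// orthonormal_residual// z1 expr1n.
  by rewrite gerBl sumr_ge0// => i _; exact: sqr_ge0.
have q1 : `|trunc k z| <= 1.
  rewrite -(@ler_pXn2r _ 2)// ?nnegrE// expr1n.
  have := @norm_orthonormal_sum _ _ eh (fun l => inner (eh l) z) 0 k oe.
  by rewrite !big_mkord => ->; apply: le_trans (bessel _ _ oe) _; rewrite z1 expr1n.
have Gr : `|emp_cov X n w r| <= T / k%:R.
  apply: le_trans (eigensystem_tail eig emp_eigenvalue_ge0 rE) _.
  apply: le_trans (ler_wpM2l (emp_eigenvalue_ge0 k) r1) _.
  by rewrite mulr1 emp_eigenvalue_le.
have lr : lam * `|r| <= D + T / k%:R.
  have -> : lam * `|r| = `|lam *: r| by rewrite normrZ gtr0_norm.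
  pose g := emp_cov X n w z - lam *: z.
  (* Truncation commutes with [emp_cov], being a spectral projection, so it passes through the
     defect [g]; removing it from [g] does not increase the norm. *)
  have -> : lam *: r = emp_cov X n w r - (g - trunc k g).
    rewrite /g /r compact_opB.
    have -> : emp_cov X n w (trunc k z) = trunc k (emp_cov X n w z).
      rewrite /trunc compact_op_sum; apply: eq_bigr => l _.
      by rewrite compact_op_linZ eigE emp_cov_sym eigE innerZl scalerA mulrC.
    have -> : trunc k (emp_cov X n w z - lam *: z) =
        trunc k (emp_cov X n w z) - lam *: trunc k z.
      rewrite /trunc scaler_sumr -sumrB; apply: eq_bigr => l _.
      by rewrite innerBr innerZr scalerBl scalerA.
    rewrite scalerBr.
    set a := emp_cov _ _ _ _; set b := trunc k a.
    set p := lam *: z; set q := lam *: trunc k z.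
    have -> : a - p - (b - q) = a - b - (p - q).
      by rewrite (opprB b) [q - b]addrC addrACA (opprB p) [q - p]addrC.
    by rewrite opprB [RHS]addrC subrK.
  apply: le_trans (ler_normB _ _) _; rewrite addrC; apply: lerD => //.
  rewrite -(@ler_pXn2r _ 2)// ?nnegrE// /trunc orthonormal_residual//.
  by rewrite gerBl sumr_ge0// => i _; exact: sqr_ge0.
set dr := rho_hat k - rho.
pose v := emp_cov X n w (trunc k z).
have vz : `|lam *: z - v| <= D + T / k%:R.
  have -> : lam *: z - v = emp_cov X n w r - (emp_cov X n w z - lam *: z).
    by rewrite /r compact_opB -/v opprB [RHS]addrC addrA subrK.
  by apply: le_trans (ler_normB _ _) _; rewrite addrC; exact: lerD.
have drv : inner y (dr v) =
    inner y (emp_cross X n w (trunc k z)) - inner y (rho v).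
  by rewrite -innerBr -rho_hat_emp_cov.
have edge := emp_cross_edge w y (trunc k z) n_gt1.
have -> : inner y (dr (lam *: z)) - inner V z =
   inner y (dr (lam *: z - v)) - inner V r
   + (inner y (dr v) - inner V (trunc k z)).
  by rewrite compact_opB /r !innerBr; ring.
apply: le_trans (ler_normD _ _) _; apply: lerD; last first.
  rewrite drv; apply: le_trans edge _.
  rewrite ler_piMr// !mulr_ge0 ?opnorm_ge0// addr_ge0 ?sqr_ge0//.
  exact: mean_sq_norm_ge0.
apply: le_trans (ler_normB _ _) _; apply: lerD.
  apply: le_trans (inner_CauchySchwarz _ _) _.
  rewrite mulrAC mulrC ler_wpM2r//.
  apply: le_trans (ler_opnorm _ _) _; rewrite ler_wpM2l ?opnorm_ge0//.
apply: le_trans (inner_CauchySchwarz _ _) _; rewrite ler_wpM2l//.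
by rewrite ler_pdivlMr// mulrC.
Qed.

End eigen.
End estimator_expansion.

(** * Expectation and independence of real random variables *)

Definition L1 {d} {T : measurableType d} {R : realType}
    (P : probability T R) (f : T -> R) :=
  P.-integrable [set: T] (EFin \o f).

Definition Ex {d} {T : measurableType d} {R : realType}
    (P : probability T R) (f : T -> R) : R := \int[P]_w f w.

Section expectation.
Context {d : measure_display} {T : measurableType d} {R : realType}.
Variable P : probability T R.
Implicit Types (f g : T -> R).

Lemma L1_measurable f : L1 P f -> measurable_fun setT f.
Proof. by move=> /measurable_int/measurable_EFinP. Qed.

Lemma L1_le f g : measurable_fun setT f -> (forall w, `|f w| <= g w) ->
  L1 P g -> L1 P f.
Proof.
move=> mf fg; apply: le_integrable => //; first exact/measurable_EFinP.
by move=> w _ /=; rewrite lee_fin (le_trans (fg w))// ler_norm.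
Qed.

Lemma L1_fin f : measurable_fun setT f -> (forall w, 0 <= f w) ->
  (\int[P]_w (f w)%:E < +oo)%E -> L1 P f.
Proof.
move=> mf f0 foo; apply/integrableP; split; first exact/measurable_EFinP.
by under eq_integral do rewrite /= ger0_norm//.
Qed.

Lemma L1_cst (c : R) : L1 P (fun=> c).
Proof. exact: finite_measure_integrable_cst. Qed.

Lemma L1D f g : L1 P f -> L1 P g -> L1 P (fun w => f w + g w).
Proof. by move=> lf lg; exact: (integrableD _ lf lg). Qed.

Lemma L1Z (c : R) f : L1 P f -> L1 P (fun w => c * f w).
Proof. by move=> lf; exact: (integrableZl _ _ lf). Qed.

Lemma L1N f : L1 P f -> L1 P (fun w => - f w).
Proof. by move=> /(L1Z (-1)); under eq_fun do rewrite mulN1r. Qed.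

Lemma L1B f g : L1 P f -> L1 P g -> L1 P (fun w => f w - g w).
Proof. by move=> lf lg; apply: L1D => //; exact: L1N. Qed.

Lemma L1_sum (I : Type) (s : seq I) (F : I -> T -> R) :
  (forall i, L1 P (F i)) -> L1 P (fun w => \sum_(i <- s) F i w).
Proof.
move=> lF; elim: s => [|i s IH].
  by under eq_fun do rewrite big_nil; exact: L1_cst.
by under eq_fun do rewrite big_cons; exact: L1D.
Qed.

Lemma L1M f g : measurable_fun setT f -> measurable_fun setT g ->
  L1 P (fun w => f w ^+ 2) -> L1 P (fun w => g w ^+ 2) ->
  L1 P (fun w => f w * g w).
Proof.
move=> mf mg lf lg; apply: (L1_le _ _ (L1D lf lg)).
  exact: measurable_funM.
move=> w; rewrite normrM.
have := sqr_ge0 (`|f w| - `|g w|); rewrite sqrrB !real_normK ?num_real//.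
have := mulr_ge0 (normr_ge0 (f w)) (normr_ge0 (g w)).
lra.
Qed.

Lemma L1_sqrD f g : measurable_fun setT f -> measurable_fun setT g ->
  L1 P (fun w => f w ^+ 2) -> L1 P (fun w => g w ^+ 2) ->
  L1 P (fun w => (f w + g w) ^+ 2).
Proof.
move=> mf mg lf lg; under eq_fun do rewrite sqrrD.
by apply: L1D => //; apply: L1D => //; apply: L1D; exact: L1M.
Qed.

Lemma L1_sqr f : measurable_fun setT f -> L1 P (fun w => f w ^+ 2) -> L1 P f.
Proof.
move=> mf lf; apply: (L1_le mf _ (L1D lf (L1_cst 1))) => w.
have := sqr_ge0 (`|f w| - 1); rewrite sqrrB real_normK ?num_real//.
have := normr_ge0 (f w); rewrite expr1n mulr1; lra.
Qed.

Lemma Ex_fin f : L1 P f -> (\int[P]_w (f w)%:E = (Ex P f)%:E)%E.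
Proof. by move=> lf; rewrite /Ex /Rintegral fineK//; exact: integrable_fin_num. Qed.

Lemma ExD f g : L1 P f -> L1 P g -> Ex P (fun w => f w + g w) = Ex P f + Ex P g.
Proof. by move=> lf lg; rewrite /Ex RintegralD. Qed.

Lemma ExZ (c : R) f : L1 P f -> Ex P (fun w => c * f w) = c * Ex P f.
Proof. by move=> lf; rewrite /Ex RintegralZl. Qed.

Lemma ExB f g : L1 P f -> L1 P g -> Ex P (fun w => f w - g w) = Ex P f - Ex P g.
Proof. by move=> lf lg; rewrite /Ex RintegralB. Qed.

Lemma Ex_cst (c : R) : Ex P (fun=> c) = c.
Proof.
rewrite /Ex Rintegral_cst// (_ : fine _ = 1) ?mulr1//.
by rewrite -[RHS]/(fine 1%E); congr fine; exact: probability_setT.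
Qed.

Lemma Ex_sum (I : Type) (s : seq I) (F : I -> T -> R) :
  (forall i, L1 P (F i)) ->
  Ex P (fun w => \sum_(i <- s) F i w) = \sum_(i <- s) Ex P (F i).
Proof.
move=> lF; elim: s => [|i s IH].
  by under eq_fun do rewrite big_nil; rewrite big_nil Ex_cst.
under eq_fun do rewrite big_cons.
by rewrite ExD//; [rewrite IH big_cons|exact: L1_sum].
Qed.

Lemma Ex_le f g : L1 P f -> L1 P g -> (forall w, f w <= g w) -> Ex P f <= Ex P g.
Proof. by move=> lf lg fg; apply: le_Rintegral. Qed.

Lemma Ex_ge0 f : (forall w, 0 <= f w) -> 0 <= Ex P f.
Proof. by move=> f0; apply: Rintegral_ge0. Qed.

Lemma Ex_ae_eq f g : measurable_fun setT f -> measurable_fun setT g ->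
  {ae P, forall w, f w = g w} -> Ex P f = Ex P g.
Proof.
move=> mf mg fg; congr fine; apply: ae_eq_integral => //.
- exact/measurable_EFinP.
- exact/measurable_EFinP.
- by apply: filterS fg => w fgw _; rewrite fgw.
Qed.

Lemma L1_ae_eq f g : measurable_fun setT g ->
  {ae P, forall w, f w = g w} -> L1 P f -> L1 P g.
Proof.
move=> mg fg lf; apply/integrableP; split; first exact/measurable_EFinP.
have /integrableP[mf foo] := lf; apply: le_lt_trans foo.
rewrite le_eqVlt; apply/orP; left; apply/eqP; apply: ae_eq_integral => //.
- by do 2 apply: measurableT_comp => //.
- by apply: measurableT_comp.
- by apply: filterS fg => w fgw _ /=; rewrite fgw.
Qed.

Lemma measurable_ge f (a : R) : measurable_fun setT f ->
  measurable [set w | a <= f w].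
Proof.
move=> mf; have -> : [set w | a <= f w] = f @^-1` `[a, +oo[%classic.
  by apply/seteqP; split => w /=; rewrite in_itv/= andbT.
by rewrite -[_ @^-1` _]setTI; exact: mf.
Qed.

Lemma markov_ge f (a : R) : L1 P f -> (forall w, 0 <= f w) -> 0 < a ->
  (P [set w | (a <= f w)%R] <= (Ex P f / a)%R%:E)%E.
Proof.
move=> lf f0 a0; have mf := L1_measurable lf.
set A := [set w | _]; have mA : measurable A by exact: measurable_ge.
have lA : L1 P (fun w => a * \1_A w).
  apply: L1Z; exact: integrable_indic.
have : Ex P (fun w => a * \1_A w) <= Ex P f.
  apply: Ex_le => // w; rewrite indicE; case: (boolP (w \in A)) => [|_].
    by rewrite inE mulr1.
  by rewrite mulr0.
rewrite ExZ; last exact: integrable_indic.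
rewrite mulrC -ler_pdivlMr// -lee_fin -Ex_fin; last exact: integrable_indic.
by rewrite integral_indic// setIT.
Qed.

(** Instead of Cauchy-Schwarz, a pointwise bound is integrated: f is at most m / 2 off [A], and at
    most t f^2 / 2 + 1 / (2 t) on [A]. *)
Lemma paley_zygmund f (K : R) : 0 < K -> L1 P f -> L1 P (fun w => f w ^+ 2) ->
  (forall w, 0 <= f w) -> 0 < Ex P f ->
  Ex P (fun w => f w ^+ 2) <= K * Ex P f ^+ 2 ->
  ((4 * K)^-1%R%:E <= P [set w | (Ex P f / 2 <= f w)%R])%E.
Proof.
move=> K0 lf lf2 f0; set m := Ex P f => m0 hK; have mf := L1_measurable lf.
set A := [set w | _]; have mA : measurable A by exact: measurable_ge.
have lA : L1 P (\1_A : T -> R) by exact: integrable_indic.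
(* This [t] makes the quadratic term contribute at most m / 4 and gives the indicator of [A] the
   coefficient 1 / (2 t) = K m, so that m <= m / 2 + m / 4 + K m P(A). *)
pose t := (2 * K * m)^-1.
have Km0 : 0 < 2 * K * m by rewrite !mulr_gt0.
have t0 : 0 < t by rewrite invr_gt0.
pose g w : R := m / 2 + (t / 2 * f w ^+ 2 + K * m * \1_A w).
have lg : L1 P g by apply: L1D; [exact: L1_cst|apply: L1D; exact: L1Z].
have : m <= Ex P g.
  apply: Ex_le => // w; rewrite /g indicE.
  case: (boolP (w \in A)) => [wA|].
    have h := sqr_ge0 (t * f w - 1).
    have -> : f w = (K * m) * (2 * (t * f w)) by rewrite /t; field; rewrite !gt_eqF.
    have -> : t / 2 * (K * m * (2 * (t * f w))) ^+ 2 = K * m * (t * f w) ^+ 2.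
      by rewrite /t; field; rewrite !gt_eqF.
    have c0 : 0 < K * m by rewrite mulr_gt0.
    have := mulr_ge0 (ltW c0) h; rewrite mulr1 sqrrB expr1n mulr1 => h'.
    by move: h' c0 m0; set u := t * f w; set c := K * m; lra.
  rewrite notin_setE /A/= => /negP; rewrite -ltNge => /ltW fm.
  rewrite mulr0 addr0; apply: le_trans fm _.
  by rewrite lerDl mulr_ge0 ?sqr_ge0// ltW// divr_gt0.
rewrite ExD; [|exact: L1_cst|by apply: L1D; exact: L1Z].
rewrite Ex_cst ExD; [|exact: L1Z|exact: L1Z]; rewrite !ExZ//.
have -> : P A = (Ex P (\1_A : T -> R))%:E.
  by rewrite -Ex_fin// integral_indic// setIT.
set p := Ex P (\1_A); rewrite lee_fin => h.
have h2 : t / 2 * Ex P (fun w => f w ^+ 2) <= m / 4.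
  apply: (@le_trans _ _ (t / 2 * (K * m ^+ 2))).
    by rewrite ler_pM2l// divr_gt0.
  by rewrite le_eqVlt; apply/orP; left; apply/eqP; rewrite /t; field; rewrite !gt_eqF.
have h3 : m / 4 <= K * m * p by lra.
have -> : (4 * K)^-1 = (K * m)^-1 * (m / 4) by field; rewrite !gt_eqF.
by rewrite ler_pdivrMl ?mulr_gt0.
Qed.

End expectation.

Section independence.
Context {d : measure_display} {T : measurableType d} {R : realType}.
Variable P : probability T R.
Implicit Types (U V : T -> R).

Definition independent_rv U V :=
  forall A B : set R, measurable A -> measurable B ->
    P ((U @^-1` A) `&` (V @^-1` B)) = (P (U @^-1` A) * P (V @^-1` B))%E.

(** The law of the pair agrees with the product of the laws on rectangles, hence everywhere; Tonelli
    then gives integrability and Fubini the factorization. *)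
Lemma independent_integralM U V : measurable_fun setT U -> measurable_fun setT V ->
  independent_rv U V -> L1 P U -> L1 P V ->
  L1 P (fun w => U w * V w) /\ Ex P (fun w => U w * V w) = Ex P U * Ex P V.
Proof.
move=> mU mV iUV lU lV.
pose U' : {RV P >-> R} := HB.pack U (isMeasurableFun.Build _ _ _ _ _ mU).
pose V' : {RV P >-> R} := HB.pack V (isMeasurableFun.Build _ _ _ _ _ mV).
have mW : measurable_fun setT (fun w => (U w, V w)) by exact: measurable_fun_pair.
pose W : {RV P >-> (R * R)%type} :=
  HB.pack (fun w => (U w, V w)) (isMeasurableFun.Build _ _ _ _ _ mW).
pose mu : probability R R := distribution P U'.
pose nu : probability R R := distribution P V'.
have prodE (X : set (R * R)) : measurable X ->
    distribution P W X = (mu \x nu)%E X.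
  move=> mX; symmetry.
  by apply: product_measure_unique => // A B mA mB; exact: iUV.
pose f (z : R * R) : \bar R := (z.1 * z.2)%:E.
have mf : measurable_fun setT f.
  by apply/measurable_EFinP; exact: measurable_funM.
have m1 : measurable_fun [set: R] (fun x : R => `|x|%:E).
  by apply/measurable_EFinP; exact: normr_measurable.
have lUV : L1 P (fun w => U w * V w).
  apply/integrableP; split; first by apply/measurable_EFinP; exact: measurable_funM.
  have -> : (\int[P]_w `|(EFin \o (fun w => U w * V w)%R) w| =
      \int[distribution P W]_z `|f z|)%E.
    rewrite ge0_integral_distribution//.
    by apply: measurableT_comp.
  rewrite (eq_measure_integral (mu \x nu)%E); last by move=> A mA _; exact: prodE.
  rewrite fubini_tonelli1//; last by apply: measurableT_comp.
  rewrite /fubini_F.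
  have -> : (\int[mu]_x \int[nu]_y `|f (x, y)| =
      \int[mu]_x (`|x|%:E * \int[nu]_y `|y|%:E))%E.
    apply: eq_integral => x _.
    under eq_integral do rewrite /f/= normrM EFinM.
    by rewrite ge0_integralZl_EFin.
  have intV : (\int[nu]_y `|y|%:E < +oo)%E.
    rewrite ge0_integral_distribution//.
    by have /integrableP[_] := lV.
  have V0 : (0 <= \int[nu]_y `|y|%:E)%E by exact: integral_ge0.
  have Vfin : (\int[nu]_y `|y|%:E)%E \is a fin_num by rewrite ge0_fin_numE.
  rewrite -(fineK Vfin); move: (fine_ge0 V0); set c := fine _ => c0.
  under eq_integral do rewrite muleC.
  rewrite ge0_integralZl_EFin// lte_mul_pinfty ?lee_fin//.
  rewrite ge0_integral_distribution//.
  by have /integrableP[_] := lU.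
split => //.
have int_id (Z : {RV P >-> R}) : L1 P Z ->
    (distribution P Z).-integrable setT (EFin : R -> \bar R).
  by move=> lZ; apply: integrable_pushforward.
have intf : (mu \x nu)%E.-integrable setT f.
  apply/integrableP; split => //.
  rewrite (eq_measure_integral (distribution P W)); last first.
    by move=> A mA _; exact/esym/prodE.
  rewrite ge0_integral_distribution//; last by apply: measurableT_comp.
  by have /integrableP[_] := lUV.
apply: EFin_inj; rewrite EFinM -[in LHS]Ex_fin//.
have -> : (\int[P]_w (U w * V w)%R%:E = \int[distribution P W]_z f z)%E.
  by rewrite integral_distribution.
rewrite (eq_measure_integral (mu \x nu)%E); last by move=> A mA _; exact: prodE.
rewrite -integral12_prod_meas1// /fubini_F.
have -> : (\int[mu]_x \int[nu]_y f (x, y) =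
    \int[mu]_x (x%:E * \int[nu]_y y%:E))%E.
  apply: eq_integral => x _.
  under eq_integral do rewrite /f/= EFinM.
  by rewrite integralZl//; exact: int_id.
have -> : (\int[nu]_y y%:E = (Ex P V)%:E)%E.
  by rewrite -Ex_fin// integral_distribution.
under eq_integral do rewrite muleC.
rewrite integralZl//; last exact: int_id.
have -> : (\int[mu]_x x%:E = (Ex P U)%:E)%E.
  by rewrite -Ex_fin// integral_distribution.
by rewrite muleC.
Qed.

End independence.

(** * Convergence and boundedness in probability *)

Section in_probability.
Context {d : measure_display} {T : measurableType d} {R : realType}.
Variable P : probability T R.
Implicit Types (f g : nat -> T -> R).

(* No measurability of [f n] is required: the exceptional event is only
   contained in the measurable set [A]. *)
Definition bounded_off (eta M : R) (h : T -> R) :=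
  exists A : set T, [/\ measurable A, (P A <= eta%:E)%E &
    forall w, ~ A w -> `|h w| <= M].

(** Convergence to 0 in probability, in a form that tolerates nonmeasurable functions. *)
Definition small f := forall M eta : R, 0 < M -> 0 < eta ->
  \forall n \near \oo, bounded_off eta M (f n).

(** Boundedness in probability, required only from some rank on. *)
Definition tight f := forall eta : R, 0 < eta ->
  exists M, \forall n \near \oo, bounded_off eta M (f n).

Lemma bounded_off_le eta eta' M M' (h h' : T -> R) :
  eta <= eta' -> (forall w, `|h w| <= M -> `|h' w| <= M') ->
  bounded_off eta M h -> bounded_off eta' M' h'.
Proof.
move=> ee hh [A [mA PA hA]]; exists A; split => //.
  by rewrite (le_trans PA)// lee_fin.
by move=> w /hA/hh.
Qed.

Lemma bounded_off2 eta1 eta2 M1 M2 M (h1 h2 h : T -> R) :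
  (forall w, `|h1 w| <= M1 -> `|h2 w| <= M2 -> `|h w| <= M) ->
  bounded_off eta1 M1 h1 -> bounded_off eta2 M2 h2 ->
  bounded_off (eta1 + eta2) M h.
Proof.
move=> hh [A [mA PA hA]] [B [mB PB hB]]; exists (A `|` B); split.
- exact: measurableU.
- by rewrite EFinD; apply: le_trans (measureU2 _ mA mB) _; exact: leeD.
- by move=> w /not_orP[/hA h1w /hB h2w]; exact: hh.
Qed.

Lemma small_le f g : (\forall n \near \oo, forall w, `|f n w| <= g n w) ->
  small g -> small f.
Proof.
move=> fg sg M eta M0 eta0; near=> n.
apply: (@bounded_off_le eta eta M M (g n)) => //; last by near: n; exact: sg.
move=> w; apply: le_trans; apply: le_trans (ler_norm _).
by move: w; near: n.
Unshelve. all: by end_near. Qed.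

Lemma tight_le f g : (\forall n \near \oo, forall w, `|f n w| <= g n w) ->
  tight g -> tight f.
Proof.
move=> fg tg eta eta0; have [M tM] := tg _ eta0; exists M; near=> n.
apply: (@bounded_off_le eta eta M M (g n)) => //; last by near: n; exact: tM.
move=> w; apply: le_trans; apply: le_trans (ler_norm _).
by move: w; near: n.
Unshelve. all: by end_near. Qed.

Lemma small_norm f : small f -> small (fun n w => `|f n w|).
Proof.
move=> sf M eta M0 eta0; move: (sf M eta M0 eta0); apply: filterS => n.
by apply: bounded_off_le => // w; rewrite normr_id.
Qed.

Lemma smallD f g : small f -> small g -> small (fun n w => f n w + g n w).
Proof.
move=> sf sg M eta M0 eta0.
have M20 : 0 < M / 2 by rewrite divr_gt0.
have eta20 : 0 < eta / 2 by rewrite divr_gt0.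
near=> n; rewrite (splitr eta).
apply: (@bounded_off2 _ _ (M / 2) (M / 2) _ (f n) (g n)).
- move=> w h1 h2; rewrite (splitr M).
  by apply: le_trans (ler_normD _ _) _; exact: lerD.
- by near: n; exact: sf.
- by near: n; exact: sg.
Unshelve. all: by end_near. Qed.

Lemma tightD f g : tight f -> tight g -> tight (fun n w => f n w + g n w).
Proof.
move=> tf tg eta eta0.
have eta20 : 0 < eta / 2 by rewrite divr_gt0.
have [M tM] := tf _ eta20; have [N tN] := tg _ eta20.
exists (M + N); near=> n; rewrite (splitr eta).
apply: (@bounded_off2 _ _ M N _ (f n) (g n)).
- by move=> w h1 h2; apply: le_trans (ler_normD _ _) _; exact: lerD.
- by near: n.
- by near: n.
Unshelve. all: by end_near. Qed.

Lemma tightM_small f g : tight f -> small g -> small (fun n w => f n w * g n w).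
Proof.
move=> tf sg M eta M0 eta0.
have eta20 : 0 < eta / 2 by rewrite divr_gt0.
have [N tN] := tf _ eta20.
have N0 : 0 < `|N| + 1 by rewrite ltr_pwDr.
have MN0 : 0 < M / (`|N| + 1) by rewrite divr_gt0.
near=> n; rewrite (splitr eta).
apply: (@bounded_off2 _ _ N (M / (`|N| + 1)) _ (f n) (g n)).
- move=> w h1 h2; rewrite normrM.
  have -> : M = (`|N| + 1) * (M / (`|N| + 1)) by rewrite mulrC divfK// gt_eqF.
  apply: ler_pM => //; apply: le_trans h1 _.
  by have := ler_norm N; lra.
- by near: n.
- by near: n; exact: sg.
Unshelve. all: by end_near. Qed.

Lemma small_cvg0 (u : nat -> R) : u n @[n --> \oo] --> 0 ->
  small (fun n _ => u n).
Proof.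
move=> u0 M eta M0 eta0; near=> n.
exists set0; split => //; first by rewrite measure0 lee_fin ltW.
by move=> w _; near: n; apply: cvgr0_norm_le.
Unshelve. all: by end_near. Qed.

Lemma tight_cst (c : R) : tight (fun _ _ => c).
Proof.
move=> eta eta0; exists `|c|; near=> n; exists set0; split => //.
by rewrite measure0 lee_fin ltW.
Unshelve. all: by end_near. Qed.

Lemma tight_Ex f (C : R) : (forall n w, 0 <= f n w) ->
  (\forall n \near \oo, L1 P (f n) /\ Ex P (f n) <= C) -> tight f.
Proof.
move=> f0 fC eta eta0; exists ((`|C| + 1) / eta).
have C0 : 0 < `|C| + 1 by rewrite ltr_pwDr.
have M0 : 0 < (`|C| + 1) / eta by rewrite divr_gt0.
near=> n; have [lf Ef] : L1 P (f n) /\ Ex P (f n) <= C by near: n.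
exists [set w | (`|C| + 1) / eta <= f n w]; split.
- exact: measurable_ge (L1_measurable lf).
- apply: le_trans (markov_ge lf (f0 n) M0) _; rewrite lee_fin.
  rewrite ler_pdivrMr// mulrC divfK ?gt_eqF//.
  by have := ler_norm C; lra.
- by move=> w /= /negP; rewrite -ltNge (ger0_norm (f0 n w)) => /ltW.
Unshelve. all: by end_near. Qed.

Lemma small_Ex f (u : nat -> R) : (forall n w, 0 <= f n w) ->
  (\forall n \near \oo, L1 P (f n) /\ Ex P (f n) <= u n) ->
  u n @[n --> \oo] --> 0 -> small f.
Proof.
move=> f0 fu u0 M eta M0 eta0; near=> n.
have [lf Ef] : L1 P (f n) /\ Ex P (f n) <= u n by near: n.
exists [set w | M <= f n w]; split.
- exact: measurable_ge (L1_measurable lf).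
- apply: le_trans (markov_ge lf (f0 n) M0) _; rewrite lee_fin.
  rewrite ler_pdivrMr//; apply: le_trans Ef _.
  apply: le_trans (ler_norm _) _.
  by near: n; apply: cvgr0_norm_le => //; rewrite mulr_gt0.
- by move=> w /= /negP; rewrite -ltNge (ger0_norm (f0 n w)) => /ltW.
Unshelve. all: by end_near. Qed.

Lemma small_sqr f : small (fun n w => f n w ^+ 2) -> small f.
Proof.
move=> sf M eta M0 eta0; have M20 : 0 < M ^+ 2 by rewrite exprn_gt0.
near=> n; apply: (@bounded_off_le eta eta (M ^+ 2) M (fun w => f n w ^+ 2)) => //.
  by move=> w; rewrite normrX ler_pXn2r ?nnegrE// ltW.
by near: n; exact: sf.
Unshelve. all: by end_near. Qed.

Lemma tight_sqr f : tight (fun n w => f n w ^+ 2) -> tight f.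
Proof.
move=> tf eta eta0; have [M tM] := tf _ eta0; exists (`|M| + 1).
near=> n; apply: (@bounded_off_le eta eta M _ (fun w => f n w ^+ 2)) => //.
  move=> w h; rewrite -(@ler_pXn2r _ 2)// ?nnegrE ?addr_ge0// -normrX.
  apply: le_trans h _; apply: le_trans (ler_norm _) _.
  by rewrite sqrrD expr1n mulr1; have := sqr_ge0 `|M|; have := normr_ge0 M; lra.
by near: n.
Unshelve. all: by end_near. Qed.

(** Approximation at level [m]: [g m] is negligible for each fixed [m], while [h m] is controlled
    for all large [n] at once when [m] is well chosen. It serves for the iterated adjoint and for
    the truncation of coordinates. *)
Lemma small_approx f (g h : nat -> nat -> T -> R) :
  (forall m, \forall n \near \oo, forall w, `|f n w| <= g m n w + h m n w) ->
  (forall m, small (g m)) ->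
  (forall M eta : R, 0 < M -> 0 < eta -> exists m,
    \forall n \near \oo, bounded_off eta M (h m n)) ->
  small f.
Proof.
move=> fgh sg sh M eta M0 eta0.
have M20 : 0 < M / 2 by rewrite divr_gt0.
have eta20 : 0 < eta / 2 by rewrite divr_gt0.
have [m hm] := sh _ _ M20 eta20.
near=> n; rewrite (splitr eta).
apply: (@bounded_off2 _ _ (M / 2) (M / 2) _ (g m n) (h m n)).
- move=> w h1 h2; rewrite (splitr M).
  have : `|f n w| <= g m n w + h m n w by move: w {h1 h2}; near: n; exact: fgh.
  move/le_trans; apply; apply: lerD.
    exact: le_trans (ler_norm _) h1.
  exact: le_trans (ler_norm _) h2.
- by near: n; exact: sg.
- by near: n.
Unshelve. all: by end_near. Qed.

Lemma bounded_off_Ex (h : T -> R) (M eta C : R) : 0 < M -> L1 P h ->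
  (forall w, 0 <= h w) -> Ex P h <= C -> C <= eta * M -> bounded_off eta M h.
Proof.
move=> M0 lh h0 hC CM; exists [set w | M <= h w]; split.
- exact: measurable_ge (L1_measurable lh).
- apply: le_trans (markov_ge lh h0 M0) _; rewrite lee_fin ler_pdivrMr//.
  exact: le_trans hC CM.
- by move=> w /= /negP; rewrite -ltNge (ger0_norm (h0 w)) => /ltW.
Qed.

Lemma Ex_bounded_off (h g : T -> R) (M eta : R) : bounded_off eta M h ->
  L1 P g -> (forall w, g w <= 1) -> (forall w, g w <= `|h w|) -> 0 <= M ->
  Ex P g <= M + eta.
Proof.
move=> [A [mA PA hA]] lg g1 gh M0.
have lA : L1 P (\1_A : T -> R) by exact: integrable_indic.
apply: (@le_trans _ _ (Ex P (fun w => M + \1_A w))).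
  apply: Ex_le => //; first by apply: L1D => //; exact: L1_cst.
  move=> w; rewrite indicE; case: (boolP (w \in A)) => [_|].
    by apply: le_trans (g1 w) _; rewrite lerDr.
  by rewrite notin_setE => /hA; rewrite addr0; exact: le_trans.
rewrite ExD//; last exact: L1_cst.
rewrite Ex_cst lerD2l -lee_fin -Ex_fin//.
by rewrite integral_indic// setIT.
Qed.

End in_probability.

Lemma cvg_invn (R : realType) : n%:R^-1 @[n --> \oo] --> (0 : R).
Proof. by rewrite -(cvg_shiftS (fun n => n%:R^-1 : R)); exact: cvg_harmonic. Qed.

Section orthogonal_sums.
Context {d : measure_display} {T : measurableType d} {R : realType}.
Variable P : probability T R.

Lemma L1_sqr_sum (D : nat -> T -> R) (s : seq nat) :
  (forall j, measurable_fun setT (D j)) -> (forall j, L1 P (fun w => D j w ^+ 2)) ->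
  L1 P (fun w => (\sum_(j <- s) D j w) ^+ 2).
Proof.
move=> mD lD; elim: s => [|i s IH].
  by under eq_fun do rewrite big_nil expr0n; exact: L1_cst.
under eq_fun do rewrite big_cons; apply: L1_sqrD => //.
exact: measurable_sum.
Qed.

Lemma Ex_sqr_sum (D : nat -> T -> R) m n :
  (forall j, measurable_fun setT (D j)) -> (forall j, L1 P (fun w => D j w ^+ 2)) ->
  (forall i j, (m <= i < j)%N -> Ex P (fun w => D i w * D j w) = 0) ->
  Ex P (fun w => (\sum_(m <= j < n) D j w) ^+ 2) =
  \sum_(m <= j < n) Ex P (fun w => D j w ^+ 2).
Proof.
move=> mD lD orth.
have lDD i j : L1 P (fun w => D i w * D j w) by exact: L1M.
have [nm|mn] := leqP n m.
  under eq_fun do rewrite big_geq// expr0n.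
  by rewrite Ex_cst big_geq.
elim: n mn => // n IH; rewrite ltnS leq_eqVlt => /predU1P[->|mn].
  by under eq_fun do rewrite big_nat1; rewrite big_nat1.
under eq_fun do rewrite big_nat_recr/= ?(ltnW mn)// sqrrD.
have lS := L1_sqr_sum (index_iota m n) mD lD.
have mS : measurable_fun setT (fun w => \sum_(m <= j < n) D j w) by exact: measurable_sum.
have lSD := L1M mS (mD n) lS (lD n).
rewrite big_nat_recr/= ?(ltnW mn)// -IH//.
rewrite ExD//; last first.
  by apply: L1D => //; under eq_fun do rewrite mulr2n; exact: L1D.
rewrite ExD//; last by under eq_fun do rewrite mulr2n; exact: L1D.
under [X in _ + Ex P X + _]eq_fun do rewrite mulr2n.
rewrite ExD//.
have -> : Ex P (fun w => (\sum_(m <= j < n) D j w) * D n w) = 0.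
  under eq_fun do rewrite mulr_suml.
  rewrite Ex_sum// big_nat big1// => i mi.
  exact: orth.
by rewrite !addr0.
Qed.

(** Weak law of large numbers by Chebyshev: orthogonality makes the second moment of the average at
    most C / n. *)
Lemma small_average (D : nat -> T -> R) (C : R) :
  (forall j, measurable_fun setT (D j)) -> (forall j, L1 P (fun w => D j w ^+ 2)) ->
  (forall i j, (0 < i < j)%N -> Ex P (fun w => D i w * D j w) = 0) ->
  (forall j, (0 < j)%N -> Ex P (fun w => D j w ^+ 2) <= C) ->
  small P (fun n w => n%:R^-1 * \sum_(1 <= j < n.+1) D j w).
Proof.
move=> mD lD orth DC; apply: small_sqr.
have lS n := L1_sqr_sum (index_iota 1 n.+1) mD lD.
apply: (@small_Ex _ _ _ P _ (fun n => n%:R^-1 * C)).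
- by move=> n w; exact: sqr_ge0.
- near=> n; under eq_fun do rewrite exprMn.
  split; first exact: L1Z.
  rewrite ExZ// Ex_sqr_sum//.
  rewrite expr2 -mulrA ler_wpM2l//.
  have n0 : (0 < n)%N by near: n; exact: nbhs_infty_gt.
  rewrite ler_pdivrMl ?ltr0n//.
  rewrite big_nat; apply: (@le_trans _ _ (\sum_(1 <= j < n.+1 | (1 <= j < n.+1)%N) C)).
    by apply: ler_sum => j /andP[j1 _]; exact: DC.
  by rewrite -big_nat sumr_const_nat subn1/= mulr_natl.
- rewrite -(mul0r C); apply: cvgM; last exact: cvg_cst.
  exact: cvg_invn.
Unshelve. all: by end_near. Qed.

End orthogonal_sums.

(** * Borel random elements *)

Lemma continuous_borel_preimage (E F : topologicalType) (g : E -> F) (A : set F) :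
  continuous g -> <<s @open F >> A -> <<s @open E >> (g @^-1` A).
Proof.
move=> /continuousP cg sA.
suff h : <<s @open F >> `<=` [set B | <<s @open E >> (g @^-1` B)] by exact: h.
apply: smallest_sub => [|B oB]; last by apply: sub_sigma_algebra; exact: cg.
have [s0 sC sU] := smallest_sigma_algebra [set: E] (@open E).
split => [|B sB|F' sF] /=.
- by rewrite preimage_set0.
- by have := sC _ sB; rewrite !setTD preimage_setC.
- by rewrite preimage_bigcup; exact: sU.
Qed.

Section borel.
Context {R : realType}.

Lemma continuous_real_measurable (E : ptopologicalType) (g : E -> R) :
  continuous g -> measurable_fun setT (g : borel E -> R).
Proof.
move=> cg; apply: (measurability _ (RGenOInfty.measurableE R)).
move=> _ [_ [x ->] <-]; rewrite setTI; apply: sub_sigma_algebra.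
move/continuousP : cg; apply; exact: interval_open.
Qed.

Context {d : measure_display} {Omega : measurableType d}.
Variable P : probability Omega R.

Lemma random_element_measurable (E : ptopologicalType) (Z : Omega -> E) (g : E -> R) :
  random_element Z -> continuous g -> measurable_fun setT (fun w => g (Z w)).
Proof.
by move=> mZ cg; apply: (measurableT_comp (continuous_real_measurable cg) mZ).
Qed.

Lemma same_law_expectation (E : ptopologicalType) (Y Z : Omega -> E) (g : E -> R) :
  random_element Y -> random_element Z -> same_law P Y Z -> continuous g ->
  L1 P (fun w => g (Y w)) ->
  L1 P (fun w => g (Z w)) /\ Ex P (fun w => g (Z w)) = Ex P (fun w => g (Y w)).
Proof.
move=> mY mZ YZ cg lY.
have mg := continuous_real_measurable cg.
pose Y' : {RV P >-> borel E} := HB.pack Y (isMeasurableFun.Build _ _ _ _ _ mY).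
pose Z' : {RV P >-> borel E} := HB.pack Z (isMeasurableFun.Build _ _ _ _ _ mZ).
have lawE (A : set (borel E)) : measurable A -> distribution P Y' A = distribution P Z' A.
  by move=> mA; exact: YZ.
have lZ : L1 P (fun w => g (Z w)).
  apply/integrableP; split.
    by apply/measurable_EFinP; exact: random_element_measurable.
  have mag : measurable_fun setT (fun x : borel E => `|(g x)%:E|%E).
    by apply: measurableT_comp => //; exact/measurable_EFinP.
  have -> : (\int[P]_w `|(g (Z w))%:E| = \int[distribution P Z']_x `|(g x)%:E|)%E.
    by rewrite ge0_integral_distribution.
  rewrite (eq_measure_integral (distribution P Y')); last first.
    by move=> A mA _; exact/esym/lawE.
  rewrite ge0_integral_distribution//.
  by have /integrableP[_] := lY.
split => //; apply: EFin_inj; rewrite -!Ex_fin//.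
have mg' : measurable_fun setT (fun x : borel E => (g x)%:E) by exact/measurable_EFinP.
have -> : (\int[P]_w (g (Z w))%:E = \int[distribution P Z']_x (g x)%:E)%E.
  by rewrite integral_distribution.
rewrite (eq_measure_integral (distribution P Y')); last first.
  by move=> A mA _; exact/esym/lawE.
by rewrite integral_distribution.
Qed.

Lemma stationary_same_law (E : ptopologicalType) (Y : int -> Omega -> E) (n m : int) :
  strictly_stationary P Y -> same_law P (Y n) (Y m).
Proof.
move=> sY A mA.
pose ev (g : {ptws 'I_1 -> E}) : E := g ord0.
have := sY 1%N (fun=> n) (m - n) (ev @^-1` A).
rewrite addrC subrK /preimage/=; apply.
have cev : continuous ev by exact: (@proj_continuous _ (fun _ : 'I_1 => E) ord0).
exact: continuous_borel_preimage cev mA.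
Qed.

(** Carries moment bounds from finite sums of squared coordinates to the norm, their pointwise limit
    by Parseval. *)
Lemma L1_fatou (f : nat -> Omega -> R) (g : Omega -> R) (B : R) :
  (forall n w, 0 <= f n w) -> (forall n, L1 P (f n)) ->
  (forall n, Ex P (f n) <= B) -> (forall w, f n w @[n --> \oo] --> g w) ->
  L1 P g /\ Ex P g <= B.
Proof.
move=> f0 lf fB fg.
have mg : measurable_fun setT g.
  by apply: (measurable_fun_cvg (fun n => L1_measurable (lf n))) => w _; exact: fg.
have g0 w : 0 <= g w by apply: (cvgr_to_ge (fg w)); apply: nearW => n; exact: f0.
have gB : (\int[P]_w (g w)%:E <= B%:E)%E.
  have -> : (\int[P]_w (g w)%:E = \int[P]_w limn_einf (fun n => (f n w)%:E))%E.
    apply: eq_integral => w _; apply/esym.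
    have h : (f n w)%:E @[n --> \oo] --> (g w)%:E by apply: cvg_EFin; [exact: nearW|exact: fg].
    by rewrite (cvg_limn_einf_sup h).
  apply: le_trans (fatou P measurableT _ _) _.
  - by move=> n; apply/measurable_EFinP; exact: L1_measurable.
  - by move=> n w _; rewrite lee_fin.
  - rewrite limn_einf_lim; apply: lime_le; first exact: is_cvg_einfs.
    apply: nearW => n; apply: ereal_inf_le.
    exists (\int[P]_w (f n w)%:E)%E; first by exists n => /=.
    by rewrite Ex_fin// lee_fin.
have lg : L1 P g by apply: L1_fin => //; apply: le_lt_trans gB _; rewrite ltry.
by split => //; rewrite -lee_fin -Ex_fin.
Qed.

End borel.

(** * Convergence in law *)

Section convergence_in_law.
Context {R : realType} {d : measure_display} {Omega : measurableType d}.
Variables (P : probability Omega R) (E : normedModType R).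
Variables (Z : nat -> Omega -> E) (mu : probability (borel E) R).
Hypothesis Z_meas : forall n, random_element (Z n).
Hypothesis Z_mu : cvg_in_law P Z mu.

Lemma L1_bounded {d'} {T : measurableType d'} (Q : probability T R) (f : T -> R) (M : R) :
  measurable_fun setT f -> (forall x, `|f x| <= M) -> L1 Q f.
Proof. by move=> mf fM; apply: (L1_le mf fM); exact: L1_cst. Qed.

Lemma cvg_in_law_expectation (f : E -> R) (M : R) : continuous f ->
  (forall x, `|f x| <= M) ->
  Ex P (fun w => f (Z n w)) @[n --> \oo] --> Ex mu f.
Proof.
move=> cf fM; have := Z_mu cf (ex_intro _ M fM).
have lmu : L1 mu f by exact: (L1_bounded mu (continuous_real_measurable cf) fM).
by rewrite (Ex_fin lmu) => h; exact: (fine_cvg h).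
Qed.

(** A bounded continuous substitute for the indicator of large norm: 0 up to norm m, 1 from norm m +
    1 on. *)
Let cutoff (m : nat) (x : E) : R := Num.min 1 (Num.max 0 (`|x| - m%:R)).

Let cutoff_continuous m : continuous (cutoff m).
Proof.
move=> x; apply: (@continuous_min _ _ (fun=> 1 : R) (fun x => Num.max 0 (`|x| - m%:R))).
  exact: cst_continuous.
apply: (@continuous_max _ _ (fun=> 0 : R) (fun x : E => `|x| - m%:R)).
  exact: cst_continuous.
apply: (@cvgB _ R^o); last exact: cvg_cst.
exact: norm_continuous.
Qed.

Let cutoff_ge0 m x : 0 <= cutoff m x.
Proof. by rewrite le_min ler01 le_max lexx. Qed.

Let cutoff_le1 m x : `|cutoff m x| <= 1.
Proof. by rewrite ger0_norm// ge_min lexx. Qed.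

(** [mu] has total mass 1 on [E], so the integral of [cutoff m] tends to 0 by dominated convergence.
    One [m] with integral below eta is enough, since convergence in law carries the strict bound
    over to all large n. *)
Lemma cvg_in_law_tight : tight P (fun n w => `|Z n w|).
Proof.
have mc m : measurable_fun setT (cutoff m : borel E -> R).
  exact: continuous_real_measurable.
have : Ex mu (cutoff m) @[m --> \oo] --> 0.
  have [|||||_ _ h] := @dominated_convergence _ (borel E) _ mu setT measurableT
    (fun m x => (cutoff m x)%:E) (fun=> 0%E) (fun=> 1%E).
  - by move=> m; exact/measurable_EFinP.
  - exact: measurable_cst.
  - apply: aeW => x _; apply: cvg_EFin; first exact: nearW.
    apply: cvg_near_cst; near=> m; rewrite /= /cutoff.
    have : `|x| <= m%:R by near: m; exact: nbhs_infty_ger.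
    by rewrite -subr_le0 => /max_idPl ->; rewrite min_r.
  - exact: (@L1_cst _ (borel E) _ mu 1).
  - by apply: aeW => x m _; rewrite /= lee_fin.
  move: h; rewrite integral0 => h.
  exact: (fine_cvg h).
move=> /(cvgr0_norm_lt _) h eta eta0; have [m _ /(_ m (leqnn m)) hm] := h _ eta0.
exists (m%:R + 1).
have := cvg_in_law_expectation (@cutoff_continuous m) (cutoff_le1 m).
move=> /(cvgr_lt _)/(_ eta).
have lt : Ex mu (cutoff m) < eta by apply: le_lt_trans hm; exact: ler_norm.
move=> /(_ lt); apply: filterS => n hn.
exists [set w | 1 <= cutoff m (Z n w)].
have mcZ : measurable_fun setT (fun w => cutoff m (Z n w)).
  exact: (random_element_measurable (Z_meas n) (@cutoff_continuous m)).
have lcZ : L1 P (fun w => cutoff m (Z n w)).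
  by apply: (L1_bounded P mcZ (M := 1)) => w; exact: cutoff_le1.
split; first exact: measurable_ge.
  apply: le_trans (markov_ge lcZ _ ltr01) _; first by move=> w; exact: cutoff_ge0.
  by rewrite lee_fin divr1 ltW.
move=> w /= /negP; rewrite normr_id -ltNge /cutoff gt_min ltxx/= gt_max => /andP[_].
by rewrite ltrBlDr addrC => /ltW.
Unshelve. all: by end_near. Qed.

End convergence_in_law.

(** * The autoregressive process *)

Section autoregression.
Context {R : realType} {H : hilbertType R} {d : measure_display}
  {Omega : measurableType d}.
Variables (P : probability Omega R) (rho : compact_op H).
Variables (eps X : int -> Omega -> H).
Hypothesis eps_meas : forall n, random_element (eps n).
Hypothesis X_meas : forall n, random_element (X n).
Hypothesis eps_law : forall n m, same_law P (eps n) (eps m).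
Hypothesis eps_centered : forall n, is_mean P (eps n) 0.
Hypothesis X_stationary : strictly_stationary P X.
Hypothesis X_ar : forall n, {ae P, forall w, X n w = rho (X (n - 1) w) + eps n w}.
Hypothesis eps_indep : forall n, independent_of_past P (eps n) X (n - 1).
Variable Gamma : H -> H.
Hypothesis Gamma_cov : is_mean_op P (fun w => tensor (X 1 w) (X 1 w)) Gamma.
Variable adj : H -> H.
Hypothesis adjE : forall x y, inner (adj x) y = inner x (rho y).

(** * Second moments of the process *)

Lemma X_expectation (g : H -> R) n m : continuous g ->
  L1 P (fun w => g (X n w)) ->
  L1 P (fun w => g (X m w)) /\ Ex P (fun w => g (X m w)) = Ex P (fun w => g (X n w)).
Proof.
move=> cg lg; apply: (same_law_expectation (X_meas n) (X_meas m) _ cg lg).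
exact: stationary_same_law.
Qed.

Let normsq_continuous : continuous (fun x : H => `|x| ^+ 2).
Proof.
move=> x; apply: (@continuous_comp _ _ _ (fun y : H => `|y|) (fun r : R => r ^+ 2)).
  exact: norm_continuous.
exact: exprn_continuous.
Qed.

(** The second moment is contained in [Gamma_cov]: evaluating the tensor at X_1 itself shows that
    its norm is at least |X_1|^2. Stationarity does the rest. *)
Lemma X_normsq n : L1 P (fun w => `|X n w| ^+ 2).
Proof.
suff h : L1 P (fun w => `|X 1 w| ^+ 2) by have [] := X_expectation n normsq_continuous h.
have [lt _] := Gamma_cov.
apply: (L1_le _ _ lt).
  exact: (random_element_measurable (X_meas 1) normsq_continuous).
move=> w; rewrite ger0_norm ?sqr_ge0//.
have [->|x0] := eqVneq (X 1 w) 0; first by rewrite normr0 expr0n; exact: normr_ge0.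
have n0 : 0 < `|X 1 w| by rewrite normr_gt0.
have := @ler_opnorm _ _ (tensor (X 1 w) (X 1 w)) (X 1 w).
rewrite [tensor _ _ _]/(inner _ _ *: _) inner_norm normrZ ger0_norm ?sqr_ge0//.
by rewrite ler_pM2r.
Qed.

Lemma X_inner_meas x n : measurable_fun setT (fun w => inner x (X n w)).
Proof. exact: (random_element_measurable (X_meas n) (@inner_continuous _ _ x)). Qed.

Lemma X_inner_sqr x n : L1 P (fun w => inner x (X n w) ^+ 2).
Proof.
apply: (L1_le _ _ (L1Z (`|x| ^+ 2) (X_normsq n))).
  by apply: measurable_funX; exact: X_inner_meas.
move=> w; rewrite ger0_norm ?sqr_ge0// -exprMn -real_normK ?num_real//.
by rewrite lerXn2r ?nnegrE ?mulr_ge0// inner_CauchySchwarz.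
Qed.

Lemma X_cov x y n : Ex P (fun w => inner x (X n w) * inner y (X n w)) = inner x (Gamma y).
Proof.
have c : continuous (fun z : H => inner x z * inner y z).
  by move=> z; apply: cvgM; exact: inner_continuous.
have l m : L1 P (fun w => inner x (X m w) * inner y (X m w)).
  by apply: L1M; [exact: X_inner_meas|exact: X_inner_meas|exact: X_inner_sqr..].
have [_ ->] := X_expectation n c (l 1).
apply: EFin_inj; rewrite -Ex_fin//.
have [_ /(_ y)[_ /(_ x) <-]] := Gamma_cov.
apply: eq_integral => w _; congr EFin.
by rewrite [tensor _ _ _]/(inner _ _ *: _) innerZr (innerC _ y) mulrC.
Qed.

Lemma X_var x n : Ex P (fun w => inner x (X n w) ^+ 2) = inner x (Gamma x).
Proof. by rewrite -(X_cov x x n). Qed.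

(** * Independence of the innovations from the past *)

Definition past_generator (n : int) : set (set Omega) :=
  \bigcup_(m in [set m : int | m <= n])
    preimage_set_system [set: Omega] (X m : Omega -> borel H) measurable.

(** The generated sigma-algebra is the one of [sigma_upto]; carried by a type, it lets the usual
    closure lemmas for measurable functions apply to the past. *)
Definition past_measurable (n : int) (V : Omega -> R) :=
  measurable_fun setT (V : g_sigma_algebraType (past_generator n) -> R).

Lemma past_measurable_sub n V : past_measurable n V -> measurable_fun setT V.
Proof.
move=> mV _ B mB; rewrite setTI.
have := mV measurableT B mB; rewrite setTI.
apply: smallest_sub; first exact: sigma_algebra_measurable.
by move=> _ [m _ [A mA <-]]; exact: X_meas.
Qed.

Lemma past_measurable_le n m V : n <= m -> past_measurable n V -> past_measurable m V.
Proof.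
move=> nm mV _ B mB; have := mV measurableT B mB.
apply: smallest_sub; first exact: smallest_sigma_algebra.
move=> A [j /= jn Aj]; apply: sub_sigma_algebra.
by exists j => //=; exact: le_trans jn nm.
Qed.

Lemma past_measurable_X x n m : m <= n ->
  past_measurable n (fun w => inner x (X m w)).
Proof.
move=> mn.
have mX : measurable_fun setT
    (X m : g_sigma_algebraType (past_generator n) -> borel H).
  move=> _ A mA; rewrite setTI; apply: sub_sigma_algebra.
  by exists m => //; exists A => //; rewrite setTI.
exact: (measurableT_comp (continuous_real_measurable (@inner_continuous _ _ x)) mX).
Qed.

(** Built from [X] rather than from [eps]: the autoregression holds only almost surely, whereas this
    makes the recursion hold at every sample point and [eta x n] measurable for the past up to n.
    The link with [eps] is [eta_ae]. *)
Definition eta x n w := inner x (innovation rho X n w).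

Lemma etaE x n w : eta x n w = inner x (X n w) - inner (adj x) (X (n - 1) w).
Proof. by rewrite /eta /innovation innerBr adjE. Qed.

Lemma past_measurable_eta x n m : m <= n -> past_measurable n (eta x m).
Proof.
move=> mn; rewrite /past_measurable (funext (etaE x m)).
apply: measurable_funB; apply: past_measurable_X => //.
by apply: le_trans mn; rewrite gerBl.
Qed.

Lemma eta_meas x n : measurable_fun setT (eta x n).
Proof. exact: past_measurable_sub (past_measurable_eta x (lexx n)). Qed.

Lemma eta_ae x n : {ae P, forall w, eta x n w = inner x (eps n w)}.
Proof.
apply: filterS (X_ar n) => w Xw.
by rewrite /eta /innovation Xw addrC addKr.
Qed.

(** Independence is known for [eps n] and is transferred along the almost sure equality. The
    function [p] covers the identity, the powers 2 and 4, and the centered square. *)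
Lemma eta_indep x n (p : R -> R) V : continuous p -> past_measurable (n - 1) V ->
  L1 P (fun w => p (eta x n w)) -> L1 P V ->
  L1 P (fun w => p (eta x n w) * V w) /\
  Ex P (fun w => p (eta x n w) * V w) = Ex P (fun w => p (eta x n w)) * Ex P V.
Proof.
move=> cp pV lp lV; have mp : measurable_fun setT p by exact: continuous_measurable_fun.
have mV := past_measurable_sub pV.
pose U w := p (inner x (eps n w)).
have mep : measurable_fun setT (fun w => p (eta x n w)).
  exact: (measurableT_comp mp (eta_meas x n)).
have mpx : measurable_fun setT (fun z : borel H => p (inner x z)).
  exact: (measurableT_comp mp (continuous_real_measurable (@inner_continuous _ _ x))).
have mU : measurable_fun setT U by exact: (measurableT_comp mpx (eps_meas n)).
have UE : {ae P, forall w, p (eta x n w) = U w}.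
  by apply: filterS (eta_ae x n) => w ->.
have lU : L1 P U by exact: L1_ae_eq lp.
have iUV : independent_rv P U V.
  move=> A B mA mB; apply: (eps_indep (A := (fun z => p (inner x z)) @^-1` A)).
    by rewrite -[_ @^-1` _]setTI; exact: mpx.
  by have := pV measurableT B mB; rewrite setTI.
have [lUV EUV] := independent_integralM mU mV iUV lU lV.
have UVE : {ae P, forall w, U w * V w = p (eta x n w) * V w}.
  by apply: filterS UE => w ->.
have mpV : measurable_fun setT (fun w => p (eta x n w) * V w) by exact: measurable_funM.
split; first exact: L1_ae_eq lUV.
rewrite -(Ex_ae_eq _ _ UVE)//; last exact: measurable_funM.
by rewrite EUV; congr (_ * _); rewrite -(Ex_ae_eq _ _ UE).
Qed.

Lemma eta_expectation x n m (p : R -> R) : continuous p ->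
  L1 P (fun w => p (eta x n w)) ->
  L1 P (fun w => p (eta x m w)) /\
  Ex P (fun w => p (eta x m w)) = Ex P (fun w => p (eta x n w)).
Proof.
move=> cp lp; have mp : measurable_fun setT p by exact: continuous_measurable_fun.
have mep j : measurable_fun setT (fun w => p (eta x j w)).
  exact: (measurableT_comp mp (eta_meas x j)).
have cpx : continuous (fun z : H => p (inner x z)).
  by move=> z; apply: continuous_comp; [exact: inner_continuous|exact: cp].
have mU j : measurable_fun setT (fun w => p (inner x (eps j w))).
  exact: random_element_measurable (eps_meas j) cpx.
have UE j : {ae P, forall w, p (eta x j w) = p (inner x (eps j w))}.
  by apply: filterS (eta_ae x j) => w ->.
have UE' j : {ae P, forall w, p (inner x (eps j w)) = p (eta x j w)}.
  by apply: filterS (UE j) => w ->.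
have ln := L1_ae_eq (mU n) (UE n) lp.
have [lm Em] := same_law_expectation (eps_meas n) (eps_meas m) (eps_law n m) cpx ln.
split; first exact: L1_ae_eq (mep m) (UE' m) lm.
by rewrite (Ex_ae_eq (mep m) (mU m) (UE m)) (Ex_ae_eq (mep n) (mU n) (UE n)).
Qed.

Lemma eta_sqr x n : L1 P (fun w => eta x n w ^+ 2).
Proof.
under eq_fun do rewrite etaE; apply: L1_sqrD.
- exact: X_inner_meas.
- by apply: measurableT_comp => //; exact: X_inner_meas.
- exact: X_inner_sqr.
- by under eq_fun do rewrite sqrrN; exact: X_inner_sqr.
Qed.

Lemma eta_L1 x n : L1 P (eta x n).
Proof. by apply: L1_sqr; [exact: eta_meas|exact: eta_sqr]. Qed.

Lemma eta_centered x n : Ex P (eta x n) = 0.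
Proof.
rewrite (Ex_ae_eq (eta_meas x n) _ (eta_ae x n)); last first.
  exact: (random_element_measurable (eps_meas n) (@inner_continuous _ _ x)).
have [_ /(_ x)] := eps_centered n.
by rewrite /Ex /Rintegral => ->; rewrite inner0r.
Qed.

(** The martingale difference property, from which every orthogonality below is drawn. *)
Lemma eta_past_centered x n V : past_measurable (n - 1) V -> L1 P V ->
  L1 P (fun w => eta x n w * V w) /\ Ex P (fun w => eta x n w * V w) = 0.
Proof.
move=> pV lV.
have [l E] := @eta_indep x n idfun V (fun z => cvg_id) pV (eta_L1 x n) lV.
by split => //; rewrite E eta_centered mul0r.
Qed.

(** * Fourth moments *)

Variables (e : nat -> H) (lam : nat -> R) (C4 : R).
Hypothesis e_complete : complete_orthonormal e.
Hypothesis Gamma_e : forall l, Gamma (e l) = lam l *: e l.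
Hypothesis lam_gt0 : forall l, 0 < lam l.
Hypothesis X_coord4 : forall l, L1 P (fun w => inner (e l) (X 1 w) ^+ 4) /\
  Ex P (fun w => inner (e l) (X 1 w) ^+ 4) <= C4 * lam l ^+ 2.

Let oe : orthonormal_seq e. Proof. by have [] := e_complete. Qed.

Let expr_continuous m x : continuous (fun z : H => inner x z ^+ m).
Proof.
move=> z; apply: (@continuous_comp _ _ _ (inner x : H -> R) (fun r : R => r ^+ m)).
  exact: inner_continuous.
exact: exprn_continuous.
Qed.

Lemma X_coord_sqr l n : Ex P (fun w => inner (e l) (X n w) ^+ 2) = lam l.
Proof.
by rewrite X_var Gamma_e innerZr oe eqxx mulr1.
Qed.

Let C4_ge0 : 0 <= C4.
Proof.
have [_ h] := X_coord4 0%N.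
have : 0 <= C4 * lam 0%N ^+ 2.
  by apply: le_trans h; apply: Ex_ge0 => w; rewrite (exprM _ 2 2) sqr_ge0.
by rewrite pmulr_lge0// exprn_gt0.
Qed.

Lemma sum_lam_le m : \sum_(i < m) lam i <= Ex P (fun w => `|X 1 w| ^+ 2).
Proof.
have -> : \sum_(i < m) lam i =
    Ex P (fun w => \sum_(i < m) inner (e i) (X 1 w) ^+ 2).
  rewrite Ex_sum; last by move=> i; exact: X_inner_sqr.
  by apply: eq_bigr => i _; rewrite X_coord_sqr.
apply: Ex_le; last by move=> w; exact: bessel.
  by apply: L1_sum => i; exact: X_inner_sqr.
exact: X_normsq.
Qed.

Lemma X_coord_sqrM i j : L1 P (fun w => inner (e i) (X 1 w) ^+ 2 * inner (e j) (X 1 w) ^+ 2) /\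
  Ex P (fun w => inner (e i) (X 1 w) ^+ 2 * inner (e j) (X 1 w) ^+ 2) <= C4 * (lam i * lam j).
Proof.
have [li Ei] := X_coord4 i; have [lj Ej] := X_coord4 j.
have l : L1 P (fun w => inner (e i) (X 1 w) ^+ 2 * inner (e j) (X 1 w) ^+ 2).
  apply: L1M; try by apply: measurable_funX; exact: X_inner_meas.
    by under eq_fun do rewrite -exprM.
  by under eq_fun do rewrite -exprM.
split => //.
(* The weight balances the two fourth moments in the inequality of arithmetic and geometric means:
   both terms become C4 lam_i lam_j / 2. *)
pose s := lam j / lam i.
have s0 : 0 < s by rewrite divr_gt0.
pose g w := s / 2 * inner (e i) (X 1 w) ^+ 4 + (2 * s)^-1 * inner (e j) (X 1 w) ^+ 4.
have lg : L1 P g by apply: L1D; exact: L1Z.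
apply: (@le_trans _ _ (Ex P g)).
  apply: Ex_le => // w; rewrite /g.
  set a := inner (e i) _; set b := inner (e j) _.
  have -> : s / 2 * a ^+ 4 + (2 * s)^-1 * b ^+ 4 =
     (2 * s)^-1 * (s * a ^+ 2 - b ^+ 2) ^+ 2 + a ^+ 2 * b ^+ 2.
    by field; rewrite gt_eqF.
  by rewrite lerDr mulr_ge0 ?sqr_ge0// invr_ge0 mulr_ge0// ltW.
rewrite ExD; [|exact: L1Z..]; rewrite !ExZ//.
apply: (@le_trans _ _ (s / 2 * (C4 * lam i ^+ 2) + (2 * s)^-1 * (C4 * lam j ^+ 2))).
  apply: lerD; apply: ler_wpM2l => //.
    by rewrite divr_ge0 ?ltW.
  by rewrite invr_ge0 mulr_ge0 ?ltW.
rewrite le_eqVlt; apply/orP; left; apply/eqP; rewrite /s; field.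
by rewrite !gt_eqF.
Qed.

(** Squaring the partial Parseval sums gives a double sum of mixed moments, bounded by C4 times the
    square of the trace of Gamma; Fatou passes to the limit. *)
Lemma X_norm4 n : L1 P (fun w => `|X n w| ^+ 4).
Proof.
suff h : L1 P (fun w => `|X 1 w| ^+ 4).
  have c : continuous (fun x : H => `|x| ^+ 4).
    move=> x; apply: (@continuous_comp _ _ _ (fun y : H => `|y|) (fun r : R => r ^+ 4)).
      exact: norm_continuous.
    exact: exprn_continuous.
  by have [] := X_expectation n c h.
pose tau := Ex P (fun w => `|X 1 w| ^+ 2).
pose f m w := (\sum_(i < m) inner (e i) (X 1 w) ^+ 2) ^+ 2.
have fE m w : f m w = \sum_(i < m) \sum_(j < m)
    inner (e i) (X 1 w) ^+ 2 * inner (e j) (X 1 w) ^+ 2.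
  by rewrite /f expr2 mulr_suml; apply: eq_bigr => i _; rewrite mulr_sumr.
have lf m : L1 P (f m).
  rewrite (funext (fE m)); apply: L1_sum => i; apply: L1_sum => j.
  by have [] := X_coord_sqrM i j.
have [] // := @L1_fatou _ _ _ P f (fun w => `|X 1 w| ^+ 4) (C4 * tau ^+ 2).
- by move=> m w; exact: sqr_ge0.
- move=> m; rewrite (funext (fE m)) Ex_sum; last first.
    by move=> i; apply: L1_sum => j; have [] := X_coord_sqrM i j.
  apply: (@le_trans _ _ (C4 * (\sum_(i < m) lam i) ^+ 2)).
    rewrite expr2 mulr_suml mulr_sumr; apply: ler_sum => i _.
    rewrite Ex_sum; last by move=> j; have [] := X_coord_sqrM i j.
    rewrite !mulr_sumr; apply: ler_sum => j _.
    by have [] := X_coord_sqrM i j.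
  rewrite ler_wpM2l// lerXn2r ?nnegrE ?sum_lam_le//.
    by apply: sumr_ge0 => i _; exact: ltW.
  by apply: Ex_ge0 => w; exact: sqr_ge0.
- move=> w; rewrite (_ : `|X 1 w| ^+ 4 = (`|X 1 w| ^+ 2) ^+ 2); last by rewrite -exprM.
  have h : \sum_(i < n) inner (e i) (X 1 w) ^+ 2 @[n --> \oo] --> `|X 1 w| ^+ 2.
    by rewrite -inner_norm; exact: parseval.
  have c2 : continuous (fun r : R => r ^+ 2) by exact: exprn_continuous.
  exact: (cvg_comp _ (fun r : R => r ^+ 2) h (c2 _)).
Qed.

Lemma X_inner4 x n : L1 P (fun w => inner x (X n w) ^+ 4).
Proof.
apply: (L1_le _ _ (L1Z (`|x| ^+ 4) (X_norm4 n))).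
  by apply: measurable_funX; exact: X_inner_meas.
move=> w; rewrite normrX -exprMn.
by rewrite lerXn2r ?nnegrE ?mulr_ge0// inner_CauchySchwarz.
Qed.

Lemma eta4 x n : L1 P (fun w => eta x n w ^+ 4).
Proof.
apply: (L1_le _ _ (L1Z 8 (L1D (X_inner4 x n) (X_inner4 (adj x) (n - 1))))).
  by apply: measurable_funX; exact: eta_meas.
move=> w; rewrite etaE.
set a := inner x _; set b := inner _ _.
rewrite ger0_norm; last by rewrite (exprM _ 2 2) sqr_ge0.
rewrite -subr_ge0.
(* The inequality (a - b)^4 <= 8 (a^4 + b^4), with the difference displayed as visibly
   nonnegative. *)
have -> : 8 * (a ^+ 4 + b ^+ 4) - (a - b) ^+ 4 = 4 * (a ^+ 2 - b ^+ 2) ^+ 2 +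
  (a + b) ^+ 2 * (2 * (a ^+ 2 + b ^+ 2) + (a - b) ^+ 2) by ring.
apply: addr_ge0; first by rewrite mulr_ge0 ?sqr_ge0.
apply: mulr_ge0; first exact: sqr_ge0.
by apply: addr_ge0; rewrite ?sqr_ge0// mulr_ge0// addr_ge0 ?sqr_ge0.
Qed.

Let XE x n w : inner x (X n w) = eta x n w + inner (adj x) (X (n - 1) w).
Proof. by rewrite etaE subrK. Qed.

Lemma eta_lag_sqr x y n m : m <= n - 1 ->
  L1 P (fun w => (eta x n w * inner y (X m w)) ^+ 2) /\
  Ex P (fun w => (eta x n w * inner y (X m w)) ^+ 2) =
  Ex P (fun w => eta x n w ^+ 2) * inner y (Gamma y).
Proof.
move=> mn; under eq_fun do rewrite exprMn.
have c2 : continuous (fun r : R => r ^+ 2) by exact: exprn_continuous.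
have pV : past_measurable (n - 1) (fun w => inner y (X m w) ^+ 2).
  by apply: measurable_funX; exact: past_measurable_X.
have [l ->] := eta_indep c2 pV (eta_sqr x n) (X_inner_sqr y m).
by rewrite X_var.
Qed.

(** The covariance of the noise is Gamma - rho Gamma rho^*: when <x, X_n>^2 is expanded, the cross
    term has mean 0. *)
Lemma eta_variance x n :
  Ex P (fun w => eta x n w ^+ 2) = inner x (Gamma x) - inner (adj x) (Gamma (adj x)).
Proof.
have lE := eta_sqr x n.
have lA := X_inner_sqr (adj x) (n - 1).
have [lEA EA0] := eta_past_centered x (past_measurable_X (adj x) (lexx (n - 1)))
  (L1_sqr (X_inner_meas _ _) lA).
rewrite -(X_var x n) -(X_var (adj x) (n - 1)).
rewrite (_ : (fun w => inner x (X n w) ^+ 2) = (fun w => eta x n w ^+ 2 +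
  (eta x n w * inner (adj x) (X (n - 1) w) + eta x n w * inner (adj x) (X (n - 1) w))
  + inner (adj x) (X (n - 1) w) ^+ 2)); last first.
  by apply/funext => w; rewrite XE sqrrD mulr2n.
rewrite ExD//; last by apply: L1D => //; exact: L1D.
rewrite ExD//; last exact: L1D.
by rewrite ExD// EA0 !addr0 addrK.
Qed.

(** * Consistency of the empirical covariance *)

Let cov_err x n w : R :=
  n%:R^-1 * \sum_(1 <= j < n.+1) inner x (X j%:Z w) ^+ 2 - inner x (Gamma x).

Let posz_le (i j : nat) : (i < j)%N -> i%:Z <= j%:Z - 1.
Proof. by move=> ij; rewrite lerBrDr -PoszD lez_nat addn1. Qed.

(** [cross] and [square] are the two martingale differences left when <x, X_j>^2 is expanded into
    innovation and past. *)
Let cross x j w : R := eta x j%:Z w * inner (adj x) (X (j%:Z - 1) w).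

Let square x j w : R :=
  eta x j%:Z w ^+ 2 - (inner x (Gamma x) - inner (adj x) (Gamma (adj x))).

(** The term with X_0 and X_n comes from shifting the sum over X_(j-1) to a sum over X_j. *)
Let cov_err_rec x n w : (0 < n)%N -> cov_err x n w = cov_err (adj x) n w +
  (n%:R^-1 * (inner (adj x) (X 0 w) ^+ 2 - inner (adj x) (X n%:Z w) ^+ 2) +
   (2 * (n%:R^-1 * \sum_(1 <= j < n.+1) cross x j w)
    + n%:R^-1 * \sum_(1 <= j < n.+1) square x j w)).
Proof.
move=> n0; rewrite /cov_err.
have -> : \sum_(1 <= j < n.+1) inner x (X j%:Z w) ^+ 2 =
    \sum_(1 <= j < n.+1) eta x j%:Z w ^+ 2 +
    (2 * \sum_(1 <= j < n.+1) cross x j w +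
     \sum_(1 <= j < n.+1) inner (adj x) (X (j%:Z - 1) w) ^+ 2).
  rewrite mulr_sumr -!big_split/=; apply: eq_bigr => j _.
  by rewrite XE /cross; ring.
have -> : \sum_(1 <= j < n.+1) square x j w =
    \sum_(1 <= j < n.+1) eta x j%:Z w ^+ 2
    - n%:R * (inner x (Gamma x) - inner (adj x) (Gamma (adj x))).
  by rewrite sumrB sumr_const_nat subn1/= mulr_natl.
have -> : \sum_(1 <= j < n.+1) inner (adj x) (X (j%:Z - 1) w) ^+ 2 =
    \sum_(1 <= j < n.+1) inner (adj x) (X j%:Z w) ^+ 2 +
    (inner (adj x) (X 0 w) ^+ 2 - inner (adj x) (X n%:Z w) ^+ 2).
  rewrite big_add1/= [in RHS]big_nat_recr//=.
  rewrite big_ltn//.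
  under eq_bigr do rewrite -addn1 PoszD addrK.
  by rewrite subrr; ring.
by field; rewrite pnatr_eq0 -lt0n.
Qed.

Let small_cross x : small P (fun n w => n%:R^-1 * \sum_(1 <= j < n.+1) cross x j w).
Proof.
have mC j : past_measurable j%:Z (cross x j).
  apply: measurable_funM; first exact: past_measurable_eta.
  by apply: past_measurable_X; rewrite gerBl.
apply: (@small_average _ _ _ P _
  ((inner x (Gamma x) - inner (adj x) (Gamma (adj x))) * inner (adj x) (Gamma (adj x)))).
- by move=> j; exact: past_measurable_sub (mC j).
- by move=> j; have [] := eta_lag_sqr x (adj x) (lexx (j%:Z - 1)).
- move=> i j /andP[i0 ij].
  (* The product of the differences at i < j is [eta x j] times this [V], which is measurable for
     the past of j. *)
  pose V w := inner (adj x) (X (j%:Z - 1) w) * cross x i w.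
  have pV : past_measurable (j%:Z - 1) V.
    apply: measurable_funM; first exact: past_measurable_X.
    exact: past_measurable_le (posz_le ij) (mC i).
  have lV : L1 P V.
    apply: L1M; first exact: X_inner_meas.
    - exact: past_measurable_sub (mC i).
    - exact: X_inner_sqr.
    - by have [] := eta_lag_sqr x (adj x) (lexx (i%:Z - 1)).
  have [_ <-] := eta_past_centered x pV lV.
  by congr Ex; apply/funext => w; rewrite /V /cross; ring.
- move=> j _; have [_ ->] := eta_lag_sqr x (adj x) (lexx (j%:Z - 1)).
  by rewrite eta_variance.
Qed.

Let small_square x : small P (fun n w => n%:R^-1 * \sum_(1 <= j < n.+1) square x j w).
Proof.
set v := inner x (Gamma x) - inner (adj x) (Gamma (adj x)).
have cp : continuous (fun r : R => r ^+ 2 - v).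
  move=> r; apply: (@cvgB _ R^o); last exact: cvg_cst.
  exact: exprn_continuous.
have cp2 : continuous (fun r : R => (r ^+ 2 - v) ^+ 2).
  move=> r; apply: (@continuous_comp _ _ _ (fun r : R => r ^+ 2 - v) (fun r : R => r ^+ 2)).
    exact: cp.
  exact: exprn_continuous.
have pS j : past_measurable j%:Z (square x j).
  apply: measurable_funB => //; apply: measurable_funX.
  exact: past_measurable_eta.
have lS j : L1 P (square x j) by apply: L1B; [exact: eta_sqr|exact: L1_cst].
have lS2 j : L1 P (fun w => square x j w ^+ 2).
  apply: (L1_sqrD (f := fun w => eta x j%:Z w ^+ 2) (g := fun=> - v)).
  - by apply: measurable_funX; exact: eta_meas.
  - exact: measurable_cst.
  - by under eq_fun do rewrite -exprM; exact: eta4.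
  - exact: L1_cst.
apply: (@small_average _ _ _ P _ (Ex P (fun w => square x 1 w ^+ 2))).
- by move=> j; exact: past_measurable_sub (pS j).
- exact: lS2.
- move=> i j /andP[i0 ij].
  have [_] := eta_indep cp (past_measurable_le (posz_le ij) (pS i)) (lS j) (lS i).
  rewrite ExB; [|exact: eta_sqr|exact: L1_cst].
  rewrite eta_variance Ex_cst subrr mul0r => <-.
  by congr Ex; apply/funext => w; rewrite mulrC.
- move=> j _; have [_ h] := @eta_expectation x 1 j%:Z _ cp2 (lS2 1%N).
  by rewrite le_eqVlt; apply/orP; left; apply/eqP; exact: h.
Qed.

Let small_edge x : small P (fun n w => n%:R^-1 *
  (inner (adj x) (X 0 w) ^+ 2 - inner (adj x) (X n%:Z w) ^+ 2)).
Proof.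
pose s := inner (adj x) (Gamma (adj x)).
apply: (@small_le _ _ _ P _ (fun n w => n%:R^-1 *
  (inner (adj x) (X 0 w) ^+ 2 + inner (adj x) (X n%:Z w) ^+ 2))).
  apply: nearW => n w; rewrite normrM ger0_norm// ler_wpM2l//.
  by apply: le_trans (ler_normB _ _) _; rewrite !ger0_norm ?sqr_ge0.
apply: (@small_Ex _ _ _ P _ (fun n => n%:R^-1 * (s + s))).
- by move=> n w; rewrite mulr_ge0// addr_ge0 ?sqr_ge0.
- apply: nearW => n.
  have l := L1D (X_inner_sqr (adj x) 0) (X_inner_sqr (adj x) n%:Z).
  split; first exact: L1Z.
  rewrite ExZ// ExD; [|exact: X_inner_sqr..].
  rewrite le_eqVlt; apply/orP; left; apply/eqP; congr (_ * (_ + _)).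
    exact: X_var.
  exact: X_var.
- by rewrite -(mul0r (s + s)); apply: cvgM; [exact: cvg_invn|exact: cvg_cst].
Qed.

Hypothesis adj_norm : forall x, `|adj x| <= `|rho| * `|x|.
Hypothesis rho_lt1 : `|rho| < 1.

Let cov_err_small x : small P (cov_err x).
Proof.
pose g m n w := `|cov_err x n w - cov_err (iter m adj x) n w|.
apply: (@small_approx _ _ _ P _ g (fun m n w => `|cov_err (iter m adj x) n w|)).
- move=> m; apply: nearW => n w; rewrite /g.
  by rewrite -[X in `|X| <= _](subrK (cov_err (iter m adj x) n w)) ler_normD.
- move=> m; apply: small_norm; elim: m => [|m IH].
    apply: (@small_le _ _ _ P _ (fun _ _ => 0)).
      by apply: nearW => n w; rewrite /= subrr normr0.
    by apply: small_cvg0; exact: cvg_cst.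
  set y := iter m adj x in IH *.
  apply: (@small_le _ _ _ P _ (fun n w => `|cov_err x n w - cov_err y n w| +
    `|(n%:R^-1 * (inner (adj y) (X 0 w) ^+ 2 - inner (adj y) (X n%:Z w) ^+ 2) +
   (2 * (n%:R^-1 * \sum_(1 <= j < n.+1) cross y j w)
    + n%:R^-1 * \sum_(1 <= j < n.+1) square y j w))|)).
    exists 1%N => // n /= n0 w.
    apply: le_trans _ (ler_normD _ _); rewrite le_eqVlt; apply/orP; left; apply/eqP.
    by congr `| _ |; rewrite (cov_err_rec y w n0) -/y; ring.
  apply: smallD; apply: small_norm => //.
  apply: smallD; first exact: small_edge.
  apply: smallD; last exact: small_square.
  by apply: tightM_small; [exact: tight_cst|exact: small_cross].
- move=> M eta M0 eta0.
  pose tau := Ex P (fun w => `|X 1 w| ^+ 2).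
  have tau0 : 0 <= tau by apply: Ex_ge0 => w; exact: sqr_ge0.
  have Gle y : inner y (Gamma y) <= `|y| ^+ 2 * tau.
    rewrite -(X_var _ 1) -ExZ; last exact: X_normsq.
    apply: Ex_le; [exact: X_inner_sqr|by apply: L1Z; exact: X_normsq|].
    move=> w; rewrite -exprMn -real_normK ?num_real// lerXn2r ?nnegrE ?mulr_ge0//.
    exact: inner_CauchySchwarz.
  have xm m : `|iter m adj x| <= `|rho| ^+ m * `|x|.
    elim: m => [|m IH] /=; first by rewrite mul1r.
    apply: le_trans (adj_norm _) _; rewrite exprS -mulrA ler_wpM2l//.
  have : `|rho| ^+ m * `|x| @[m --> \oo] --> 0.
    rewrite -(mul0r `|x|); apply: cvgM; last exact: cvg_cst.
    by apply: cvg_expr; rewrite normr_id.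
  move=> /(cvgr0_norm_le _) hc.
  (* As a <= 1, |y| <= a yields |y|^2 <= a, and the second bound gives 2 tau a <= eta M; the added 1
     keeps the divisor positive. *)
  pose a := Num.min 1 (eta * M / (2 * tau + 1)).
  have t0 : 0 < 2 * tau + 1 by rewrite ltr_wpDl// mulr_ge0.
  have a0 : 0 < a by rewrite lt_min ltr01/= divr_gt0// mulr_gt0.
  have [m _ /(_ m (leqnn m)) hm] := hc _ a0.
  exists m; exists 1%N => // n /= n0.
  set y := iter m adj x.
  have lq : L1 P (fun w => n%:R^-1 * \sum_(1 <= j < n.+1) inner y (X j%:Z w) ^+ 2).
    by apply: L1Z; apply: L1_sum => j; exact: X_inner_sqr.
  have Eq : Ex P (fun w => n%:R^-1 * \sum_(1 <= j < n.+1) inner y (X j%:Z w) ^+ 2) =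
      inner y (Gamma y).
    rewrite ExZ; last by apply: L1_sum => j; exact: X_inner_sqr.
    rewrite Ex_sum; last by move=> j; exact: X_inner_sqr.
    under eq_bigr do rewrite X_var.
    by rewrite sumr_const_nat subn1/= -(mulr_natl (inner y (Gamma y))) mulKf// pnatr_eq0 -lt0n.
  have y1 : `|y| ^+ 2 <= a.
    have ya : `|y| <= a by apply: le_trans (xm m) _; apply: le_trans (ler_norm _) hm.
    rewrite expr2; apply: le_trans (ler_wpM2l (normr_ge0 y) ya) _.
    rewrite ler_piMl ?(ltW a0)//; apply: le_trans ya _.
    by rewrite ge_min lexx.
  have ce w : `|cov_err y n w| <= n%:R^-1 * \sum_(1 <= j < n.+1) inner y (X j%:Z w) ^+ 2
      + inner y (Gamma y).
    apply: le_trans (ler_normB _ _) _; apply: lerD; rewrite ger0_norm//.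
      by rewrite mulr_ge0// sumr_ge0// => j _; exact: sqr_ge0.
    by rewrite -(X_var _ 1); apply: Ex_ge0 => v; exact: sqr_ge0.
  apply: (@bounded_off_le _ _ _ _ eta eta M M (fun w =>
      n%:R^-1 * \sum_(1 <= j < n.+1) inner y (X j%:Z w) ^+ 2 + inner y (Gamma y))) => //.
    move=> w; rewrite normr_id; apply: le_trans.
    exact: le_trans (ce w) (ler_norm _).
  apply: (@bounded_off_Ex _ _ _ P _ M eta (2 * tau * a)) => //.
  + by apply: L1D => //; exact: L1_cst.
  + by move=> w; apply: le_trans (ce w).
  + rewrite ExD//; last exact: L1_cst.
    rewrite Eq Ex_cst.
    have := le_trans (Gle y) (ler_wpM2r tau0 y1).
    lra.
  + have ha : a <= eta * M / (2 * tau + 1) by rewrite ge_min lexx orbT.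
    move: ha; rewrite ler_pdivlMr//.
    have := a0; nra.
Qed.

(** Polarization of the quadratic statement [cov_err_small]. *)
Let emp_cov_entry_small y z :
  small P (fun n w => inner y (emp_cov X n w z) - inner y (Gamma z)).
Proof.
apply: (@small_le _ _ _ P _ (fun n w =>
    `|4^-1 * cov_err (y + z) n w| + `|4^-1 * cov_err (y - z) n w|)).
  apply: nearW => n w; apply: le_trans _ (ler_normB _ _).
  rewrite le_eqVlt; apply/orP; left; apply/eqP; congr `| _ |.
  have -> : inner y (Gamma z) =
      4^-1 * (inner (y + z) (Gamma (y + z)) - inner (y - z) (Gamma (y - z))).
    rewrite -(X_cov y z 1) -!(X_var _ 1) -ExB; [|exact: X_inner_sqr..].
    rewrite -ExZ; last by apply: L1B; exact: X_inner_sqr.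
    congr Ex; apply/funext => v.
    by rewrite innerDl -[- z]scaleN1r innerDl innerZl; field.
  have -> : inner y (emp_cov X n w z) = 4^-1 *
      (n%:R^-1 * \sum_(1 <= j < n.+1) inner (y + z) (X j%:Z w) ^+ 2 -
       n%:R^-1 * \sum_(1 <= j < n.+1) inner (y - z) (X j%:Z w) ^+ 2).
    rewrite inner_emp_cov -mulrBr mulrCA; congr (_ * _).
    rewrite -sumrB mulr_sumr; apply: eq_bigr => j _.
    by rewrite innerDl -[- z]scaleN1r innerDl innerZl !(innerC (X _ _)); field.
  by rewrite /cov_err; ring.
by apply: smallD; apply: small_norm; apply: tightM_small;
  [exact: tight_cst|exact: cov_err_small|exact: tight_cst|exact: cov_err_small].
Qed.

Let residual J (x : H) : H := x - \sum_(i < J) inner (e i) x *: e i.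

Let residualZ J a x : residual J (a *: x) = a *: residual J x.
Proof.
rewrite /residual scalerBr scaler_sumr; congr (_ - _); apply: eq_bigr => i _.
by rewrite innerZr scalerA.
Qed.

Let residualB J x y : residual J (x - y) = residual J x - residual J y.
Proof.
rewrite /residual; set a := \sum_(i < J) inner (e i) x *: _.
set b := \sum_(i < J) inner (e i) y *: _.
have -> : \sum_(i < J) inner (e i) (x - y) *: e i = a - b.
  by rewrite -sumrB; apply: eq_bigr => i _; rewrite innerBr scalerBl.
by rewrite !opprB [b - a]addrC addrACA [- y + b]addrC.
Qed.

Let residual_le J x : `|residual J x| <= `|x|.
Proof.
rewrite -(@ler_pXn2r _ 2)// ?nnegrE// /residual orthonormal_residual//.
by rewrite gerBl sumr_ge0// => i _; exact: sqr_ge0.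
Qed.

Let residual_continuous J : continuous (fun x : H => `|x| * `|residual J x|).
Proof.
move=> x; apply: cvgM; first exact: norm_continuous.
apply: cvg_norm; apply: (@lipschitz_continuous _ _ _ 1 (residual J)) => y z.
by rewrite -residualB mul1r residual_le.
Qed.

Let tail_L1 J n : L1 P (fun w => `|X n w| * `|residual J (X n w)|).
Proof.
apply: (L1_le _ _ (X_normsq n)).
  exact: (random_element_measurable (X_meas n) (@residual_continuous J)).
by move=> w; rewrite ger0_norm ?mulr_ge0// expr2 ler_wpM2l.
Qed.

Let tail_cvg0 :
  Ex P (fun w => `|X 1 w| * `|residual J (X 1 w)|) @[J --> \oo] --> 0.
Proof.
have [|||||_ _ h] := @dominated_convergence _ _ _ P setT measurableT
  (fun J w => (`|X 1 w| * `|residual J (X 1 w)|)%:E) (fun=> 0%E)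
  (fun w => (`|X 1 w| ^+ 2)%:E).
- by move=> J; apply/measurable_EFinP; exact: L1_measurable (tail_L1 J 1).
- exact: measurable_cst.
- apply: aeW => w _; apply: cvg_EFin; first exact: nearW.
  rewrite -[X in _ --> X](mulr0 `|X 1 w|); apply: cvgM; first exact: cvg_cst.
  rewrite -[X in _ --> X](@normr0 _ H); apply: cvg_norm.
  rewrite -[X in _ --> X](subrr (X 1 w)); apply: cvgB; first exact: cvg_cst.
  exact: complete_orthonormal_cvg.
- exact: X_normsq.
- apply: aeW => w J _ /=; rewrite lee_fin ger0_norm ?mulr_ge0// expr2.
  by rewrite ler_wpM2l.
move: h; rewrite integral0 => h.
by apply: (fine_cvg h).
Qed.

(** Convergence of the entries is only weak. Norm convergence follows because the part of Gamma_n
    e_l beyond the first J coordinates is at most the average of |X_j| |residual J X_j|, whose mean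
    does not depend on n and tends to 0 as J grows. *)
Lemma emp_cov_small l :
  small P (fun n w => `|emp_cov X n w (e l) - lam l *: e l|).
Proof.
pose v n w := emp_cov X n w (e l) - lam l *: e l.
pose g m n w := \sum_(i < m + l.+1)
  `|inner (e i) (emp_cov X n w (e l)) - inner (e i) (Gamma (e l))|.
pose h m n w := n%:R^-1 * \sum_(1 <= j < n.+1)
  (`|X j%:Z w| * `|residual (m + l.+1) (X j%:Z w)|).
have h0 m n w : 0 <= h m n w.
  by rewrite mulr_ge0// sumr_ge0// => j _; rewrite mulr_ge0.
apply: (@small_approx _ _ _ P _ g h).
- move=> m; apply: nearW => n w; rewrite normr_id -/(v n w).
  have -> : v n w = \sum_(i < m + l.+1) inner (e i) (v n w) *: e i
      + residual (m + l.+1) (v n w) by rewrite /residual addrC subrK.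
  apply: le_trans (ler_normD _ _) _; apply: lerD.
    apply: le_trans (ler_norm_sum _ _ _) _; apply: ler_sum => i _.
    by rewrite normrZ (orthonormal_norm oe) mulr1 /v innerBr Gamma_e.
  rewrite /v residualB (residualZ _ (lam l)).
  (* The offset [l.+1] in the truncation level is there for this: [e l] is always among the retained
     coordinates. *)
  have -> : residual (m + l.+1) (e l) = 0.
    apply/eqP; rewrite -normr_eq0 -sqrf_eq0 /residual orthonormal_residual//.
    rewrite (orthonormal_norm oe) expr1n.
    have lm : (l < m + l.+1)%N by rewrite addnS ltnS leq_addl.
    rewrite (bigD1 (Ordinal lm))//= oe eqxx expr1n big1 ?addr0 ?subrr// => i il.
    rewrite oe; case: eqVneq => [E|_]; last by rewrite expr0n.
    by case/eqP: il; apply/val_inj.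
  rewrite scaler0 subr0 emp_covE residualZ normrZ ger0_norm// ler_wpM2l//.
  have -> : residual (m + l.+1) (\sum_(1 <= j < n.+1) inner (X j%:Z w) (e l) *: X j%:Z w)
      = \sum_(1 <= j < n.+1) inner (X j%:Z w) (e l) *: residual (m + l.+1) (X j%:Z w).
    under [RHS]eq_bigr do rewrite -residualZ.
    apply: (big_morph (residual (m + l.+1))).
      by move=> x y; rewrite -{1}[y]opprK residualB -[- y]scaleN1r residualZ scaleN1r opprK.
    by have := residualZ (m + l.+1) 0 0; rewrite !scale0r.
  apply: le_trans (ler_norm_sum _ _ _) _; apply: ler_sum => j _.
  rewrite normrZ ler_wpM2r//; apply: le_trans (inner_CauchySchwarz _ _) _.
  by rewrite (orthonormal_norm oe) mulr1.
- move=> m; rewrite /g; elim: (m + l.+1)%N => [|J IH].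
    apply: (@small_le _ _ _ P _ (fun _ _ => 0)).
      by apply: nearW => n w; rewrite big_ord0 normr0.
    by apply: small_cvg0; exact: cvg_cst.
  have -> : (fun n w => \sum_(i < J.+1)
         `|inner (e i) (emp_cov X n w (e l)) - inner (e i) (Gamma (e l))|)
     = (fun n w => \sum_(i < J)
         `|inner (e i) (emp_cov X n w (e l)) - inner (e i) (Gamma (e l))|
       + `|inner (e J) (emp_cov X n w (e l)) - inner (e J) (Gamma (e l))|).
    by apply/funext => n; apply/funext => w; rewrite big_ord_recr.
  by apply: smallD => //; apply: small_norm; exact: emp_cov_entry_small.
- move=> M eta0 M0 eta00.
  have := tail_cvg0; move=> /(cvgr0_norm_le _)/(_ _ (mulr_gt0 eta00 M0)) [m _ hm].
  exists m; exists 1%N => // n /= n0.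
  have lh j : L1 P (fun w => `|X j w| * `|residual (m + l.+1) (X j w)|) by exact: tail_L1.
  have lsum : L1 P (fun w => \sum_(1 <= j < n.+1)
      (`|X j%:Z w| * `|residual (m + l.+1) (X j%:Z w)|)).
    by apply: L1_sum => j; exact: lh.
  apply: (@bounded_off_Ex _ _ _ P _ M eta0 (eta0 * M)) => //.
  + by rewrite /h; exact: L1Z.
  + rewrite /h ExZ// Ex_sum; last by move=> j; exact: lh.
    have EX j : Ex P (fun w => `|X j w| * `|residual (m + l.+1) (X j w)|) =
        Ex P (fun w => `|X 1 w| * `|residual (m + l.+1) (X 1 w)|).
      by have [_] := X_expectation j (@residual_continuous (m + l.+1)) (lh 1).
    under eq_bigr do rewrite EX.
    rewrite sumr_const_nat subn1/= -(mulr_natl (Ex _ _)) mulKf ?pnatr_eq0 -?lt0n//.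
    by apply: le_trans (ler_norm _) _; apply: hm => /=; exact: leq_addr.
Qed.

(** * Moments of the noise sums *)

Definition noise_sum y z n w : R :=
  \sum_(1 <= j < n) eta y j.+1%:Z w * inner z (X j%:Z w).

Lemma inner_noise_sum y z n w :
  inner z (noise_vector rho X n y w) = (n.-1)%:R^-1 * noise_sum y z n w.
Proof.
rewrite innerC inner_noise_vector; congr (_ * _); apply: eq_bigr => j _.
by rewrite innerC (innerC z).
Qed.

Let noise y z (j : nat) w : R := eta y j.+1%:Z w * inner z (X j%:Z w).

Let posS1 (j : nat) : j.+1%:Z - 1 = j%:Z. Proof. by rewrite -addn1 PoszD addrK. Qed.

Let past_noise y z (i j : nat) : (i < j)%N -> past_measurable j%:Z (noise y z i).
Proof.
move=> ij; apply: measurable_funM; first by apply: past_measurable_eta; rewrite lez_nat.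
by apply: past_measurable_X; rewrite lez_nat ltnW.
Qed.

Let noise_meas y z j : measurable_fun setT (noise y z j).
Proof. exact: past_measurable_sub (@past_noise y z j j.+1 (ltnSn j)). Qed.

Let noise_sqr y z j : L1 P (fun w => noise y z j w ^+ 2) /\
  Ex P (fun w => noise y z j w ^+ 2) =
  Ex P (fun w => eta y 1 w ^+ 2) * inner z (Gamma z).
Proof.
have [|l ->] := @eta_lag_sqr y z j.+1%:Z j%:Z; first by rewrite posS1.
split => //; congr (_ * _).
have c2 : continuous (fun r : R => r ^+ 2) by exact: exprn_continuous.
by have [_] := eta_expectation j.+1%:Z c2 (eta_sqr y 1).
Qed.

Lemma noise_sum_sqr y z n : L1 P (fun w => noise_sum y z n w ^+ 2) /\
  Ex P (fun w => noise_sum y z n w ^+ 2) =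
  (n.-1)%:R * (Ex P (fun w => eta y 1 w ^+ 2) * inner z (Gamma z)).
Proof.
have lN j : L1 P (fun w => noise y z j w ^+ 2) by have [] := noise_sqr y z j.
split; first by apply: L1_sqr_sum => j; [exact: noise_meas|exact: lN].
rewrite (@Ex_sqr_sum _ _ _ P (noise y z))//.
  under eq_bigr do rewrite (noise_sqr y z _).2.
  by rewrite sumr_const_nat subn1 mulr_natl.
move=> i j /andP[i1 ij].
pose V w := inner z (X j%:Z w) * noise y z i w.
have pV : past_measurable (j.+1%:Z - 1) V.
  rewrite posS1; apply: measurable_funM; first exact: past_measurable_X.
  exact: past_noise.
have lV : L1 P V by apply: L1M => //; [exact: X_inner_meas|exact: X_inner_sqr].
have [_ <-] := eta_past_centered y pV lV.
by congr Ex; apply/funext => w; rewrite /V /noise; ring.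
Qed.

Lemma noise_vector_tight y :
  tight P (fun n w => Num.sqrt n%:R * `|noise_vector rho X n y w|).
Proof.
apply: tight_sqr.
pose s2 := Ex P (fun w => eta y 1 w ^+ 2).
pose tau := Ex P (fun w => `|X 1 w| ^+ 2).
have s20 : 0 <= s2 by apply: Ex_ge0 => w; exact: sqr_ge0.
have tau0 : 0 <= tau by apply: Ex_ge0 => w; exact: sqr_ge0.
(* Summing the coordinate variances, n E |V_n|^2 is at most n / (n - 1) times s2 tau, and n / (n -
   1) <= 2 from n = 2 on. *)
apply: (@tight_Ex _ _ _ P _ (2 * (s2 * tau))).
  by move=> n w; exact: sqr_ge0.
exists 2%N => // -[//|[//|n]] _; set N := n.+2.
have N0 : (N.-1)%:R != 0 :> R by rewrite pnatr_eq0.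
pose f m w := N%:R * \sum_(i < m) ((N.-1)%:R^-1 * noise_sum y (e i) N w) ^+ 2.
have lf1 i : L1 P (fun w => ((N.-1)%:R^-1 * noise_sum y (e i) N w) ^+ 2).
  by under eq_fun do rewrite exprMn; apply: L1Z; have [] := noise_sum_sqr y (e i) N.
have lf m : L1 P (f m) by apply: L1Z; apply: L1_sum.
apply: (L1_fatou (f := f)) => //.
- by move=> m w; rewrite mulr_ge0// sumr_ge0// => i _; exact: sqr_ge0.
- move=> m; rewrite ExZ; last exact: L1_sum.
  rewrite Ex_sum//.
  have E i : Ex P (fun w => ((N.-1)%:R^-1 * noise_sum y (e i) N w) ^+ 2) =
      (N.-1)%:R^-1 * s2 * lam i.
    under eq_fun do rewrite exprMn.
    have [l E] := noise_sum_sqr y (e i) N.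
    by rewrite ExZ// E Gamma_e innerZr oe eqxx mulr1 -/s2; field.
  under eq_bigr do rewrite E.
  rewrite -mulr_sumr mulrA; apply: le_trans (ler_wpM2l _ (sum_lam_le m)) _.
    by rewrite !mulr_ge0.
  rewrite -/tau !mulrA ler_wpM2r// ler_wpM2r//.
  rewrite ler_pdivrMr ?ltr0n// -natrM ler_nat /N /=.
  by rewrite mul2n -addnn addSnnS leq_addl.
- move=> w; rewrite exprMn sqr_sqrtr ?ler0n//.
  apply: cvgM; first exact: cvg_cst.
  rewrite -inner_norm; set v := noise_vector rho X N y w.
  have := @parseval _ _ e v v e_complete.
  apply: cvg_trans; apply: near_eq_cvg; apply: nearW => m.
  by apply: eq_bigr => i _; rewrite -expr2 inner_noise_sum.
Qed.

Lemma mean_sq_norm_tight : tight P (mean_sq_norm X).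
Proof.
apply: (@tight_Ex _ _ _ P _ (Ex P (fun w => `|X 1 w| ^+ 2))).
  by move=> n w; exact: mean_sq_norm_ge0.
have lsum n : L1 P (fun w => \sum_(1 <= j < n.+1) `|X j%:Z w| ^+ 2).
  by apply: L1_sum => j; exact: X_normsq.
exists 1%N => // n /= n0; split; first exact: L1Z.
rewrite ExZ// Ex_sum; last by move=> j; exact: X_normsq.
have E j : Ex P (fun w => `|X j w| ^+ 2) = Ex P (fun w => `|X 1 w| ^+ 2).
  by have [_] := X_expectation j normsq_continuous (X_normsq 1).
under eq_bigr do rewrite E.
by rewrite sumr_const_nat subn1/= -(mulr_natl (Ex _ _)) mulKf ?pnatr_eq0 -?lt0n.
Qed.

Lemma X_normsq_tight : tight P (fun n w => `|X n%:Z w| ^+ 2).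
Proof.
apply: (@tight_Ex _ _ _ P _ (Ex P (fun w => `|X 1 w| ^+ 2))).
  by move=> n w; exact: sqr_ge0.
apply: nearW => n; split; first exact: X_normsq.
have [_ E] := X_expectation n%:Z normsq_continuous (X_normsq 1).
by rewrite le_eqVlt E eqxx.
Qed.

(* Otherwise [X n = rho (X (n - 1))] almost surely, and stationarity would give
   [E |X n|^2 <= |rho|^2 E |X n|^2]. *)
Lemma innovation_nondegenerate : exists l, 0 < Ex P (fun w => eta (e l) 1 w ^+ 2).
Proof.
apply: contrapT => /forallNP h.
pose tau := Ex P (fun w => `|X 1 w| ^+ 2).
have E0 l : inner (adj (e l)) (Gamma (adj (e l))) = lam l.
  have : Ex P (fun w => eta (e l) 1 w ^+ 2) = 0.
    apply/eqP; rewrite eq_le; apply/andP; split; last first.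
      by apply: Ex_ge0 => w; exact: sqr_ge0.
    by rewrite leNgt; apply/negP; exact: h.
  rewrite eta_variance Gamma_e innerZr oe eqxx mulr1 => /eqP.
  by rewrite subr_eq0 => /eqP.
have ls l : L1 P (fun w => inner (e l) (rho (X 1 w)) ^+ 2).
  by under eq_fun do rewrite -adjE; exact: X_inner_sqr.
have sum_le m : \sum_(i < m) lam i <= `|rho| ^+ 2 * tau.
  have -> : \sum_(i < m) lam i =
      Ex P (fun w => \sum_(i < m) inner (e i) (rho (X 1 w)) ^+ 2).
    rewrite Ex_sum//; apply: eq_bigr => i _; rewrite -E0 -(X_var _ 1).
    by congr Ex; apply/funext => w; rewrite adjE.
  rewrite -ExZ; last exact: X_normsq.
  apply: Ex_le; [exact: L1_sum|by apply: L1Z; exact: X_normsq|].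
  move=> w; apply: le_trans (bessel _ _ oe) _.
  rewrite -exprMn lerXn2r ?nnegrE ?mulr_ge0//; exact: ler_opnorm.
have lX m : L1 P (fun w => \sum_(i < m) inner (e i) (X 1 w) ^+ 2).
  by apply: L1_sum => i; exact: X_inner_sqr.
have tau_le : tau <= `|rho| ^+ 2 * tau.
  have [] // := @L1_fatou _ _ _ P (fun m w => \sum_(i < m) inner (e i) (X 1 w) ^+ 2)
    (fun w => `|X 1 w| ^+ 2) (`|rho| ^+ 2 * tau).
  - by move=> m w; apply: sumr_ge0 => i _; exact: sqr_ge0.
  - move=> m; rewrite Ex_sum; last by move=> i; exact: X_inner_sqr.
    by under eq_bigr do rewrite X_coord_sqr.
  - by move=> w; rewrite -inner_norm; exact: parseval.
have tau0 : 0 < tau.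
  by apply: lt_le_trans (lam_gt0 0) _; have := sum_lam_le 1; rewrite big_ord1.
move: tau_le; rewrite ler_pMl//; apply/negP; rewrite -ltNge.
by rewrite expr_lt1.
Qed.

Let X_coord4_le l n : Ex P (fun w => inner (e l) (X n w) ^+ 4) <= C4 * lam l ^+ 2.
Proof.
have [l4 E4] := X_coord4 l.
by have [_ ->] := X_expectation n (@expr_continuous 4 (e l)) l4.
Qed.

(** One step of a discrete Gronwall argument for E M^4. The horizon [N] is a free parameter, chosen
    later as the number of steps, so that the factors 1 + 1 / N multiply to at most e. *)
Let noise_fourth_step y l (M : Omega -> R) (N k : nat)
    (s2 := Ex P (fun w => eta y 1 w ^+ 2)) (kappa := Ex P (fun w => eta y 1 w ^+ 4)) :
  (0 < N)%N -> past_measurable k%:Z M -> L1 P (fun w => M w ^+ 4) ->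
  L1 P (fun w => (M w + noise y (e l) k w) ^+ 4) /\
  Ex P (fun w => (M w + noise y (e l) k w) ^+ 4) <=
    (1 + N%:R^-1) * Ex P (fun w => M w ^+ 4)
    + N%:R * ((16 * s2 ^+ 2 + 3 * kappa) * (C4 * lam l ^+ 2)).
Proof.
move=> N0 pM lM4; have mM := past_measurable_sub pM.
pose x w := inner (e l) (X k%:Z w); pose h := eta y k.+1%:Z.
have s20 : 0 <= s2 by apply: Ex_ge0 => w; exact: sqr_ge0.
have kappa0 : 0 <= kappa by apply: Ex_ge0 => w; rewrite (exprM _ 2 2) sqr_ge0.
have N1 : 1 <= N%:R :> R by rewrite ler1n.
have px : past_measurable k%:Z x by exact: past_measurable_X.
have mx : measurable_fun setT x by exact: X_inner_meas.
have mh : measurable_fun setT h by exact: eta_meas.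
have lx4 : L1 P (fun w => x w ^+ 4) by exact: X_inner4.
have Ex4 : Ex P (fun w => x w ^+ 4) <= C4 * lam l ^+ 2 by exact: X_coord4_le.
have c2 : continuous (fun r : R => r ^+ 2) by exact: exprn_continuous.
have c4 : continuous (fun r : R => r ^+ 4) by exact: exprn_continuous.
have [lM3d EM3d] : L1 P (fun w => h w * (M w ^+ 3 * x w)) /\
    Ex P (fun w => h w * (M w ^+ 3 * x w)) = 0.
  apply: eta_past_centered.
    by rewrite posS1; apply: measurable_funM => //; exact: measurable_funX.
  apply: (L1_le _ _ (L1D lM4 lx4)).
    by apply: measurable_funM => //; exact: measurable_funX.
  move=> w; rewrite normrM normrX.
  rewrite -[M w ^+ 4]ger0_norm; last by rewrite (exprM _ 2 2) sqr_ge0.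
  rewrite -[x w ^+ 4]ger0_norm; last by rewrite (exprM _ 2 2) sqr_ge0.
  rewrite !normrX; set a := `|M w|; set b := `|x w|.
  have a0 : 0 <= a by exact: normr_ge0.
  have b0 : 0 <= b by exact: normr_ge0.
  have [ab|/ltW ba] := lerP a b.
    apply: (@le_trans _ _ (b ^+ 4)); last by rewrite lerDr exprn_ge0.
    by rewrite (exprSr b 3) ler_wpM2r// lerXn2r.
  apply: (@le_trans _ _ (a ^+ 4)); last by rewrite lerDl exprn_ge0.
  by rewrite (exprSr a 3) ler_wpM2l// exprn_ge0.
have lM2x2 : L1 P (fun w => M w ^+ 2 * x w ^+ 2).
  apply: L1M; try exact: measurable_funX.
    by under eq_fun do rewrite -exprM.
  by under eq_fun do rewrite -exprM.
have [lM2d2 EM2d2] : L1 P (fun w => h w ^+ 2 * (M w ^+ 2 * x w ^+ 2)) /\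
    Ex P (fun w => h w ^+ 2 * (M w ^+ 2 * x w ^+ 2)) =
    s2 * Ex P (fun w => M w ^+ 2 * x w ^+ 2).
  have pV : past_measurable (k.+1%:Z - 1) (fun w => M w ^+ 2 * x w ^+ 2).
    by rewrite posS1; apply: measurable_funM; exact: measurable_funX.
  have [? ->] := eta_indep c2 pV (eta_sqr y k.+1%:Z) lM2x2.
  by split => //; have [_ ->] := eta_expectation k.+1%:Z c2 (eta_sqr y 1).
have [ld4 Ed4] : L1 P (fun w => h w ^+ 4 * x w ^+ 4) /\
    Ex P (fun w => h w ^+ 4 * x w ^+ 4) = kappa * Ex P (fun w => x w ^+ 4).
  have pV : past_measurable (k.+1%:Z - 1) (fun w => x w ^+ 4).
    by rewrite posS1; exact: measurable_funX.
  have [? ->] := eta_indep c4 pV (eta4 y k.+1%:Z) lx4.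
  by split => //; have [_ ->] := eta_expectation k.+1%:Z c4 (eta4 y 1).
have lMd : L1 P (fun w => (M w + noise y (e l) k w) ^+ 4).
  apply: (L1_le _ _ (L1Z 8 (L1D lM4 ld4))).
    by apply: measurable_funX; apply: measurable_funD => //; exact: noise_meas.
  move=> w; rewrite -exprMn -/(noise y (e l) k w).
  set a := M w; set b := noise _ _ _ _.
  rewrite ger0_norm; last by rewrite (exprM _ 2 2) sqr_ge0.
  rewrite -subr_ge0.
  have -> : 8 * (a ^+ 4 + b ^+ 4) - (a + b) ^+ 4 = 4 * (a ^+ 2 - b ^+ 2) ^+ 2 +
    (a - b) ^+ 2 * (2 * (a ^+ 2 + b ^+ 2) + (a + b) ^+ 2) by ring.
  apply: addr_ge0; first by rewrite mulr_ge0 ?sqr_ge0.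
  apply: mulr_ge0; first exact: sqr_ge0.
  by apply: addr_ge0; rewrite ?sqr_ge0// mulr_ge0// addr_ge0 ?sqr_ge0.
split => //.
(* With d = h x, 4 M d^3 <= 2 M^2 d^2 + 2 d^4 removes the odd power of d; this turns the binomial
   coefficients 6 and 1 into 8 and 3. *)
pose g w := M w ^+ 4 + (4 * (h w * (M w ^+ 3 * x w)) +
  (8 * (h w ^+ 2 * (M w ^+ 2 * x w ^+ 2)) + 3 * (h w ^+ 4 * x w ^+ 4))).
have lg3 : L1 P (fun w => 8 * (h w ^+ 2 * (M w ^+ 2 * x w ^+ 2)) + 3 * (h w ^+ 4 * x w ^+ 4)).
  by apply: L1D; exact: L1Z.
have lg2 : L1 P (fun w => 4 * (h w * (M w ^+ 3 * x w)) +
    (8 * (h w ^+ 2 * (M w ^+ 2 * x w ^+ 2)) + 3 * (h w ^+ 4 * x w ^+ 4))).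
  by apply: L1D => //; exact: L1Z.
apply: (@le_trans _ _ (Ex P g)).
  apply: Ex_le => //; first exact: L1D.
  move=> w; rewrite /g -[noise _ _ _ _]/(h w * x w) -subr_ge0.
  set a := M w; set b := h w; set c := x w.
  have -> : a ^+ 4 + (4 * (b * (a ^+ 3 * c)) + (8 * (b ^+ 2 * (a ^+ 2 * c ^+ 2))
      + 3 * (b ^+ 4 * c ^+ 4))) - (a + b * c) ^+ 4 = 2 * (b * c * (a - b * c)) ^+ 2 by ring.
  by rewrite mulr_ge0 ?sqr_ge0.
rewrite /g ExD// ExD//; last exact: L1Z.
rewrite ExD; [|exact: L1Z..]; rewrite !ExZ// EM3d EM2d2 Ed4 mulr0 add0r.
(* The weight 1 / N is put on M^4 so that one step inflates it by 1 + 1 / N only; the price is a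
   factor N on x^4, affordable because N steps then give a total of order N^2. *)
have EM2x2 : 8 * (s2 * Ex P (fun w => M w ^+ 2 * x w ^+ 2)) <=
    N%:R^-1 * Ex P (fun w => M w ^+ 4) + 16 * s2 ^+ 2 * N%:R * Ex P (fun w => x w ^+ 4).
  have -> : 8 * (s2 * Ex P (fun w => M w ^+ 2 * x w ^+ 2)) =
      Ex P (fun w => 8 * s2 * (M w ^+ 2 * x w ^+ 2)) by rewrite ExZ// mulrA.
  have -> : N%:R^-1 * Ex P (fun w => M w ^+ 4) + 16 * s2 ^+ 2 * N%:R * Ex P (fun w => x w ^+ 4)
      = Ex P (fun w => N%:R^-1 * M w ^+ 4 + 16 * s2 ^+ 2 * N%:R * x w ^+ 4).
    by rewrite ExD; [rewrite !ExZ|exact: L1Z..].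
  apply: Ex_le; [exact: L1Z|by apply: L1D; exact: L1Z|].
  move=> w; rewrite -subr_ge0; set a := M w; set c := x w.
  have -> : N%:R^-1 * a ^+ 4 + 16 * s2 ^+ 2 * N%:R * c ^+ 4 - 8 * s2 * (a ^+ 2 * c ^+ 2)
    = N%:R^-1 * (a ^+ 2 - 4 * s2 * N%:R * c ^+ 2) ^+ 2.
    by field; rewrite pnatr_eq0 -lt0n.
  by rewrite mulr_ge0 ?sqr_ge0.
have h1 : 16 * s2 ^+ 2 * N%:R * Ex P (fun w => x w ^+ 4) <=
    16 * s2 ^+ 2 * N%:R * (C4 * lam l ^+ 2).
  by rewrite ler_wpM2l// !mulr_ge0.
have h2 : kappa * Ex P (fun w => x w ^+ 4) <= N%:R * (kappa * (C4 * lam l ^+ 2)).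
  apply: (@le_trans _ _ (kappa * (C4 * lam l ^+ 2))); first by rewrite ler_wpM2l.
  by rewrite ler_peMl// !mulr_ge0// ltW// exprn_gt0.
move: EM2x2 h1 h2.
set m4 := Ex P (fun w => M w ^+ 4); set m22 := Ex P _; set x4 := Ex P _.
set cl := C4 * _; move=> EM2x2 h1 h2.
have -> : (1 + N%:R^-1) * m4 + N%:R * ((16 * s2 ^+ 2 + 3 * kappa) * cl) =
  m4 + (N%:R^-1 * m4 + 16 * s2 ^+ 2 * N%:R * cl + 3 * (N%:R * (kappa * cl))) by ring.
lra.
Qed.

Lemma noise_sum_fourth_moment y l n
    (s2 := Ex P (fun w => eta y 1 w ^+ 2)) (kappa := Ex P (fun w => eta y 1 w ^+ 4)) :
  (1 < n)%N ->
  L1 P (fun w => noise_sum y (e l) n w ^+ 4) /\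
  Ex P (fun w => noise_sum y (e l) n w ^+ 4) <=
    expR 1 * (16 * s2 ^+ 2 + 3 * kappa) * C4 * ((n.-1)%:R * lam l) ^+ 2.
Proof.
move=> n1; have N0 : (0 < n.-1)%N by case: n n1 => [|[]].
set N := n.-1 in N0 *.
have NR0 : 0 < N%:R :> R by rewrite ltr0n.
set B := (16 * s2 ^+ 2 + 3 * kappa) * (C4 * lam l ^+ 2).
have kappa0 : 0 <= kappa by apply: Ex_ge0 => w; rewrite (exprM _ 2 2) sqr_ge0.
have A0 : 0 <= 16 * s2 ^+ 2 + 3 * kappa.
  by apply: addr_ge0; apply: mulr_ge0 => //; exact: sqr_ge0.
have B0 : 0 <= B.
  by apply: mulr_ge0 => //; apply: mulr_ge0; [exact: C4_ge0|exact: sqr_ge0].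
have rec k : L1 P (fun w => noise_sum y (e l) k.+1 w ^+ 4) /\
    Ex P (fun w => noise_sum y (e l) k.+1 w ^+ 4) <=
    k%:R * (N%:R * B) * expR (N%:R^-1 *+ k).
  elim: k => [|k [lk Ek]].
    have -> : (fun w => noise_sum y (e l) 1 w ^+ 4) = (fun=> 0).
      by apply/funext => w; rewrite /noise_sum big_geq// expr0n.
    by split; [exact: L1_cst|rewrite Ex_cst !mul0r].
  have pM : past_measurable k.+1%:Z (noise_sum y (e l) k.+1).
    rewrite /past_measurable /noise_sum.
    (* [measurable_sum] asks for every index, but [noise y (e l) j] is known to be measurable for
       this past only when j <= k; outside the range the term is set to 0. *)
    have -> : (fun w => \sum_(1 <= j < k.+1) eta y j.+1%:Z w * inner (e l) (X j%:Z w)) =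
        (fun w => \sum_(1 <= j < k.+1) (if (j < k.+1)%N then noise y (e l) j w else 0)).
      by apply/funext => w; rewrite !big_nat; apply: eq_bigr => j /andP[_ ->].
    apply: measurable_sum => j; case: (ltnP j k.+1) => jk; last exact: measurable_cst.
    exact: past_noise.
  have [lS ES] := noise_fourth_step y l N0 pM lk.
  have SE : (fun w => noise_sum y (e l) k.+2 w ^+ 4) =
      (fun w => (noise_sum y (e l) k.+1 w + noise y (e l) k.+1 w) ^+ 4).
    by apply/funext => w; rewrite /noise_sum big_nat_recr.
  rewrite SE; split => //; apply: le_trans ES _.
  move: Ek; set a := Ex P (fun w => noise_sum y (e l) k.+1 w ^+ 4).
  set E := expR (N%:R^-1 *+ k) => Ek.
  have E1 : 1 <= expR (N%:R^-1 *+ k.+1) :> R.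
    by apply: le_trans (expR_ge1Dx _); rewrite lerDl mulrn_wge0.
  have E2 : (1 + N%:R^-1) * E <= expR (N%:R^-1 *+ k.+1) :> R.
    by rewrite mulrS expRD ler_wpM2r ?expR_ge0// expR_ge1Dx.
  have iN0 : 0 <= N%:R^-1 :> R by rewrite invr_ge0 ltW.
  apply: (@le_trans _ _ (k%:R * (N%:R * B) * ((1 + N%:R^-1) * E) + N%:R * B)).
    rewrite lerD2r [leRHS]mulrCA ler_wpM2l//; by rewrite addr_ge0.
  have NB0 : 0 <= N%:R * B by rewrite mulr_ge0// ltW.
  have -> : k.+1%:R * (N%:R * B) * expR (N%:R^-1 *+ k.+1) =
      k%:R * (N%:R * B) * expR (N%:R^-1 *+ k.+1)
      + N%:R * B * expR (N%:R^-1 *+ k.+1) by rewrite -natr1; ring.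
  apply: lerD.
    by rewrite ler_wpM2l// mulr_ge0.
  by rewrite ler_peMr.
have [l4 E4] := rec N; rewrite (_ : N.+1 = n) in l4 E4; last by rewrite /N prednK// ltnW.
split => //; apply: le_trans E4 _.
have NN : N%:R^-1 *+ N = 1 :> R by rewrite -(mulr_natr N%:R^-1) mulVf ?gt_eqF.
rewrite NN /B le_eqVlt; apply/orP; left; apply/eqP.
by ring.
Qed.

Lemma noise_sum_lower_bound y (s2 := Ex P (fun w => eta y 1 w ^+ 2)) : 0 < s2 ->
  exists2 c : R, 0 < c & forall l n, (1 < n)%N ->
    (c%:E <= P [set w | ((n.-1)%:R * (s2 * lam l) / 2 <= noise_sum y (e l) n w ^+ 2)%R])%E.
Proof.
move=> s20.
(* Bound on the fourth moment over the squared second moment. The powers of [lam l] and of n - 1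
   cancel in it, which is what makes [c] uniform in [l] and [n]. *)
pose K0 := expR 1 * (16 * s2 ^+ 2 + 3 * Ex P (fun w => eta y 1 w ^+ 4)) * C4 / s2 ^+ 2.
have kappa0 : 0 <= Ex P (fun w => eta y 1 w ^+ 4).
  by apply: Ex_ge0 => w; rewrite (exprM _ 2 2) sqr_ge0.
have K00 : 0 <= K0.
  apply: mulr_ge0; last by rewrite invr_ge0 sqr_ge0.
  apply: mulr_ge0 => //; apply: mulr_ge0; first exact: expR_ge0.
  by apply: addr_ge0; apply: mulr_ge0 => //; exact: sqr_ge0.
exists (4 * (K0 + 1))^-1; first by rewrite invr_gt0 mulr_gt0// ltr_pwDr.
move=> l n n1.
have [l2 E2] := noise_sum_sqr y (e l) n; rewrite Gamma_e innerZr oe eqxx mulr1 -/s2 in E2.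
have [l4 E4] := noise_sum_fourth_moment y l n1.
have N0 : 0 < (n.-1)%:R :> R by rewrite ltr0n; case: n n1 {l2 E2 l4 E4} => [|[]].
rewrite -E2; apply: (paley_zygmund (f := fun w => noise_sum y (e l) n w ^+ 2)) => //.
- by rewrite ltr_pwDr.
- by under eq_fun do rewrite -exprM.
- by move=> w; exact: sqr_ge0.
- by rewrite E2 !mulr_gt0.
under eq_fun do rewrite -exprM.
apply: le_trans E4 _; rewrite E2 -/s2.
apply: (@le_trans _ _ (K0 * ((n.-1)%:R * (s2 * lam l)) ^+ 2)).
  by rewrite /K0 le_eqVlt; apply/orP; left; apply/eqP; field; rewrite gt_eqF.
by rewrite ler_wpM2r ?sqr_ge0// lerDl.
Qed.

(** * Linearization of the estimator *)

Variables (k : nat -> nat) (lamh : nat -> nat -> Omega -> R).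
Variables (eh : nat -> nat -> Omega -> H).
Hypothesis k_gt0 : forall n, (0 < k n)%N.
Hypothesis k_infty : k n @[n --> \oo] --> \oo.
Hypothesis emp_eigen : forall n w, (0 < n)%N ->
  eigensystem (emp_cov X n w) (fun l => lamh n l w) (fun l => eh n l w).

Let rhoh := rho_est X k lamh eh.

Let gap l y n w : R :=
  inner y ((rhoh n w - rho) (lam l *: e l)) - inner (noise_vector rho X n y w) (e l).

Let small_ratio l : small P (fun n w =>
  `|emp_cov X n w (e l) - lam l *: e l| + mean_sq_norm X n w / (k n)%:R).
Proof.
apply: smallD; first exact: emp_cov_small.
apply: tightM_small; first exact: mean_sq_norm_tight.
apply: small_cvg0.
exact: (cvg_comp _ _ k_infty (@cvg_invn R)).
Qed.

Let small_edge_rate : small P (fun n w => Num.sqrt n%:R *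
  ((mean_sq_norm X n w + `|X n%:Z w| ^+ 2) / (n.-1)%:R)).
Proof.
(* Here sqrt n / (n - 1) <= 2 / sqrt n is used, valid from n = 2 on. *)
apply: (@small_le _ _ _ P _ (fun n w =>
    (mean_sq_norm X n w + `|X n%:Z w| ^+ 2) * (2 * (Num.sqrt n%:R)^-1))).
  exists 2%N => // -[//|[//|n]] _ w; set N := n.+2.
  rewrite mulrCA ger0_norm; last first.
    by rewrite !mulr_ge0 ?sqrtr_ge0// addr_ge0 ?mean_sq_norm_ge0 ?sqr_ge0.
  rewrite ler_wpM2l//; first by rewrite addr_ge0 ?mean_sq_norm_ge0 ?sqr_ge0.
  have s0 : 0 < Num.sqrt N%:R :> R by rewrite sqrtr_gt0 ltr0n.
  rewrite ler_pdivrMr ?ltr0n// mulrAC ler_pdivlMr// -expr2 sqr_sqrtr//.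
  by rewrite -natrM ler_nat /N /= mul2n -addnn addSnnS leq_addl.
apply: tightM_small.
  by apply: tightD; [exact: mean_sq_norm_tight|exact: X_normsq_tight].
apply: tightM_small; first exact: tight_cst.
apply: small_cvg0; apply/cvgr0Pnorm_le => r r0.
have e20 : 0 < r ^+ 2 by rewrite exprn_gt0.
have := @cvg_invn R; move=> /cvgr0Pnorm_le/(_ _ e20); apply: filterS => n.
rewrite !ger0_norm ?invr_ge0 ?sqrtr_ge0// => h.
rewrite -(@ler_pXn2r _ 2)// ?nnegrE ?invr_ge0 ?sqrtr_ge0 ?(ltW r0)//.
by rewrite exprVn sqr_sqrtr.
Qed.

Section normalization.
Variable alpha : nat -> R.
Hypothesis tight_alpha : tight P (fun n w => `|alpha n| * `|rhoh n w - rho|).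

(** Bounded by |alpha_n| where it multiplies |rho_n - rho|, and by sqrt n where it multiplies the
    noise or the edge term: each error in [gap] is then a tight factor times a negligible one. *)
Let rate n : R := Num.min `|alpha n| (Num.sqrt n%:R).

Let rate_ge0 n : 0 <= rate n.
Proof. by rewrite le_min normr_ge0 sqrtr_ge0. Qed.

Let gap_small l y : small P (fun n w => rate n * gap l y n w).
Proof.
pose D n w := `|emp_cov X n w (e l) - lam l *: e l|.
pose T n w := mean_sq_norm X n w.
pose V n w := `|noise_vector rho X n y w|.
pose dl n w := D n w + T n w / (k n)%:R.
apply: (@small_le _ _ _ P _ (fun n w =>
   `|y| * ((`|alpha n| * `|rhoh n w - rho|) * dl n w) +
   ((lam l)^-1 * ((Num.sqrt n%:R * V n w) * dl n w) +
   `|rho| * `|y| * (Num.sqrt n%:R * ((T n w + `|X n%:Z w| ^+ 2) / (n.-1)%:R))))).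
  exists 2%N => // n /= n1 w.
  have := @estimator_expansion _ _ _ rho X n w (fun l => lamh n l w)
    (fun l => eh n l w) n1 (emp_eigen w (ltnW n1)) (k n) (e l) y (lam l) (k_gt0 n)
    (orthonormal_norm oe l) (lam_gt0 l).
  rewrite -/(D n w) -/(T n w) -/(V n w) -/(dl n w) => hexp.
  have ra : rate n <= `|alpha n| by rewrite ge_min lexx.
  have rs : rate n <= Num.sqrt n%:R by rewrite ge_min lexx orbT.
  have T0 : 0 <= T n w by exact: mean_sq_norm_ge0.
  have dl0 : 0 <= dl n w by apply: addr_ge0; [exact: normr_ge0|exact: divr_ge0].
  rewrite -[comp_op _ _ - rho]/(rhoh n w - rho) in hexp.
  rewrite normrM (ger0_norm (rate_ge0 n)).
  apply: le_trans (ler_wpM2l (rate_ge0 n) hexp) _ => {hexp}.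
  move: (dl n w) dl0 => q q0; set E := (T n w + _) / _.
  have E0 : 0 <= E by rewrite divr_ge0// addr_ge0 ?sqr_ge0.
  have V0 : 0 <= V n w by exact: normr_ge0.
  set o := `|rhoh n w - rho|.
  rewrite -[opnorm (rhoh n w - rho)]/o -[opnorm rho]/(`|rho|).
  have o0 : 0 <= o by exact: normr_ge0.
  have -> : rate n * (o * `|y| * q + V n w * (q / lam l) + `|rho| * `|y| * E) =
    `|y| * ((rate n * o) * q) + ((lam l)^-1 * ((rate n * V n w) * q)
      + `|rho| * `|y| * (rate n * E)) by ring.
  apply: lerD; last apply: lerD.
  - by rewrite ler_wpM2l// ler_wpM2r// ler_wpM2r.
  - by rewrite ler_wpM2l ?invr_ge0 ?(ltW (lam_gt0 l))// ler_wpM2r// ler_wpM2r.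
  - by rewrite ler_wpM2l ?mulr_ge0// ler_wpM2r.
apply: smallD.
  apply: tightM_small; first exact: tight_cst.
  by apply: tightM_small => //; exact: small_ratio.
apply: smallD.
  apply: tightM_small; first exact: tight_cst.
  by apply: tightM_small; [exact: noise_vector_tight|exact: small_ratio].
by apply: tightM_small; [exact: tight_cst|exact: small_edge_rate].
Qed.

Hypothesis lam_cvg0 : lam l @[l --> \oo] --> 0.

Let gapE l y n w : inner y ((rhoh n w - rho) (lam l *: e l)) =
  gap l y n w + inner (noise_vector rho X n y w) (e l).
Proof. by rewrite /gap subrK. Qed.

(* For [alpha n >= c sqrt n] the variables [sqrt n <V_n, e l> / lam l] would be
   bounded in probability uniformly in [l], while they have order
   [1 / sqrt (lam l)]. *)
Lemma normalization_below_sqrt (c : R) : 0 < c ->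
  ~ \forall n \near \oo, c * Num.sqrt n%:R <= alpha n.
Proof.
move=> c0 ca; have [l0 s20] := innovation_nondegenerate.
set y := e l0 in s20; set s2 := Ex P _ in s20.
have y1 : `|y| = 1 by exact: orthonormal_norm.
have [p p0 plow] := noise_sum_lower_bound s20.
(* Since c1 sqrt n <= rate n, the bound c1 lam_l on [rate n * gap] becomes lam_l on sqrt n times the
   gap. *)
pose c1 := Num.min 1 c.
have c10 : 0 < c1 by rewrite lt_min ltr01.
(* Two exceptional events of probability at most p / 4 cannot cover an event of probability at least
   p. *)
have p40 : 0 < p / 4 by rewrite divr_gt0.
have [M tM] := tight_alpha p40.
(* [M] is fixed before [l]. Off the exceptional events n <V_n, e_l>^2 <= lam_l^2 B, while the lower
   bound is s2 lam_l / 2; they are incompatible once lam_l < s2 / (2 B). *)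
pose B := (1 + `|M| / c) ^+ 2.
have B0 : 0 < B by rewrite exprn_gt0// ltr_pwDl// divr_ge0// ltW.
have B20 : 0 < 2 * B by apply: mulr_gt0.
have sB0 : 0 < s2 / (2 * B) by rewrite divr_gt0.
have [l _ /(_ l (leqnn l)) lamB] := cvgr0_norm_lt _ lam_cvg0 _ sB0.
rewrite ger0_norm ?(ltW (lam_gt0 l))// in lamB.
have cl0 : 0 < c1 * lam l by rewrite mulr_gt0.
have bad := @gap_small l y _ _ cl0 p40.
near \oo => n.
have n1 : (1 < n)%N by near: n; exact: nbhs_infty_gt.
have can : c * Num.sqrt n%:R <= alpha n by near: n.
have [A1 [mA1 PA1 hA1]] : bounded_off P (p / 4) M
  (fun w => `|alpha n| * `|rhoh n w - rho|) by near: n.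
have [A2 [mA2 PA2 hA2]] : bounded_off P (p / 4) (c1 * lam l)
  (fun w => rate n * gap l y n w) by near: n.
set s := Num.sqrt n%:R in can.
have s0 : 0 < s by rewrite sqrtr_gt0 ltr0n ltnW.
have a0 : 0 <= alpha n by apply: le_trans can; rewrite mulr_ge0 ?ltW.
have sub : [set w | (n.-1)%:R * (s2 * lam l) / 2 <= noise_sum y (e l) n w ^+ 2]
    `<=` A1 `|` A2.
  move=> w /= hw; apply: contrapT => /not_orP[/hA1 h1 /hA2 h2].
  have ssq : s ^+ 2 = n%:R by rewrite sqr_sqrtr.
  have rn : c1 * s <= rate n.
    rewrite le_min; apply/andP; split.
      rewrite (ger0_norm a0); apply: le_trans can; rewrite ler_wpM2r ?(ltW s0)//.
      by rewrite ge_min lexx orbT.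
    by rewrite -/s ger_pMl// ge_min lexx.
  have g1 : s * `|gap l y n w| <= lam l.
    rewrite -(@ler_pM2l _ c1)// mulrA; apply: le_trans h2.
    by rewrite normrM (ger0_norm (rate_ge0 n)) ler_wpM2r.
  have o1 : s * `|rhoh n w - rho| <= `|M| / c.
    rewrite ler_pdivlMr// mulrAC [s * c]mulrC.
    apply: (@le_trans _ _ (`|alpha n| * `|rhoh n w - rho|)).
      by rewrite ler_wpM2r// (ger0_norm a0).
    apply: le_trans (ler_norm _) _; apply: le_trans h1 _; exact: ler_norm.
  have v1 : s * `|inner (noise_vector rho X n y w) (e l)| <= lam l * (1 + `|M| / c).
    have -> : inner (noise_vector rho X n y w) (e l) =
      inner y ((rhoh n w - rho) (lam l *: e l)) - gap l y n w.
      by rewrite gapE addrC addKr.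
    apply: le_trans (ler_wpM2l (ltW s0) (ler_normB _ _)) _.
    rewrite mulrDr mulrDr mulr1 addrC; apply: lerD => //.
    apply: (@le_trans _ _ (lam l * (s * `|rhoh n w - rho|))); last first.
      by rewrite ler_wpM2l// ltW.
    have := inner_CauchySchwarz y ((rhoh n w - rho) (lam l *: e l)).
    rewrite y1 mul1r => /le_trans h.
    have := ler_opnorm (rhoh n w - rho) (lam l *: e l).
    rewrite normrZ (orthonormal_norm oe) mulr1 (ger0_norm (ltW (lam_gt0 l))).
    move=> /h{h} h; rewrite mulrCA ler_wpM2l ?(ltW s0)//.
    by rewrite mulrC.
  have v2 : s2 * lam l / 2 <= (s * `|inner (noise_vector rho X n y w) (e l)|) ^+ 2.
    rewrite exprMn ssq real_normK ?num_real// innerC inner_noise_sum exprMn.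
    have N0 : 0 < (n.-1)%:R :> R by rewrite ltr0n; case: (n) n1 => [|[]].
    apply: (@le_trans _ _ (n%:R * ((n.-1)%:R^-1 ^+ 2 * ((n.-1)%:R * (s2 * lam l) / 2)))).
      have -> : n%:R * ((n.-1)%:R^-1 ^+ 2 * ((n.-1)%:R * (s2 * lam l) / 2)) =
         (n%:R / (n.-1)%:R) * (s2 * lam l / 2) by field; rewrite gt_eqF.
      rewrite ler_peMl//; first by rewrite divr_ge0// mulr_ge0 ?ltW.
      by rewrite ler_pdivlMr// mul1r ler_nat leq_pred.
    by rewrite !ler_wpM2l// sqr_ge0.
  have : s2 * lam l / 2 <= lam l ^+ 2 * B.
    have q0 : 0 <= 1 + `|M| / c by rewrite addr_ge0// divr_ge0// ltW.
    apply: le_trans v2 _; rewrite /B -exprMn.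
    by rewrite lerXn2r ?nnegrE ?mulr_ge0 ?(ltW s0) ?(ltW (lam_gt0 l)).
  have -> : lam l ^+ 2 * B = lam l * (lam l * B) by ring.
  have -> : s2 * lam l / 2 = lam l * (s2 / 2) by ring.
  rewrite ler_pM2l//; apply/negP; rewrite -ltNge.
  move: lamB; rewrite ltr_pdivlMr// => h; lra.
have := plow l n n1; apply/negP; rewrite -ltNge.
apply: le_lt_trans (_ : _ <= P (A1 `|` A2))%E _.
  apply: le_measure; rewrite ?inE//; last exact: measurableU.
  apply: measurable_ge; apply: measurable_funX.
  by apply: measurable_sum => j; exact: noise_meas.
apply: le_lt_trans (measureU2 _ mA1 mA2) _.
apply: le_lt_trans (leeD PA1 PA2) _.
rewrite -EFinD lte_fin; lra.
Unshelve. all: by end_near. Qed.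

(** The conditions on [alpha n] stand inside the eventual quantifier because they may hold only
    along a subsequence. With c <= 1 the rate is [alpha n]; the other bound on [c] makes alpha_n
    <V_n, e_l> at most lam_l eps0 / 2. *)
Lemma coefficient_bound l y (eps0 : R) : 0 < eps0 ->
  exists2 c : R, 0 < c & \forall n \near \oo, 0 <= alpha n -> alpha n <= c * Num.sqrt n%:R ->
    bounded_off P eps0 eps0 (fun w => inner y ((alpha n *: (rhoh n w - rho)) (e l))).
Proof.
move=> eps00; have e20 : 0 < eps0 / 2 by rewrite divr_gt0.
have ll := lam_gt0 l.
have [M tM] := noise_vector_tight y e20.
have le0 : 0 < lam l * (eps0 / 2) by rewrite mulr_gt0.
have M0 : 0 < `|M| + 1 by rewrite ltr_pwDr.
pose c := Num.min 1 (lam l * (eps0 / 2) / (`|M| + 1)).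
have c0 : 0 < c by rewrite lt_min ltr01/= divr_gt0.
have bad := @gap_small l y _ _ le0 e20.
exists c => //; near=> n => a0 ac.
rewrite {1}(splitr eps0).
apply: (@bounded_off2 _ _ _ P _ _ (lam l * (eps0 / 2)) M _
  (fun w => rate n * gap l y n w) (fun w => Num.sqrt n%:R * `|noise_vector rho X n y w|)).
- move=> w h1 h2; rewrite scale_compact_op innerZr.
  have s0 : 0 <= Num.sqrt n%:R :> R by exact: sqrtr_ge0.
  have as_ : alpha n <= Num.sqrt n%:R.
    by apply: le_trans ac _; rewrite ler_piMl// ge_min lexx.
  have rE : rate n = alpha n by rewrite /rate (ger0_norm a0) min_l.
  rewrite rE normrM (ger0_norm a0) in h1.
  have -> : alpha n * inner y ((rhoh n w - rho) (e l)) =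
      (lam l)^-1 * (alpha n * inner y ((rhoh n w - rho) (lam l *: e l))).
    by rewrite compact_op_linZ innerZr; field; rewrite gt_eqF.
  rewrite gapE normrM ger0_norm ?invr_ge0 ?(ltW ll)// ler_pdivrMl//.
  rewrite mulrDr; apply: le_trans (ler_normD _ _) _.
  have -> : lam l * eps0 = lam l * (eps0 / 2) + lam l * (eps0 / 2) by field.
  apply: lerD; first by rewrite normrM (ger0_norm a0).
  rewrite normrM (ger0_norm a0).
  apply: (@le_trans _ _ (c * (`|M| + 1))); last first.
    by rewrite -ler_pdivlMr// ge_min lexx orbT.
  apply: le_trans (ler_wpM2l a0 (inner_CauchySchwarz _ _)) _.
  rewrite (orthonormal_norm oe) mulr1.
  apply: le_trans (ler_wpM2r (normr_ge0 _) ac) _.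
  rewrite -mulrA ler_wpM2l ?(ltW c0)//.
  apply: le_trans (ler_norm _) _; apply: le_trans h2 _.
  by have := ler_norm M; lra.
- by near: n.
- by near: n.
Unshelve. all: by end_near. Qed.

End normalization.

(** * Identification of the limit law *)

Hypothesis lam_cvg0 : lam l @[l --> \oo] --> 0.
Hypothesis rho_est_meas : forall n, random_element (rho_est X k lamh eh n).
Variable alpha : nat -> R.
Hypothesis alpha_infty : alpha n @[n --> \oo] --> +oo.
Variable mu : probability (borel (compact_op H)) R.
Hypothesis law_mu :
  cvg_in_law P (fun n w => alpha n *: (rho_est X k lamh eh n w - rho)) mu.

Let Z n w : compact_op H := alpha n *: (rho_est X k lamh eh n w - rho).

Let Z_meas n : random_element (Z n).
Proof.
move=> _ A mA; rewrite setTI.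
have cg : continuous (fun T : compact_op H => alpha n *: (T - rho)).
  apply: (@lipschitz_continuous _ _ _ `|alpha n|) => S T.
  by rewrite -scalerBr opprB addrA subrK normrZ.
by have := @rho_est_meas n measurableT _ (continuous_borel_preimage cg mA);
  rewrite setTI.
Qed.

Let coeff i j (T : compact_op H) : R := inner (e i) (T (e j)).

Let coeff_continuous i j : continuous (fun T => `|coeff i j T|).
Proof.
apply: (@lipschitz_continuous _ _ _ 1) => S T.
apply: le_trans (ler_dist_dist _ _) _; rewrite /coeff -innerBr.
apply: le_trans (inner_CauchySchwarz _ _) _.
rewrite (orthonormal_norm oe) !mul1r.
by have := ler_opnorm (S - T) (e j); rewrite (orthonormal_norm oe) mulr1.
Qed.

(** Capped at 1 to be a bounded continuous test function with the same zeros as the coefficient. *)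
Let phi i j (T : compact_op H) : R := Num.min 1 `|coeff i j T|.

Let phi_continuous i j : continuous (phi i j).
Proof.
move=> T; apply: (@continuous_min _ _ (fun=> 1 : R) (fun T => `|coeff i j T|)).
  exact: cst_continuous.
exact: coeff_continuous.
Qed.

Let phi_ge0 i j T : 0 <= phi i j T.
Proof. by rewrite le_min ler01 normr_ge0. Qed.

Let phi_le1 i j T : `|phi i j T| <= 1.
Proof. by rewrite ger0_norm// ge_min lexx. Qed.

Let phi_L1 i j : L1 mu (phi i j).
Proof.
apply: (L1_bounded mu _ (phi_le1 i j)).
exact: (continuous_real_measurable (@phi_continuous i j)).
Qed.

(** If the integral I were positive, the expectations along [Z n] would eventually exceed I / 2.
    Wherever alpha_n <= c sqrt n they are at most I / 8 + I / 8, so alpha_n > c sqrt n eventually,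
    which [normalization_below_sqrt] forbids. *)
Let Ex_phi i j : Ex mu (phi i j) = 0.
Proof.
apply/eqP; rewrite eq_le; apply/andP; split; last by apply: Ex_ge0 => T; exact: phi_ge0.
rewrite leNgt; apply/negP => I0; set I := Ex mu _ in I0.
have talpha : tight P (fun n w => `|alpha n| * `|rho_est X k lamh eh n w - rho|).
  apply: (@tight_le _ _ _ P _ (fun n w => `|Z n w|)); last first.
    exact: (cvg_in_law_tight Z_meas law_mu).
  by apply: nearW => n w; rewrite ger0_norm ?mulr_ge0// /Z normrZ.
have r0 : 0 < I / 8 by rewrite divr_gt0.
have [c c0 hc] := coefficient_bound talpha j (e i) r0.
apply: (normalization_below_sqrt talpha lam_cvg0 c0).
have Icvg := cvg_in_law_expectation law_mu (@phi_continuous i j) (phi_le1 i j).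
have I2 : I / 2 < I by rewrite ltr_pdivrMr// ltr_pMr// ltr1n.
have hI := cvgr_gt _ Icvg _ I2.
have ha : \forall n \near \oo, 0 <= alpha n.
  by move/cvgryPge : alpha_infty; exact.
near=> n; rewrite leNgt; apply/negP => /ltW ac.
have a0 : 0 <= alpha n by near: n.
have bo : bounded_off P (I / 8) (I / 8)
    (fun w => inner (e i) ((alpha n *: (rho_est X k lamh eh n w - rho)) (e j))).
  by move: a0 ac; near: n.
have IZ : I / 2 < Ex P (fun w => phi i j (Z n w)) by near: n; exact: hI.
have mphi : measurable_fun setT (fun w => phi i j (Z n w)).
  exact: (random_element_measurable (Z_meas n) (@phi_continuous i j)).
have : Ex P (fun w => phi i j (Z n w)) <= I / 8 + I / 8.
  apply: (Ex_bounded_off bo) => //.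
  - exact: (L1_bounded P mphi (fun w => phi_le1 i j (Z n w))).
  - by move=> w; rewrite ge_min lexx.
  - by move=> w; rewrite ge_min lexx orbT.
  - exact: ltW.
lra.
Unshelve. all: by end_near. Qed.

Let coeff_ae0 i j : {ae mu, forall T : borel (compact_op H), coeff i j T = 0}.
Proof.
have mphi : measurable_fun setT (phi i j : borel (compact_op H) -> R).
  exact: continuous_real_measurable (@phi_continuous i j).
have mE : measurable_fun setT (fun T : borel (compact_op H) => (phi i j T)%:E).
  exact/measurable_EFinP.
have : (\int[mu]_T `|(phi i j T)%:E| = 0)%E.
  under eq_integral do rewrite /= ger0_norm//.
  by rewrite (Ex_fin (phi_L1 i j)) Ex_phi.
move/(ae_eq_integral_abs mu measurableT mE); apply: filterS => T /(_ I)[] /eqP.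
rewrite /phi minEle; case: ifP => _; first by rewrite oner_eq0.
by rewrite normr_eq0 => /eqP.
Qed.

Lemma limit_law_dirac :
  cvg_in_law P Z \d_((0 : compact_op H) : borel (compact_op H)).
Proof.
(* The coefficients are countably many, so they vanish simultaneously almost everywhere; [T] then
   kills every [e j], hence everything by continuity. *)
have Tae : {ae mu, forall T : borel (compact_op H), T = 0 :> compact_op H}.
  have : {ae mu, forall (T : borel (compact_op H)) i j, coeff i j T = 0}.
    apply/ae_foralln => i; apply/ae_foralln => j; exact: coeff_ae0.
  apply: filterS => T T0; apply/val_inj/funext => x /=.
  have Te j : (T : compact_op H) (e j) = 0.
    by have [_] := e_complete; apply => i; exact: T0.
  have h : (T : compact_op H) (\sum_(i < n) inner (e i) x *: e i) @[n --> \oo] -->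
      (T : compact_op H) x.
    apply: (cvg_comp _ _ (complete_orthonormal_cvg e_complete)).
    exact: compact_op_continuous.
  apply: (cvg_unique _ h); first exact: norm_hausdorff.
  apply: cvg_near_cst; apply: nearW => n.
  by rewrite compact_op_sum big1// => i _; rewrite compact_op_linZ Te scaler0.
move=> f cf fb; have := law_mu cf fb.
have mf : measurable_fun setT (fun T : borel (compact_op H) => (f T)%:E).
  by apply/measurable_EFinP; exact: continuous_real_measurable.
rewrite integral_dirac// diracT mul1e.
suff -> : (\int[mu]_T (f T)%:E = (f 0)%:E)%E by [].
rewrite (ae_eq_integral (fun=> (f 0)%:E))//.
  rewrite (integral_cst mu measurableT); apply: etrans (mule1 _).
  by congr (_ * _)%E; exact: probability_setT.
by apply: filterS Tae => T -> _.
Qed.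

End autoregression.

Theorem theorem3p1 (R : realType) (H : hilbertType R)
  (Hsep : separable_space H) (Hinf : infinite_dimensional H)
  (d : measure_display) (Omega : measurableType d) (P : probability Omega R)
  (rho : compact_op H)
  (eps X : int -> Omega -> H)
  (eps_meas : forall n, random_element (eps n))
  (X_meas : forall n, random_element (X n))
  (eps_iid : iid P eps)
  (eps_centered : forall n, is_mean P (eps n) 0)
  (X_stationary : strictly_stationary P X)
  (X_centered : forall n, is_mean P (X n) 0)
  (X_ar : forall n, {ae P, forall w, X n w = rho (X (n - 1) w) + eps n w})
  (eps_indep : forall n, independent_of_past P (eps n) X (n - 1))
  (* [lam l] and [e l] are lambda_{l+1} and e_{l+1} of the usual indexing *)
  (Gamma : H -> H)
  (Gamma_cov : is_mean_op P (fun w => tensor (X 1 w) (X 1 w)) Gamma)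
  (lam : nat -> R) (e : nat -> H)
  (Gamma_eigen : eigensystem Gamma lam e)
  (e_complete : complete_orthonormal e)
  (A0_ker : forall x, Gamma x = 0 -> x = 0)
  (A0_eps : (\int[P]_w (`|eps 1 w| ^+ 2)%:E < +oo)%E)
  (A0_rho : `|rho| < 1)
  (Gamma12 : H -> H)
  (Gamma12_sqrt : positive_sqrt Gamma Gamma12)
  (A1 : bounded_inv_comp Gamma12 rho)
  (A2 : (ereal_sup (range (fun k : nat =>
           \int[P]_w ((inner (X 1 w) (e k) / Num.sqrt (lam k)) ^+ 4)%:E))
         < +oo)%E)
  (A3 : exists lamf : R -> R,
     [/\ forall x, 0 <= x -> 0 < lamf x,
         convex_function (`[0, +oo[%classic : set R^o) lamf,
         {in `[0, +oo[ &, {homo lamf : x y / x < y >-> y < x}},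
         lamf x @[x --> +oo] --> 0 &
         forall j : nat, lam j = lamf j.+1%:R])
  (* likewise, the empirical eigenelements are indexed from 0 *)
  (k : nat -> nat)
  (k_gt0 : forall n, (0 < k n)%N)
  (k_homo : {homo k : m n / (m <= n)%N})
  (k_infty : k n @[n --> \oo] --> \oo)
  (lamh : nat -> nat -> Omega -> R) (eh : nat -> nat -> Omega -> H)
  (emp_eigen : forall n w, (0 < n)%N ->
     eigensystem (emp_cov X n w) (fun l => lamh n l w) (fun l => eh n l w))
  (rho_est_meas : forall n, random_element (rho_est X k lamh eh n))
  (alpha : nat -> R)
  (alpha_homo : {homo alpha : m n / (m <= n)%N >-> m <= n})
  (alpha_infty : alpha n @[n --> \oo] --> +oo) :
  (~ exists mu : probability (borel (compact_op H)) R,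
       cvg_in_law P (fun n w => alpha n *: (rho_est X k lamh eh n w - rho)) mu)
  \/ cvg_in_law P (fun n w => alpha n *: (rho_est X k lamh eh n w - rho))
       \d_((0 : compact_op H) : borel (compact_op H)).
Proof.
case: (pselect (exists mu : probability (borel (compact_op H)) R,
    cvg_in_law P (fun n w => alpha n *: (rho_est X k lamh eh n w - rho)) mu));
  last by left.
move=> [mu law_mu]; right.
have [adj [adjE adj_norm]] := adjoint_exists rho e_complete.
have [lamf [lamf_gt0 _ _ lamf_cvg0 lamE]] := A3.
have lam_gt0 l : 0 < lam l by rewrite lamE lamf_gt0.
have lam_cvg0 : lam l @[l --> \oo] --> 0.
  have h : (l.+1%:R : R) @[l --> \oo] --> +oo.
    apply/cvgryPge => A; near=> l.
    have : A <= l%:R by near: l; exact: nbhs_infty_ger.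
    by move/le_trans; apply; rewrite ler_nat.
  rewrite (_ : lam = (fun l => lamf l.+1%:R)); last exact/funext.
  exact: (cvg_comp _ _ h lamf_cvg0).
have Gamma_e l : Gamma (e l) = lam l *: e l by have [_ + _ _] := Gamma_eigen; exact.
set S := ereal_sup _ in A2.
have xi4 l : (\int[P]_w ((inner (X 1 w) (e l) / Num.sqrt (lam l)) ^+ 4)%:E <= S)%E.
  by apply: ereal_sup_ubound; exists l.
have xi4_ge0 l w : 0 <= (inner (X 1 w) (e l) / Num.sqrt (lam l)) ^+ 4.
  by rewrite (exprM _ 2 2) sqr_ge0.
(* Finiteness lets [fine S] serve as the constant [C4]; multiplying by lam_l^2 undoes the
   normalization of the coordinates. *)
have S_fin : S \is a fin_num.
  rewrite ge0_fin_numE//; apply: le_trans (xi4 0%N).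
  by apply: integral_ge0 => w _; rewrite lee_fin.
have coord4 l : L1 P (fun w => inner (e l) (X 1 w) ^+ 4) /\
    Ex P (fun w => inner (e l) (X 1 w) ^+ 4) <= fine S * lam l ^+ 2.
  have mxi : measurable_fun setT (fun w => (inner (X 1 w) (e l) / Num.sqrt (lam l)) ^+ 4).
    apply: measurable_funX; apply: measurable_funM => //.
    under eq_fun do rewrite innerC.
    exact: (random_element_measurable (X_meas 1) (@inner_continuous _ _ (e l))).
  have lxi : L1 P (fun w => (inner (X 1 w) (e l) / Num.sqrt (lam l)) ^+ 4).
    by apply: L1_fin => //; exact: le_lt_trans (xi4 l) A2.
  have -> : (fun w => inner (e l) (X 1 w) ^+ 4) =
      (fun w => lam l ^+ 2 * (inner (X 1 w) (e l) / Num.sqrt (lam l)) ^+ 4).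
    apply/funext => w; rewrite innerC expr_div_n.
    rewrite (_ : Num.sqrt (lam l) ^+ 4 = lam l ^+ 2).
      by rewrite mulrC divfK// expf_neq0// gt_eqF.
    by rewrite (exprM _ 2 2) sqr_sqrtr// ltW.
  split; first exact: L1Z.
  rewrite ExZ// mulrC ler_wpM2r ?sqr_ge0//.
  by rewrite -lee_fin -Ex_fin// fineK.
exact: (limit_law_dirac eps_meas X_meas eps_iid.2 eps_centered X_stationary X_ar
  eps_indep Gamma_cov adjE e_complete Gamma_e lam_gt0 coord4 adj_norm A0_rho
  k_gt0 k_infty emp_eigen lam_cvg0 rho_est_meas alpha_infty law_mu).
Unshelve. all: by end_near. Qed.
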